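(* Let $\{\xi_n\}_{n\ge0}$ be a stationary Markov chain with a finite state space $\mathcal X$, stationary distribution $\mu$ and matrix of transition probabilities $\Pi=(p_{ij})_{i,j\in\mathcal X}$ such that for some $k$ the matrix $\Pi^k=(p^{(k)}_{ij})_{i,j\in\mathcal X}$ has all entries positive, and such that, for an integer $\ell\ge1$, $$\min_{i,j}\sum_k\min\big(p^{(\ell)}_{ik},p^{(\ell)}_{jk}\big)>0\quad\text{and}\quad\min_{i,j}\sum_k\min\big(p^{(\ell)}_{ki},p^{(\ell)}_{kj}\big)>0.$$ Let $F:\mathcal X^\ell\to\mathbb R$ satisfy $\int F\,d\mu^\ell=0$ and assume that $F_\ell$ does not equal zero identically. Put $S_N=\sum_{n=1}^NF(\xi_n,\xi_{2n},\dots,\xi_{\ell n})$ and $\sigma^2=\lim_{N\to\infty}\frac1N\mathrm{var}\,S_N$, $\sigma\ge 0$. Then both in the lattice case and in the non-lattice case (as defined in the context), for any real continuous function $g$ on $\mathbb R$ with compact support, $$\lim_{N\to\infty}\sup_u\Big|\sigma\sqrt{2\pi N}\,Eg(S_N-u)-e^{-\frac{u^2}{2N\sigma^2}}\int g\,d\mathcal L_h\Big|=0,$$ where in the lattice case the supremum is taken over $u\in\{kh:\,k\in\mathbb Z\}$ and $\mathcal L_h$, $h>0$, is the measure assigning mass $h$ to each point $kh$, $k\in\mathbb Z$, while in the non-lattice case the supremum is taken over all real $u$, $h=0$ and $\mathcal L_0$ is the Lebesgue measure on $\mathbb R$.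
   Context: The chain is defined on a probability space $(\Omega,\mathcal F,P)$ and $\xi_0$ has distribution $\mu$; $\mu^k=\mu\times\cdots\times\mu$ ($k$ times). $p^{(n)}_{ij}$ denotes the $(i,j)$ entry of $\Pi^n$. The limit defining $\sigma^2$ exists under the stated hypotheses. The function $F_\ell$ is $$F_\ell(x_1,\dots,x_\ell)=F(x_1,\dots,x_\ell)-\int F(x_1,\dots,x_\ell)\,d\mu(x_\ell).$$ Lattice and non-lattice cases. For $x_1,\dots,x_{\ell-1}\in\mathcal X$ set $$A_{x_1,\dots,x_{\ell-1}}=\{h\ge0:\ F(x_1,\dots,x_{\ell-1},x)\in\{kh:k\in\mathbb Z\}\ \text{for }\mu\text{-almost all }x\in\mathcal X\},$$ $$B_{x_1,\dots,x_{\ell-1}}=\{h\ge0:\ F(x_1,\dots,x_{\ell-1},x)-F(x_1,\dots,x_{\ell-1},y)\in\{kh:k\in\mathbb Z\}\ \text{for }\mu^2\text{-almost all }(x,y)\in\mathcal X^2\},$$ and, if $B_{x_1,\dots,x_{\ell-1}}\ne\emptyset$, $h(x_1,\dots,x_{\ell-1})=\sup\{h:\,h\in B_{x_1,\dots,x_{\ell-1}}\}$. The case is called a lattice one if there exists $h>0$ such that $$h(x_1,\dots,x_{\ell-1})=h\in A_{x_1,\dots,x_{\ell-1}}\quad\text{for }\mu^{\ell-1}\text{-almost all }(x_1,\dots,x_{\ell-1}).$$ The case is called a non-lattice one if $\mu^{\ell-1}\{(x_1,\dots,x_{\ell-1}):\,B_{x_1,\dots,x_{\ell-1}}=\emptyset\}>0$.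 (When $\ell=1$ the parameters $x_1,\dots,x_{\ell-1}$ are absent.) Other cases are not considered. *)

(* Defs.v *)
From HB Require Import structures.
From mathcomp Require Import all_boot all_order all_algebra.
From mathcomp Require Import all_classical all_reals all_analysis.

Set Implicit Arguments.
Unset Strict Implicit.
Unset Printing Implicit Defensive.

Import Order.TTheory GRing.Theory Num.Theory.
Import numFieldNormedType.Exports.

Local Open Scope classical_set_scope.
Local Open Scope ring_scope.

Definition trans_mx (R : realType) (X : finType) (p : X -> X -> R) :
  'M[R]_#|X| := \matrix_(a, b) p (enum_val a) (enum_val b).

Definition trans_prob (R : realType) (X : finType) (p : X -> X -> R)
  (n : nat) (i j : X) : R := (trans_mx p ^+ n) (enum_rank i) (enum_rank j).

(* The last field is the Markov property with transition matrix p, multiplied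
   out so that histories of probability 0 need no special treatment. *)
Record stationary_markov_chain (R : realType) (d : measure_display)
    (Omega : measurableType d) (P : probability Omega R) (X : finType)
    (xi : nat -> Omega -> X) (mu : X -> R) (p : X -> X -> R) : Prop := {
  smc_distr_ge0 : forall x, 0 <= mu x ;
  smc_distr_sum1 : \sum_x mu x = 1 ;
  smc_trans_ge0 : forall x y, 0 <= p x y ;
  smc_trans_sum1 : forall x, \sum_y p x y = 1 ;
  smc_stationary : forall y, \sum_x mu x * p x y = mu y ;
  smc_measurable : forall n x, measurable (xi n @^-1` [set x]) ;
  smc_initial : forall x, P (xi 0%N @^-1` [set x]) = (mu x)%:E ;
  smc_markov : forall (n : nat) (s : nat -> X),
    P [set w | forall i, (i <= n.+1)%N -> xi i w = s i] =
    (P [set w | forall i, (i <= n)%N -> xi i w = s i]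
       * (p (s n) (s n.+1))%:E)%E }.

(* Measures on finite spaces are given by their point masses. *)
Definition pmf_measure (R : realType) (T : finType) (nu : T -> R)
  (A : set T) : R := \sum_(x | x \in A) nu x.

Definition pmf_ae (R : realType) (T : finType) (nu : T -> R) (A : set T) :
  Prop := pmf_measure nu (~` A) = 0.

Definition pmf_pow (R : realType) (X : finType) (mu : X -> R) (k : nat)
  (xs : k.-tuple X) : R := \prod_(i < k) mu (tnth xs i).

Definition pmf_int (R : realType) (T : finType) (nu : T -> R) (f : T -> R) : R :=
  \sum_x f x * nu x.

(* F is a function of l = m + 1 variables; the first l - 1 of them form the
   tuple xs, the last one is x. *)
Definition centered_last (R : realType) (X : finType) (mu : X -> R) (m : nat)
  (F : m.+1.-tuple X -> R) (xs : m.-tuple X) (x : X) : R :=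
  F [tuple of rcons xs x]
  - pmf_int mu (fun y => F [tuple of rcons xs y]).

Definition multiples (R : realType) (h : R) : set R :=
  [set k%:~R * h | k in [set: int]].

Definition setA (R : realType) (X : finType) (mu : X -> R) (m : nat)
  (F : m.+1.-tuple X -> R) (xs : m.-tuple X) : set R :=
  [set h | 0 <= h /\
    pmf_ae mu [set x | multiples h (F [tuple of rcons xs x])]].

Definition setB (R : realType) (X : finType) (mu : X -> R) (m : nat)
  (F : m.+1.-tuple X -> R) (xs : m.-tuple X) : set R :=
  [set h | 0 <= h /\
    pmf_ae (fun z : X * X => mu z.1 * mu z.2)
      [set z | multiples h (F [tuple of rcons xs z.1]
                            - F [tuple of rcons xs z.2])]].

(* The supremum is +oo when F(xs, .) is mu-almost surely constant. *)
Definition local_span (R : realType) (X : finType) (mu : X -> R) (m : nat)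
  (F : m.+1.-tuple X -> R) (xs : m.-tuple X) : \bar R :=
  ereal_sup [set h%:E | h in setB mu F xs].

Definition lattice_case (R : realType) (X : finType) (mu : X -> R) (m : nat)
  (F : m.+1.-tuple X -> R) (h : R) : Prop :=
  0 < h /\
  pmf_ae (@pmf_pow R X mu m)
    [set xs | [/\ setB mu F xs !=set0, local_span mu F xs = h%:E
                & setA mu F xs h]].

Definition nonlattice_case (R : realType) (X : finType) (mu : X -> R) (m : nat)
  (F : m.+1.-tuple X -> R) : Prop :=
  0 < pmf_measure (@pmf_pow R X mu m) [set xs | setB mu F xs = set0].

(* S_N = \sum_(1 <= n <= N) F(xi_n, xi_(2n), ..., xi_(l n)), l = m + 1 *)
Definition nonconv_sum (R : realType) (Omega : Type) (X : finType)
  (xi : nat -> Omega -> X) (m : nat) (F : m.+1.-tuple X -> R) (N : nat)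
  (w : Omega) : R :=
  \sum_(1 <= n < N.+1) F [tuple xi (i.+1 * n)%N w | i < m.+1].

Definition asymp_stddev (R : realType) (d : measure_display)
  (Omega : measurableType d) (P : probability Omega R) (S : nat -> Omega -> R) :
  R := Num.sqrt (limn (fun N : nat => fine 'V_P[S N] / N%:R)).

Definition compactly_supported (R : realType) (g : R -> R) : Prop :=
  compact (closure [set x | g x != 0]).

(* Mass h at each k h, k : int; Posz n is n and Negz n is - (n + 1). *)
Definition lattice_measure (R : realType) (h : {posnum R}) :
  {measure set (measurableTypeR R) -> \bar R} :=
  mscale (h%:num%:nng)%R
    (measure_add
      (mseries (fun n => dirac ((Posz n)%:~R * h%:num : measurableTypeR R)) 0)
      (mseries (fun n => dirac ((Negz n)%:~R * h%:num : measurableTypeR R)) 0)).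

Definition llt_error (R : realType) (d : measure_display)
  (Omega : measurableType d) (P : probability Omega R) (S : nat -> Omega -> R)
  (sigma : R) (g : R -> R) (I : R) (N : nat) (u : R) : R :=
  `| sigma * Num.sqrt (2 * pi * N%:R) * fine 'E_P[fun w => g (S N w - u)]
     - expR (- (u ^+ 2 / (2 * N%:R * sigma ^+ 2))) * I |.

(* Main.v *)
(** The chain mixes geometrically, so functions of the chain at two sets of times far apart are
nearly independent.  A term F(xi_n, ..., xi_(l n)) is thus nearly independent of all terms n' but
the few for which some i n and j n' are close, and Stein's method gives
E cos(s S_N / sqrt N + phi) -> cos(phi) exp(- s^2 sigma^2 / 2), uniformly for bounded s.

For frequencies t bounded by T one has |E cos(t S_N + phi)| <= exp(- c N t^2).  Indeed, let
(l - 1) N / l <= n1 < n <= N: the times l n are later than all times i n' with i < l, so that, given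
the past, the remaining sum is additive along the chain observed every l steps.  For a positive
fraction of the n the first l - 1 arguments of F take prescribed values x_1, ..., x_(l-1); by the
overlap conditions any two states y1, y2 have a common predecessor and a common successor, so the
last argument may be y1 or y2, and the phases t F(x, y1) and t F(x, y2) partly cancel.  They are
different modulo 2 pi for a suitable choice of y1, y2, if T < 2 pi / h in the lattice case and
without restriction on T in the non-lattice case.

Both estimates together control the characteristic function of S_N on the window of frequencies that
carries the law: [0, pi / h] in the lattice case, by orthogonality of characters.  In the non-lattice
case g is replaced by its convolution with a Fejer kernel, whose Fourier transform has compact
support, the error being dominated by a small multiple of an integrable function of the same type. *)

Require Import Defs.
From HB Require Import structures.
From mathcomp Require Import all_boot all_order all_algebra.
From mathcomp Require Import all_classical all_reals all_analysis.
From mathcomp Require Import measurable_realfun.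
From mathcomp Require Import ring lra zify.

Set Implicit Arguments.
Unset Strict Implicit.
Unset Printing Implicit Defensive.

Import Order.TTheory GRing.Theory Num.Theory.
Import numFieldNormedType.Exports.

Local Open Scope classical_set_scope.
Local Open Scope ring_scope.

(** * Powers of a transition matrix and geometric ergodicity *)

Section Kernel.
Variables (R : realType) (X : finType).

(** Real characteristic functions suffice, provided that E cos(t S_N + phi) is estimated for all
    phases phi at once. The location u then enters only as the phase - t u, which makes the limits
    uniform in u, and conditioning on the past only rotates the phase.

    The existence of sigma is an obstacle of its own. The terms F(xi_n, ..., xi_(l n)) do not form a
    stationary sequence in general, and the times of the terms n and N interact along each line i n
    = j N. Raising N by l! and n in proportion moves along such a line, so the increments of E S_N^2
    are l!-periodic up to an exponentially small error, which is enough for their averages to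
    converge.

    All expectations are finite sums over the states at the observed times, built from the kernels
    between successive times. Decoupling and comparison of two sets of times both amount to
    exchanging these kernels one by one. *)

Definition stochastic (k : X -> X -> R) : Prop :=
  (forall x y, 0 <= k x y) /\ (forall x, \sum_y k x y = 1).

Fixpoint pn (p : X -> X -> R) (n : nat) (x y : X) : R :=
  if n is n'.+1 then \sum_z p x z * pn p n' z y else (x == y)%:R.

Variable p : X -> X -> R.

Lemma sum_delta (x : X) (f : X -> R) : \sum_y (x == y)%:R * f y = f x.
Proof.
rewrite (bigD1 x)//= eqxx mul1r big1 ?addr0// => y yx.
by rewrite eq_sym (negbTE yx) mul0r.
Qed.

Lemma pnD m n x y : pn p (m + n) x y = \sum_z pn p m x z * pn p n z y.
Proof.
elim: m x => [|m IH] x /=; first by rewrite add0n sum_delta.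
under eq_bigr do rewrite IH mulr_sumr.
rewrite exchange_big/=; apply: eq_bigr => z _.
by rewrite mulr_suml; apply: eq_bigr => w _; rewrite mulrA.
Qed.

Lemma pn1 x y : pn p 1 x y = p x y.
Proof.
rewrite /=; under eq_bigr do rewrite mulrC eq_sym.
by rewrite sum_delta.
Qed.

Lemma trans_probE n x y : trans_prob p n x y = pn p n x y.
Proof.
rewrite /trans_prob; elim: n x => [|n IH] x /=.
  by rewrite expr0 mxE (inj_eq enum_rank_inj).
rewrite exprS -mulmxE mxE (reindex (@enum_rank X))/=; last first.
  by apply: onW_bij; apply: enum_rank_bij.
by apply: eq_bigr => z _; rewrite IH mxE !enum_rankK.
Qed.

Hypothesis sp : stochastic p.

Lemma pn_stochastic n : stochastic (pn p n).
Proof.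
have [p0 p1] := sp; split.
  elim: n => [|n IH] x y /=; first by rewrite ler0n.
  by apply: sumr_ge0 => z _; apply: mulr_ge0.
elim: n => [|n IH] x /=.
  by under eq_bigr do rewrite -[_%:R]mulr1; rewrite sum_delta.
rewrite exchange_big/= -(p1 x); apply: eq_bigr => z _.
by rewrite -mulr_sumr IH mulr1.
Qed.

Variable mu : X -> R.
Hypothesis mu0 : forall x, 0 <= mu x.
Hypothesis mu1 : \sum_x mu x = 1.
Hypothesis stat : forall y, \sum_x mu x * p x y = mu y.

Lemma pn_stat n y : \sum_x mu x * pn p n x y = mu y.
Proof.
elim: n y => [|n IH] y /=.
  under eq_bigr do rewrite mulrC eq_sym; exact: sum_delta.
under eq_bigr do rewrite mulr_sumr.
rewrite exchange_big/= -[RHS]IH; apply: eq_bigr => z _.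
by rewrite -[in RHS]stat mulr_suml; apply: eq_bigr => w _; rewrite mulrA.
Qed.

Variable k : nat.
Hypothesis pos : forall x y, 0 < pn p k x y.

(** After any [g - k] steps, [k] more steps reach each state with probability at least the smallest
    entry of the [k]-th power. The start value 1 of the minimum keeps [rho <= 1]. *)
Lemma pn_lower_bound : exists2 rho : R, 0 < rho <= 1 &
  forall g, (k <= g)%N -> forall x y, rho <= pn p g x y.
Proof.
pose rho := \big[Num.min/1]_(z : X * X) pn p k z.1 z.2.
have rho_le x y : rho <= pn p k x y.
  by rewrite /rho (bigD1 (x, y))//= ge_min lexx.
exists rho.
  rewrite /rho bigmin_le_id andbT.
  by elim/big_ind : _ => // a b a0 b0; rewrite lt_min a0.
move=> g kg x y; rewrite -(subnK kg) pnD.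
have [q0 q1] := pn_stochastic (g - k).
rewrite -[rho]mul1r -(q1 x) mulr_suml.
by apply: ler_sum => z _; apply: ler_wpM2l.
Qed.

Lemma mu_gt0 x : 0 < mu x.
Proof.
have [rho /andP[rho0 _] rhole] := pn_lower_bound.
rewrite -(pn_stat k); apply: lt_le_trans rho0 _.
rewrite -[rho]mul1r -mu1 mulr_suml; apply: ler_sum => z _.
by apply: ler_wpM2l => //; apply: rhole.
Qed.

(** Doeblin's argument: [pn p k z] dominates [e * mu] for every [z], and this common part cancels
    against the total mass 0 of [pn p n x - mu], so the distance to [mu] contracts by [1 - e] every
    [k] steps. *)
Lemma pn_mixing : exists2 C : R, 0 <= C & exists2 th : R, 0 < th < 1 &
  forall n x, \sum_y `|pn p n x y - mu y| <= C * th ^+ n.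
Proof.
have [rho /andP[rho0 rho1] rhole] := pn_lower_bound.
pose D n x := \sum_y `|pn p n x y - mu y|.
have muC x : mu x <= 1 by rewrite -mu1 (bigD1 x)//= lerDl sumr_ge0.
have D0 n x : 0 <= D n x by apply: sumr_ge0.
have D2 n x : D n x <= 2.
  apply: (@le_trans _ _ (\sum_y (pn p n x y + mu y))).
    apply: ler_sum => y _; have [q0 _] := pn_stochastic n.
    by rewrite (le_trans (ler_normB _ _))// !ger0_norm.
  by rewrite big_split/= mu1 (pn_stochastic n).2.
have [e [eE e0]] : exists e, e = rho / 2 /\ 0 < e <= 1 / 2.
  by exists (rho / 2); split => //; lra.
have Dk n x : D (n + k)%N x <= (1 - e) * D n x.
  have -> : D (n + k)%N x = \sum_y `|\sum_z (pn p n x z - mu z) * (pn p k z y - e * mu y)|.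
    apply: eq_bigr => y _; congr (`|_|).
    under eq_bigr do rewrite mulrBr.
    rewrite sumrB -mulr_suml sumrB (pn_stochastic n).2 mu1 subrr mul0r subr0.
    under eq_bigr do rewrite mulrBl.
    by rewrite sumrB -pnD pn_stat.
  apply: (@le_trans _ _ (\sum_y \sum_z `|pn p n x z - mu z| * (pn p k z y - e * mu y))).
    apply: ler_sum => y _; apply: le_trans (ler_norm_sum _ _ _) _.
    apply: ler_sum => z _; rewrite normrM ler_wpM2l//.
    rewrite ger0_norm// subr_ge0 (le_trans _ (rhole _ _ _ _))//.
    by have := muC y; have := mu0 y; rewrite eE; nra.
  rewrite exchange_big/= /D mulr_sumr; apply: ler_sum => z _.
  rewrite -mulr_sumr sumrB (pn_stochastic k).2 -mulr_sumr mu1 mulr1.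
  by rewrite mulrC.
(* The rate [th = 1 - u] satisfies [1 - e <= th ^+ k] by Bernoulli's inequality; dividing [e] by
   [k.+1] instead of [k] covers [k = 0]. *)
have [u [uE u0]] : exists u, k.+1%:R * u = e /\ 0 < u <= 1 / 2.
  exists (e / k.+1%:R); split; first by rewrite mulrC divfK// pnatr_eq0.
  rewrite divr_gt0 ?ltr0n//=; last by lra.
  rewrite ler_pdivrMr ?ltr0n//.
  have : 1 <= k.+1%:R :> R by rewrite ler1n.
  by lra.
have [th thE] : exists th, th = 1 - u by exists (1 - u).
have thk : 1 - e <= th ^+ k.
  have ber : forall m, 1 - m%:R * u <= th ^+ m.
    elim=> [|m IH]; first by rewrite expr0 mul0r subr0.
    rewrite exprS -natr1 mulrDl mul1r.
    have th_ge0 : 0 <= th by lra.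
    apply: le_trans (ler_wpM2l th_ge0 IH).
    have : 0 <= m%:R :> R by rewrite ler0n.
    by rewrite thE; nra.
  apply: le_trans (ber k); rewrite lerD2l lerN2 -uE ler_wpM2r ?ler_nat//; lra.
have th01 : 0 < th < 1 by lra.
exists (2 / th ^+ k).
  by rewrite divr_ge0// exprn_ge0//; lra.
exists th => // n x; rewrite -/(D n x).
have {}th0 : 0 <= th by lra.
elim/ltn_ind : n => n IH.
have [nk|kn] := ltnP n k.
  apply: le_trans (D2 n x) _; rewrite -mulrA ler_peMr//.
  rewrite ler_pdivlMl ?mulr1 ?exprn_gt0//; last lra.
  by rewrite -(subnK (ltnW nk)) exprD ler_piMl ?exprn_ge0// exprn_ile1//; lra.
(* For [k = 0] the contraction reads [D n x <= (1 - e) * D n x], so the distance is 0. *)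
have [k_0|kpos] := posnP k.
  suff D00 : D n x <= 0 by apply: le_trans D00 _; rewrite mulr_ge0 ?divr_ge0 ?exprn_ge0.
  have := Dk n x; have := D0 n x; rewrite k_0 addn0 => a b.
  have : 0 < e by lra.
  by nra.
have := IH (n - k)%N; rewrite ltn_subrL kpos (leq_trans kpos kn) => /(_ isT) IH'.
have := Dk (n - k)%N x; rewrite (subnK kn) => /le_trans; apply.
have -> : 2 / th ^+ k * th ^+ n = th ^+ k * (2 / th ^+ k * th ^+ (n - k)).
  by rewrite -{1}(subnK kn) exprD; ring.
by apply: ler_pM => //; lra.
Qed.

End Kernel.
Arguments pn : simpl never.

(** * Expectations along observation times *)

Section PathExpectation.
Variables (R : realType) (X : finType).
Implicit Types (k : nat -> nat -> X -> X -> R) (u v : nat) (L : seq nat).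
Implicit Types (s : nat -> X) (f g : (nat -> X) -> R).

Definition upd s v (y : X) : nat -> X := fun i => if i == v then y else s i.

Fixpoint upds s L (ys : seq X) : nat -> X :=
  match L, ys with
  | v :: L', y :: ys' => upds (upd s v y) L' ys'
  | _, _ => s
  end.

(* [s] is the path observed up to time [u], [L] the later observation times
   and [k u v] the transition kernel from time [u] to time [v]. *)
Fixpoint EL k u L s f : R :=
  if L is v :: L' then \sum_y k u v (s u) y * EL k v L' (upd s v y) f else f s.

Definition dep (D : pred nat) f : Prop :=
  forall s s', (forall i, D i -> s i = s' i) -> f s = f s'.

Definition stochastics k := forall u v, stochastic (k u v).

Lemma dep_sub (D D' : pred nat) f : (forall i, D i -> D' i) -> dep D f -> dep D' f.
Proof. by move=> DD' df s s' ss'; apply: df => i /DD'; apply: ss'. Qed.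

Lemma updE s v y : upd s v y v = y.
Proof. by rewrite /upd eqxx. Qed.

Lemma upd_neq s v y i : i != v -> upd s v y i = s i.
Proof. by rewrite /upd => /negbTE ->. Qed.

Lemma EL_cat k u L1 L2 s f :
  EL k u (L1 ++ L2) s f = EL k u L1 s (fun s' => EL k (last u L1) L2 s' f).
Proof. by elim: L1 u s => //= v L1 IH u s; apply: eq_bigr => y _; rewrite IH. Qed.

Lemma eq_EL k u L s f g : (forall s', f s' = g s') -> EL k u L s f = EL k u L s g.
Proof. by move=> fg; elim: L u s => //= v L IH u s; apply: eq_bigr => y _; rewrite IH. Qed.

Lemma EL_sum k u L s (I : Type) (r : seq I) (P : pred I) (F : I -> (nat -> X) -> R) :
  EL k u L s (fun s' => \sum_(i <- r | P i) F i s') =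
  \sum_(i <- r | P i) EL k u L s (F i).
Proof.
elim: L u s => //= v L IH u s.
under eq_bigr do rewrite IH mulr_sumr.
by rewrite exchange_big.
Qed.

Lemma ELD k u L s f g : EL k u L s (fun s' => f s' + g s') = EL k u L s f + EL k u L s g.
Proof.
elim: L u s => //= v L IH u s.
by rewrite -big_split/=; apply: eq_bigr => y _; rewrite IH mulrDr.
Qed.

Lemma ELZ k u L s c f : EL k u L s (fun s' => c * f s') = c * EL k u L s f.
Proof.
elim: L u s => //= v L IH u s.
by rewrite mulr_sumr; apply: eq_bigr => y _; rewrite IH mulrCA.
Qed.

Lemma ELB k u L s f g : EL k u L s (fun s' => f s' - g s') = EL k u L s f - EL k u L s g.
Proof.
rewrite -[- EL _ _ _ _ g]mulN1r -ELZ -ELD.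
by apply: eq_EL => s'; rewrite mulN1r.
Qed.

Lemma EL_cst k u L s c : stochastics k -> EL k u L s (fun=> c) = c.
Proof.
move=> sk; elim: L u s => //= v L IH u s.
by under eq_bigr do rewrite IH; rewrite -mulr_suml (sk _ _).2 mul1r.
Qed.

Lemma EL_le k u L s f g : stochastics k -> (forall s', f s' <= g s') ->
  EL k u L s f <= EL k u L s g.
Proof.
move=> sk fg; elim: L u s => //= v L IH u s.
by apply: ler_sum => y _; rewrite ler_wpM2l// (sk _ _).1.
Qed.

Lemma EL_norm k u L s f B : stochastics k -> (forall s', `|f s'| <= B) ->
  `|EL k u L s f| <= B.
Proof.
move=> sk fB; rewrite ler_norml; apply/andP; split.
  rewrite -(EL_cst u L s (- B) sk); apply: EL_le => // s'.
  by have := fB s'; rewrite ler_norml => /andP[].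
rewrite -(EL_cst u L s B sk); apply: EL_le => // s'.
by have := fB s'; rewrite ler_norml => /andP[].
Qed.

Lemma EL_norm_le k u L s f : stochastics k ->
  `|EL k u L s f| <= EL k u L s (fun s' => `|f s'|).
Proof.
move=> sk; rewrite ler_norml -mulN1r -ELZ !EL_le// => s'.
  by rewrite ler_norm.
by rewrite mulN1r lerNl -normrN ler_norm.
Qed.

Lemma upd_agree (D : pred nat) s s' v y :
  (forall i, D i -> s i = s' i) -> forall i, D i -> upd s v y i = upd s' v y i.
Proof. by move=> ss' i Di; rewrite /upd; case: ifP => // _; apply: ss'. Qed.

Lemma dep_EL k u L f (D : pred nat) : dep [pred i | D i || (i \in L)] f ->
  dep [pred i | D i || (i == u)] (fun s => EL k u L s f).
Proof.
elim: L u D => [|v L IH] u D df s s' ss' /=.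
  by apply: df => i /=; rewrite orbF => Di; apply: ss' => /=; rewrite Di.
apply: eq_bigr => y _; rewrite ss'/= ?eqxx ?orbT//; congr (_ * _).
apply: (IH v [pred i | D i || (i == v)]).
  by apply: dep_sub df => i /=; rewrite inE orbA.
move=> i /=; rewrite -orbA orbb /upd; case: ifP => // iv; rewrite orbF => Di.
by apply: ss' => /=; rewrite Di.
Qed.

Definition kdist k k' u v u' v' : R := \sum_x \sum_y `|k u v x y - k' u' v' x y|.

Fixpoint kdists k k' u u' L L' : R :=
  match L, L' with
  | v :: L1, v' :: L1' => kdist k k' u v u' v' + kdists k k' v v' L1 L1'
  | _, _ => 0
  end.

(** Kernels are exchanged one observation at a time. Each exchange costs at most [B] times [kdist],
    which sums over all starting states and so needs no knowledge of the state reached. The two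
    chains may be observed at different times, as long as both functionals read the same list of
    states. *)
Lemma EL_coupling k k' u u' L L' s s' f f' B :
  stochastics k -> stochastics k' -> size L = size L' -> s u = s' u' ->
  (forall t, `|f t| <= B) ->
  (forall ys, size ys = size L -> f (upds s L ys) = f' (upds s' L' ys)) ->
  `|EL k u L s f - EL k' u' L' s' f'| <= B * kdists k k' u u' L L'.
Proof.
move=> sk sk'; elim: L L' u u' s s' => [|v L IH] [|v' L'] u u' s s' //=.
  by move=> _ _ _ /(_ [::] erefl) /= ->; rewrite subrr normr0 mulr0.
move=> [sL] su fB ff'.
have step y : `|EL k v L (upd s v y) f - EL k' v' L' (upd s' v' y) f'|
   <= B * kdists k k' v v' L L'.
  apply: IH => //; first by rewrite !updE.
  by move=> ys sys; apply: (ff' (y :: ys)); rewrite /= sys.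
have -> : \sum_y k u v (s u) y * EL k v L (upd s v y) f -
   \sum_y k' u' v' (s' u') y * EL k' v' L' (upd s' v' y) f' =
   \sum_y (k u v (s u) y - k' u' v' (s' u') y) * EL k v L (upd s v y) f +
   \sum_y k' u' v' (s' u') y *
     (EL k v L (upd s v y) f - EL k' v' L' (upd s' v' y) f').
  rewrite -sumrB -big_split/=; apply: eq_bigr => y _; ring.
rewrite mulrDr (le_trans (ler_normD _ _))// lerD//.
  apply: le_trans (ler_norm_sum _ _ _) _.
    apply: (@le_trans _ _ (B * \sum_y `|k u v (s u) y - k' u' v' (s u) y|)).
    rewrite mulr_sumr; apply: ler_sum => y _.
    by rewrite normrM mulrC -su ler_wpM2r// EL_norm.
  rewrite ler_wpM2l//; first exact: le_trans (normr_ge0 (f s)) (fB s).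
  rewrite /kdist [leRHS](bigD1 (s u))//= lerDl.
  by apply: sumr_ge0 => x _; apply: sumr_ge0.
apply: le_trans (ler_norm_sum _ _ _) _.
rewrite -[leRHS]mul1r -((sk' u' v').2 (s' u')) mulr_suml.
apply: ler_sum => y _.
by rewrite normrM ger0_norm ?ler_wpM2l ?(sk' _ _).1.
Qed.

Section Independence.
Variables (k : nat -> nat -> X -> X -> R) (c : pred nat).
Hypothesis sk : stochastics k.
Hypothesis kc : forall u v x x' y, c u != c v -> k u v x y = k u v x' y.

(** Steps into the other class average out, and steps into class [b] from outside ignore the current
    state, so only the coordinates of class [b] matter. *)
Lemma EL_class (b : bool) u L s s' g : dep [pred i | c i == b] g ->
  (forall i, c i == b -> s i = s' i) -> EL k u L s g = EL k u L s' g.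
Proof.
move=> dg; elim: L u s s' => [|v L IH] u s s' ss' /=; first exact: dg.
have [cv|cv] := eqVneq (c v) b.
  apply: eq_bigr => y _; congr (_ * _); last by apply: IH; exact: upd_agree.
  have [cu|cu] := eqVneq (c u) b; first by rewrite ss' ?cu.
  by apply: kc; rewrite cv.
have H t y : EL k v L (upd t v y) g = EL k v L t g.
  by apply: IH => i /eqP ci; rewrite upd_neq//; apply: contraNneq cv => <-; rewrite ci.
under eq_bigr do rewrite H.
under [RHS]eq_bigr do rewrite H.
by rewrite -!mulr_suml !(sk _ _).2 (IH v s s').
Qed.

(** Each step draws a coordinate that is read by one factor only; by [EL_class] the expectation of
    the other factor does not feel it and comes out of the sum. *)
Lemma EL_indep u L s f g : dep c f -> dep (predC c) g ->
  EL k u L s (fun s' => f s' * g s') = EL k u L s f * EL k u L s g.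
Proof.
move=> df dg.
have df' : dep [pred i | c i == true] f.
  by apply: dep_sub df => i /= ->.
have dg' : dep [pred i | c i == false] g.
  by apply: dep_sub dg => i /= /negbTE ->.
elim: L u s => [|v L IH] u s //=.
under eq_bigr do rewrite IH.
have [cv|cv] := boolP (c v).
  have H y : EL k v L (upd s v y) g = EL k v L s g.
    apply: (EL_class (b := false)) => // i ci; rewrite upd_neq//.
    by apply: contraTneq cv => <-; apply/negbT/eqP.
  under eq_bigr do rewrite H.
  under [X in _ = _ * X]eq_bigr do rewrite H.
  by rewrite -[in RHS]mulr_suml (sk _ _).2 mul1r mulr_suml; apply: eq_bigr => y _; rewrite mulrA.
have H y : EL k v L (upd s v y) f = EL k v L s f.
  apply: (EL_class (b := true)) => // i /eqP ci; rewrite upd_neq//.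
  by apply: contraNneq cv => <-; rewrite ci.
under eq_bigr do rewrite H.
under [X in _ = X * _]eq_bigr do rewrite H.
rewrite -[in RHS]mulr_suml (sk _ _).2 mul1r mulr_sumr; apply: eq_bigr => y _.
by rewrite mulrCA.
Qed.
End Independence.

End PathExpectation.

Section FiniteExpectation.
Variables (R : realType) (d : measure_display) (Omega : measurableType d).
Variables (P : probability Omega R) (T : finType) (Y : Omega -> T).
Hypothesis mY : forall t, measurable (Y @^-1` [set t]).

Lemma expectation_finite (f : T -> R) :
  'E_P[fun w => f (Y w)]%E = (\sum_t f t * fine (P (Y @^-1` [set t])))%:E.
Proof.
rewrite unlock.
rewrite (_ : (fun w => (f (Y w))%:E) =
  (fun w => \sum_t (f t)%:E * (\1_(Y @^-1` [set t]) w)%:E)%E); last first.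
  apply/funext => w; rewrite (bigD1 (Y w))//= big1 ?adde0.
    by rewrite indicE mem_set ?mule1.
  by move=> t tY; rewrite indicE memNset ?mule0//= => /esym/eqP; apply/negP.
rewrite integral_sum//=; last first.
  by move=> t; apply: integrableZl => //; apply: integrable_indic.
rewrite -sumEFin; apply: eq_bigr => t _.
rewrite integralZl//; last exact: integrable_indic.
by rewrite integral_indic// setIT EFinM fineK// fin_num_measure.
Qed.
End FiniteExpectation.

(** * Finite-dimensional distributions of the chain *)

Section Chain.
Variables (R : realType) (d : measure_display) (Omega : measurableType d).
Variables (P : probability Omega R) (X : finType) (xi : nat -> Omega -> X).
Variables (mu : X -> R) (p : X -> X -> R).
Hypothesis chain : stationary_markov_chain P xi mu p.
Implicit Types (f h : (nat -> X) -> R).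

Definition ex f : R := fine 'E_P[fun w => f (xi^~ w)]%E.

(** Time 0 is a mere starting point: leaving it draws a state from [mu], which by stationarity is
    the law at every later time. The state assigned to time 0 is then irrelevant. *)
Definition kern (u v : nat) (x y : X) : R := if u == 0%N then mu y else pn p (v - u) x y.

Lemma stochastic_p : stochastic p.
Proof. by split; [exact: smc_trans_ge0 chain | exact: smc_trans_sum1 chain]. Qed.

Lemma stochastic_kern : stochastics kern.
Proof.
move=> u v; rewrite /kern; have [_|_] := eqVneq u 0%N.
  split; first by move=> _; exact: smc_distr_ge0 chain.
  by move=> _; exact: smc_distr_sum1 chain.
exact: (pn_stochastic stochastic_p).
Qed.

Definition history (n : nat) (w : Omega) : {ffun 'I_n.+1 -> X} := [ffun i : 'I_n.+1 => xi i w].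
Definition ext n (t : {ffun 'I_n.+1 -> X}) (i : nat) : X := t (inord i).

Lemma historyP n (t : {ffun 'I_n.+1 -> X}) :
  history n @^-1` [set t] = [set w | forall i, (i <= n)%N -> xi i w = ext t i].
Proof.
apply/seteqP; split => w /=.
  by move=> <- i i_n; rewrite /ext /history ffunE inordK.
move=> H; apply/ffunP => i; rewrite ffunE H -1?ltnS//.
by rewrite /ext inord_val.
Qed.

Lemma measurable_path_eq n (s : nat -> X) :
  measurable [set w | forall i, (i <= n)%N -> xi i w = s i].
Proof.
rewrite (_ : [set w | _] = \bigcap_(i in `I_n.+1) (xi i @^-1` [set s i])).
  apply: bigcap_measurable => [|i _]; first by exists 0%N.
  by exact: smc_measurable chain _ _.
by apply/seteqP; split.
Qed.

Lemma measurable_history n t : measurable (history n @^-1` [set t]).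
Proof. by rewrite historyP; exact: measurable_path_eq. Qed.

Lemma expectation_path n f : dep [pred i | (i <= n)%N] f ->
  'E_P[fun w => f (xi^~ w)]%E =
  (\sum_t f (ext t) * fine (P (history n @^-1` [set t])))%:E.
Proof.
move=> df; rewrite -(expectation_finite P (@measurable_history n) (fun t => f (ext t))).
congr expectation; apply/funext => w; apply: df => i /= i_n.
by rewrite /ext ffunE inordK.
Qed.

Lemma ex_path n f : dep [pred i | (i <= n)%N] f ->
  ex f = \sum_t f (ext t) * fine (P (history n @^-1` [set t])).
Proof. by move=> df; rewrite /ex (expectation_path df). Qed.

Lemma ex_step n h : dep [pred i | (i <= n.+1)%N] h ->
  ex h = ex (fun s => \sum_y p (s n) y * h (upd s n.+1 y)).
Proof.
move=> dh.
have E1 : ex h = \sum_(z : {ffun 'I_n.+1 -> X} * X)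
   h (upd (ext z.1) n.+1 z.2) *
   fine (P [set w | forall i, (i <= n.+1)%N -> xi i w = upd (ext z.1) n.+1 z.2 i]).
  pose Y w := (history n w, xi n.+1 w).
  have YE z : Y @^-1` [set z] = [set w | forall i, (i <= n.+1)%N -> xi i w = upd (ext z.1) n.+1 z.2 i].
    case: z => t y; apply/seteqP; split => w /=.
      move=> [<- <-] i; rewrite /upd; case: eqP => [->//|/eqP i1 i2].
      by rewrite /ext ffunE inordK// ltn_neqAle i1.
    move=> H; congr (_, _); last by rewrite H// updE.
    apply/ffunP => i; rewrite ffunE H; last exact: ltnW.
    by rewrite upd_neq ?ltn_eqF// /ext inord_val.
  have mY z : measurable (Y @^-1` [set z]) by rewrite YE; exact: measurable_path_eq.
  rewrite /ex; under [RHS]eq_bigr do rewrite -YE.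
  rewrite -[RHS]/(fine (_%:E)) -(expectation_finite P mY (fun z => h (upd (ext z.1) n.+1 z.2))).
  congr (fine (expectation _ _)); apply/funext => w; apply: dh => i /= i_n.
  rewrite /upd; case: eqP => [->//|/eqP i1].
  by rewrite /ext ffunE inordK// ltn_neqAle i1.
rewrite E1 (@ex_path n); last first.
  move=> s s' ss'; apply: eq_bigr => y _; rewrite ss'//=; congr (_ * _).
  apply: dh => i /= i1; rewrite /upd; case: eqP => // /eqP i2.
  by apply: ss' => /=; rewrite -ltnS ltn_neqAle i2.
rewrite -(pair_bigA _ (fun t y => h (upd (ext t) n.+1 y) * fine (P [set w | forall i,
   (i <= n.+1)%N -> xi i w = upd (ext t) n.+1 y i])))/=.
apply: eq_bigr => t _; rewrite mulr_suml; apply: eq_bigr => y _.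
rewrite (smc_markov chain) updE upd_neq ?ltn_eqF//.
rewrite fineM//; last exact/fin_num_measure/measurable_path_eq.
rewrite [_ * (h _)]mulrC -mulrA /=; congr (_ * _); rewrite mulrC; congr (_ * fine (P _)).
rewrite historyP; apply/seteqP; split => w /= H i i_n; rewrite H//.
  by rewrite upd_neq// ltn_eqF.
by rewrite upd_neq// ltn_eqF.
Qed.

(** As [h] ignores the states strictly between [u] and [u + j.+1], the one-step property iterates to
    the power [j.+1] of the kernel. *)
Lemma ex_jump u j h : dep [pred i | (i <= u)%N || (i == u + j.+1)%N] h ->
  ex h = ex (fun s => \sum_y pn p j.+1 (s u) y * h (upd s (u + j.+1) y)).
Proof.
elim: j h => [|j IH] h dh.
  rewrite (@ex_step u); last first.
    by apply: dep_sub dh => i /= /orP[/leqW//|/eqP->]; rewrite addn1.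
  by congr ex; apply/funext => s; apply: eq_bigr => y _; rewrite addn1 pn1.
rewrite addnS (@ex_step (u + j.+1)); last first.
  apply: dep_sub dh => i /= /orP[/leq_trans->//|/eqP->]; last by rewrite addnS.
  by rewrite -addnS leq_addr.
rewrite IH; last first.
  move=> s s' ss'; apply: eq_bigr => y _; rewrite ss'/= ?eqxx ?orbT//; congr (_ * _).
  apply: dh => i /= /orP[iu|/eqP->]; last by rewrite -addnS !updE.
  by rewrite /upd; case: ifP => // _; apply: ss'; rewrite /= iu.
congr ex; apply/funext => s.
under [RHS]eq_bigr do rewrite -addn1 pnD mulr_suml.
rewrite exchange_big/=; apply: eq_bigr => z _.
rewrite mulr_sumr; apply: eq_bigr => y _.
rewrite pn1 updE mulrA; congr (_ * _).
apply: dh => i /= /orP[iu|/eqP->]; last by rewrite -addnS !updE.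
have i1 : i != (u + j.+1).+1 by rewrite ltn_eqF// ltnS (leq_trans iu)// leq_addr.
rewrite !(@upd_neq _ _ _ _ i)//.
by rewrite ltn_eqF// addnS ltnS (leq_trans iu)// leq_addr.
Qed.

Lemma ex_law v (f : X -> R) : ex (fun s => f (s v)) = \sum_x mu x * f x.
Proof.
rewrite /ex (expectation_finite P (smc_measurable chain v) f) /=.
under eq_bigr do rewrite mulrC; apply: eq_bigr => x _; congr (_ * _).
have H0 y : fine (P (xi 0%N @^-1` [set y])) = mu y by rewrite (smc_initial chain).
case: v => [|v]; first exact: H0.
have := @ex_jump 0 v (fun s => (s v.+1 == x)%:R).
have -> : ex (fun s => (s v.+1 == x)%:R) = fine (P (xi v.+1 @^-1` [set x])).
  rewrite /ex (expectation_finite P (smc_measurable chain v.+1) (fun y => (y == x)%:R)) /=.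
  by under eq_bigr do rewrite eq_sym; exact: sum_delta.
move=> ->; last by move=> s s' ss'; rewrite ss'//= add0n eqxx orbT.
have -> : (fun s : nat -> X => \sum_y pn p v.+1 (s 0%N) y *
    (upd s (0 + v.+1) y v.+1 == x)%:R) = (fun s => pn p v.+1 (s 0%N) x).
  by apply/funext => s; under eq_bigr do rewrite add0n updE mulrC eq_sym; exact: sum_delta.
rewrite /ex (expectation_finite P (smc_measurable chain 0%N) (fun y => pn p v.+1 y x)) /=.
under eq_bigr do rewrite H0 mulrC.
exact: (pn_stat (smc_stationary chain) v.+1).
Qed.

(** Conditioning on the path up to time [u]: the past stays inside [ex], and the later observation
    times are summed out by [EL]. *)
Lemma ex_EL_from u L f : (0 < u)%N -> path ltn u L ->
  dep [pred i | (i <= u)%N || (i \in L)] f -> ex f = ex (fun s => EL kern u L s f).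
Proof.
elim: L u f => [|v L IH] u f u0 //= /andP[uv vL] df.
have v0 : (0 < v)%N by apply: leq_trans uv.
rewrite (IH v)//; last first.
  by apply: dep_sub df => i /=; rewrite inE => /orP[iu|/orP[/eqP->|->]];
   rewrite ?orbT// ?leqnn// (leq_trans iu (ltnW uv)).
have dE : dep [pred i | (i <= u)%N || (i == v)] (fun s => EL kern v L s f).
    apply: dep_sub (@dep_EL _ _ kern v L f [pred i | (i <= u)%N || (i == v)] _).
    by move=> i /= /orP[->//|->]; rewrite orbT.
  by apply: dep_sub df => i /=; rewrite inE orbA.
have vE : v = (u + (v - u).-1.+1)%N by rewrite prednK ?subn_gt0// subnKC// ltnW.
rewrite (@ex_jump u (v - u).-1); last by rewrite -vE.
congr ex; apply/funext => s; rewrite -vE prednK ?subn_gt0//.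
by apply: eq_bigr => y _; rewrite /kern gtn_eqF.
Qed.

Lemma ex_EL L f s0 : path ltn 0%N L -> dep (mem L) f -> ex f = EL kern 0 L s0 f.
Proof.
case: L => [|v L] /=.
  move=> _ df; rewrite (_ : f = fun=> f s0); last first.
    by apply/funext => s; apply: df => i /=; rewrite in_nil.
  have := ex_law 0 (fun=> f s0); rewrite -mulr_suml (smc_distr_sum1 chain) mul1r.
  by move->.
move=> /andP[v0 vL] df; rewrite (@ex_EL_from v L)//; last first.
  by apply: dep_sub df => i /=; rewrite inE => /orP[/eqP->|->]; rewrite ?leqnn ?orbT.
rewrite (_ : (fun s => EL kern v L s f) = (fun s => EL kern v L (upd s0 v (s v)) f)); last first.
  apply/funext => s; apply: (@dep_EL _ _ _ _ _ _ [pred i | i == v]).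
    by apply: dep_sub df => i /=; rewrite inE.
  by move=> i /=; rewrite orbb => /eqP ->; rewrite updE.
rewrite (ex_law v (fun x => EL kern v L (upd s0 v x) f)).
by apply: eq_bigr => y _; rewrite /kern eqxx.
Qed.

End Chain.

Lemma sorted_undup_sort (s : seq nat) : sorted ltn (sort leq (undup s)).
Proof. by rewrite ltn_sorted_uniq_leq sort_uniq undup_uniq sort_sorted//; exact: leq_total. Qed.

Lemma path_sort_undup (s : seq nat) : (forall i, i \in s -> (0 < i)%N) ->
  path ltn 0%N (sort leq (undup s)).
Proof.
move=> s0; have := sorted_undup_sort s.
have : forall i, i \in sort leq (undup s) -> (0 < i)%N.
  by move=> i; rewrite mem_sort mem_undup; apply: s0.
by case: (sort _ _) => //= a l H ->; rewrite andbT H// mem_head.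
Qed.

Section UpdsNth.
Variables (X : finType) (x0 : X).

Lemma upds_notin (s : nat -> X) L (ys : seq X) a : a \notin L -> upds s L ys a = s a.
Proof.
elim: L ys s => [|v L IH] [|y ys] s //=; rewrite inE negb_or => /andP[av aL].
by rewrite IH// upd_neq.
Qed.

Lemma upds_nth (s : nat -> X) L (ys : seq X) i : uniq L -> size ys = size L ->
  (i < size L)%N -> upds s L ys (nth 0%N L i) = nth x0 ys i.
Proof.
elim: L ys s i => [|v L IH] [|y ys] s [|i] //= /andP[vL uL] [sL] iL.
  by rewrite upds_notin// updE.
by rewrite IH.
Qed.
End UpdsNth.

(** * Decoupling and comparison of observations at distant times *)

Section Mixing.
Variables (R : realType) (d : measure_display) (Omega : measurableType d).
Variables (P : probability Omega R) (X : finType) (xi : nat -> Omega -> X).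
Variables (mu : X -> R) (p : X -> X -> R).
Hypothesis chain : stationary_markov_chain P xi mu p.
Variables (C th : R).
Hypothesis C0 : 0 <= C.
Hypothesis th01 : 0 < th < 1.
Hypothesis mix : forall n x, \sum_y `|pn p n x y - mu y| <= C * th ^+ n.
Let E := ex P xi.
Let K0 := kern mu p.
Implicit Types (f g : (nat -> X) -> R).

(** The factor [#|X|] comes from [kdist], which sums over all starting states. *)
Definition mixrate (K : nat) : R := #|X|%:R * C * th ^+ K.

Lemma mixrate_ge0 K : 0 <= mixrate K.
Proof. by rewrite /mixrate mulr_ge0 ?exprn_ge0 ?mulr_ge0 ?ler0n//; case/andP: th01 => /ltW. Qed.

Lemma mixrate2_ge0 K : 0 <= 2 * mixrate K.
Proof. by rewrite mulr_ge0 ?mixrate_ge0. Qed.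

Lemma mixrate_le K K' : (K <= K')%N -> mixrate K' <= mixrate K.
Proof.
move=> KK; rewrite /mixrate ler_wpM2l ?mulr_ge0 ?ler0n//.
by case/andP: th01 => t0 t1; rewrite ler_wiXn2l// ltW.
Qed.

Lemma kernel_mix n : \sum_(x : X) \sum_y `|pn p n x y - mu y| <= mixrate n.
Proof.
rewrite /mixrate -mulrA.
apply: le_trans (ler_sum _ (fun x _ => mix n x)) _.
by rewrite sumr_const mulr_natl.
Qed.

Lemma ex_seqE (U : seq nat) f s0 : (forall i, i \in U -> (0 < i)%N) ->
  dep (mem U) f -> E f = EL K0 0%N (sort leq (undup U)) s0 f.
Proof.
move=> U0 df; apply: (ex_EL chain); first exact: path_sort_undup.
by apply: dep_sub df => i /=; rewrite mem_sort mem_undup.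
Qed.

Section Decouple.
Variables (U V : seq nat) (K : nat).
Hypothesis K_gt0 : (0 < K)%N.
Hypothesis UV0 : forall i, i \in U ++ V -> (0 < i)%N.
Hypothesis UVK : forall u v, u \in U -> v \in V -> (u + K <= v)%N || (v + K <= u)%N.

(** Transitions between a time in [U] and one outside forget the current state. Between [U] and [V]
    they last at least [K] steps, so the replacement is cheap, and under [kcut] the two groups of
    times are independent. *)
Let kcut (u v : nat) : X -> X -> R :=
  if (u == 0%N) || ((u \in U) == (v \in U)) then K0 u v else fun _ y => mu y.

Lemma stochastic_kcut : stochastics kcut.
Proof.
move=> u v; rewrite /kcut; case: ifP => _; first exact: (stochastic_kern chain).
split; first by move=> _; exact: smc_distr_ge0 chain.
by move=> _; exact: smc_distr_sum1 chain.
Qed.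

Lemma kcut_dist u v : (u == 0%N) || (u \in U ++ V) -> (v \in U ++ V) -> (u < v)%N ->
  kdist K0 kcut u v u v <= mixrate K * ((u \in U)%:R + (v \in U)%:R).
Proof.
move=> uUV vUV uv; rewrite /kdist /kcut; case: ifPn => [_|].
  under eq_bigr do under eq_bigr do rewrite subrr normr0.
  rewrite big1 => [|x _]; last by rewrite big1.
  by rewrite mulr_ge0 ?mixrate_ge0// addr_ge0 ?ler0n.
rewrite negb_or => /andP[u0 uvU].
rewrite (negbTE u0) /= in uUV.
have K_uv : (K <= v - u)%N.
  have [uU|uU] := boolP (u \in U).
    have vV : v \in V.
      by move: vUV uvU; rewrite mem_cat uU => /orP[->|].
    case/orP: (UVK uU vV) => H; first by rewrite leq_subRL ?(ltnW uv)// addnC addnC.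
    by have := leq_trans (leq_addr K v) H; rewrite leqNgt uv.
  have uV : u \in V by move: uUV; rewrite mem_cat (negbTE uU).
  have vU : v \in U by move: uvU; rewrite (negbTE uU); case: (v \in U).
  case/orP: (UVK vU uV) => H; last by rewrite leq_subRL ?(ltnW uv)// addnC addnC.
  by have := leq_trans (leq_addr K v) H; rewrite leqNgt uv.
have -> : (u \in U)%:R + (v \in U)%:R = 1 :> R.
  by move: uvU; case: (u \in U); case: (v \in U) => // _; rewrite ?addr0 ?add0r.
rewrite mulr1 /K0 /kern (negbTE u0).
exact: le_trans (kernel_mix _) (mixrate_le K_uv).
Qed.

(** A cut transition has exactly one endpoint in [U], and each time of [U] is an endpoint of at most
    two transitions. Charging the errors to [U] alone matters: in Stein's method [U] has boundedly
    many elements, while the size of [V] grows with [N]. *)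
Lemma kcut_dists u L : (u == 0%N) || (u \in U ++ V) -> path ltn u L ->
  (forall i, i \in L -> i \in U ++ V) ->
  kdists K0 kcut u u L L <= mixrate K * ((u \in U)%:R + (2 * count (mem U) L)%:R).
Proof.
elim: L u => [|v L IH] u uUV /=.
  by move=> _ _; rewrite muln0 addr0 mulr_ge0 ?mixrate_ge0 ?ler0n.
move=> /andP[uv vL] LUV.
have vUV : v \in U ++ V by apply: LUV; rewrite mem_head.
have H1 := kcut_dist uUV vUV uv.
have H2 := IH v; rewrite vUV orbT vL in H2.
have {}H2 := H2 isT isT (fun i iL => LUV i (@mem_behead _ (v :: L) i iL)).
apply: le_trans (lerD H1 H2) _; rewrite -mulrDr ler_wpM2l ?mixrate_ge0//.
rewrite mulnDr natrD mul2n -addnn natrD; lra.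
Qed.

Lemma kcut_bound : kdists K0 kcut 0%N 0%N (sort leq (undup (U ++ V)))
   (sort leq (undup (U ++ V))) <= mixrate K * (2 * size U)%:R.
Proof.
have UV_0 : 0%N \notin U.
  by apply/negP => U0; have := @UV0 0%N; rewrite mem_cat U0 => /(_ isT).
apply: le_trans (kcut_dists _ (path_sort_undup UV0) _) _ => //.
  by move=> i; rewrite mem_sort mem_undup.
rewrite (negbTE UV_0) add0r ler_wpM2l ?mixrate_ge0// ler_nat leq_pmul2l//.
rewrite -size_filter; apply: uniq_leq_size; first by rewrite filter_uniq// sort_uniq undup_uniq.
by move=> i; rewrite mem_filter => /andP[].
Qed.

(** The kernel is replaced by [kcut] in the expectations of [f * g], [f] and [g], each time with the
    factor [2 * size U]; under [kcut] the product formula is exact. *)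
Lemma ex_decouple f g (A B : R) : dep (mem U) f -> dep (mem V) g ->
  (forall s, `|f s| <= A) -> (forall s, `|g s| <= B) ->
  `|E (fun s => f s * g s) - E f * E g| <= A * B * (6 * size U)%:R * mixrate K.
Proof.
move=> df dg fA gB.
have [x0 _] : exists x : X, True.
  apply: contrapT => nx; have := smc_distr_sum1 chain.
  rewrite big1 => [/esym/eqP|x _]; first by rewrite oner_eq0.
  by exfalso; apply: nx; exists x.
pose s0 := fun _ : nat => x0.
set L := sort leq (undup (U ++ V)).
have LE h : dep [pred i | (i \in U) || (i \in V)] h -> E h = EL K0 0%N L s0 h.
  move=> dh; apply: ex_seqE => //.
  by apply: dep_sub dh => i /=; rewrite mem_cat.
have dU (h : (nat -> X) -> R) : dep (mem U) h -> dep [pred i | (i \in U) || (i \in V)] h.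
  by apply: dep_sub => i /= ->.
have dV (h : (nat -> X) -> R) : dep (mem V) h -> dep [pred i | (i \in U) || (i \in V)] h.
  by apply: dep_sub => i /= ->; rewrite orbT.
have A0 : 0 <= A := le_trans (normr_ge0 _) (fA s0).
have B0 : 0 <= B := le_trans (normr_ge0 _) (gB s0).
pose del := mixrate K * (2 * size U)%:R.
have cpl h (D : R) : (forall s, `|h s| <= D) -> `|EL K0 0%N L s0 h - EL kcut 0%N L s0 h| <= D * del.
  move=> hD; apply: le_trans (EL_coupling _ _ _ _ hD _) _ => //.
  - exact: (stochastic_kern chain).
  - exact: stochastic_kcut.
  - by rewrite ler_wpM2l ?kcut_bound//; exact: le_trans (normr_ge0 _) (hD s0).
have ind : EL kcut 0%N L s0 (fun s => f s * g s) = EL kcut 0%N L s0 f * EL kcut 0%N L s0 g.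
  apply: (@EL_indep _ _ _ (mem U)) => //.
  - exact: stochastic_kcut.
  - move=> u v x x' y /= cuv; rewrite /kcut /K0 /kern; case: (u == 0%N) => //=.
    by rewrite (negbTE cuv).
  - apply: dep_sub dg => i /= iV; apply/negP => iU.
    by have := UVK iU iV; lia.
rewrite !LE//; [|exact: dV|exact: dU|]; last first.
  by move=> s s' ss'; congr (_ * _); [exact: (dU f)|exact: (dV g)].
have cf := cpl f A fA; have cg := cpl g B gB.
have cfg : `|EL K0 0%N L s0 (fun s => f s * g s) -
    EL kcut 0%N L s0 (fun s => f s * g s)| <= A * B * del.
  by apply: cpl => s; rewrite normrM ler_pM.
have nf : `|EL kcut 0%N L s0 f| <= A by apply: EL_norm => //; exact: stochastic_kcut.
have ng : `|EL K0 0%N L s0 g| <= B by apply: EL_norm => //; exact: (stochastic_kern chain).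
set ef := EL K0 _ _ _ f in cf *; set eg := EL K0 _ _ _ g in cg ng *.
set ef' := EL kcut _ _ _ f in cf nf ind *; set eg' := EL kcut _ _ _ g in cg ind *.
rewrite ind in cfg.
set e := EL K0 0%N L s0 _ in cfg *.
have -> : e - ef * eg = (e - ef' * eg') - (ef - ef') * eg - ef' * (eg - eg') by ring.
apply: le_trans (ler_normB _ _) _.
have -> : A * B * (6 * size U)%:R * mixrate K = A * B * del + A * del * B + A * (B * del).
  by rewrite /del !natrM; ring.
apply: lerD; last by rewrite normrM ler_pM.
apply: le_trans (ler_normB _ _) _.
by rewrite lerD// normrM ler_pM.
Qed.
End Decouple.

Lemma kern_dist_mu u v K : (u + K <= v)%N ->
  kdist K0 (fun _ _ _ => mu) u v u v <= mixrate K.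
Proof.
move=> uKv; rewrite /kdist /K0 /kern; have [u0|u0] := boolP (u == 0%N).
  under eq_bigr do under eq_bigr do rewrite subrr normr0.
  by rewrite big1 ?mixrate_ge0// => x _; rewrite big1.
apply: le_trans (kernel_mix _) (mixrate_le _); rewrite leq_subRL//.
exact: leq_trans (leq_addr _ _) uKv.
Qed.

Lemma kern_dist u v u' v' K : (u == 0%N) = (u' == 0%N) ->
  (u != 0%N -> (v - u = v' - u')%N \/ ((u + K <= v)%N /\ (u' + K <= v')%N)) ->
  kdist K0 K0 u v u' v' <= 2 * mixrate K.
Proof.
move=> uu' H; rewrite /kdist /K0 /kern -uu'; have [u0|u0] := boolP (u == 0%N).
  under eq_bigr do under eq_bigr do rewrite subrr normr0.
  by rewrite big1 ?mixrate2_ge0// => x _; rewrite big1.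
case: (H u0) => [->|[uv uv']].
  under eq_bigr do under eq_bigr do rewrite subrr normr0.
  by rewrite big1 ?mixrate2_ge0// => x _; rewrite big1.
have H1 : \sum_(x : X) \sum_y `|pn p (v - u) x y - mu y| <= mixrate K.
  apply: le_trans (kernel_mix _) (mixrate_le _); rewrite leq_subRL//.
  exact: leq_trans (leq_addr _ _) uv.
have H2 : \sum_(x : X) \sum_y `|pn p (v' - u') x y - mu y| <= mixrate K.
  apply: le_trans (kernel_mix _) (mixrate_le _); rewrite leq_subRL//.
  exact: leq_trans (leq_addr _ _) uv'.
rewrite mulr2n mulrDl mul1r; apply: le_trans (lerD H1 H2).
rewrite -big_split/=; apply: ler_sum => x _.
rewrite -big_split/=; apply: ler_sum => y _.
rewrite (_ : _ - _ = (pn p (v - u) x y - mu y) - (pn p (v' - u') x y - mu y)); last ring.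
exact: ler_normB.
Qed.

(** The first clause says [b - a = b' - a'] without subtraction. In each case the order of the times
    is the same, and the kernels between them are equal or both close to [mu]. *)
Definition compat K (a b a' b' : nat) : bool :=
  [|| b + a' == b' + a, (a + K <= b) && (a' + K <= b') | (b + K <= a) && (b' + K <= a')]%N.

(** Compatibility turns the correspondence between the two lists into an increasing map [h] of
    times, so sorting matches them term by term and [kern_dist] compares the kernels pairwise. *)
Lemma ex_compat (u u' : seq nat) K f f' (A : R) : (0 < K)%N -> size u = size u' ->
  (forall i, i \in u -> (0 < i)%N) -> (forall i, i \in u' -> (0 < i)%N) ->
  (forall i j, (i < size u)%N -> (j < size u)%N ->
     compat K (nth 0%N u i) (nth 0%N u j) (nth 0%N u' i) (nth 0%N u' j)) ->
  (forall s, `|f s| <= A) ->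
  (forall s s' : nat -> X, map s u = map s' u' -> f s = f' s') ->
  `|E f - E f'| <= A * (2 * size u)%:R * mixrate K.
Proof.
move=> K_gt0 su u0 u'0 cp fA ff'.
have [x0 _] : exists x : X, True.
  apply: contrapT => nx; have := smc_distr_sum1 chain.
  rewrite big1 => [/esym/eqP|x _]; first by rewrite oner_eq0.
  by exfalso; apply: nx; exists x.
pose s0 := fun _ : nat => x0.
pose h a := nth 0%N u' (index a u).
(* [h] is well defined: as [K] is positive, repeated times in [u] have equal counterparts in
   [u']. *)
have hu i : (i < size u)%N -> h (nth 0%N u i) = nth 0%N u' i.
  move=> iu; have := cp _ _ iu (_ : (index (nth 0 u i) u < size u)%N).
  rewrite index_mem mem_nth// nth_index ?mem_nth// => /(_ isT).
  rewrite /compat /h; lia.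
have cph a b : a \in u -> b \in u -> compat K a b (h a) (h b).
  by move=> au bu; have := cp (index a u) (index b u); rewrite !index_mem !nth_index//; apply.
have h_mono a b : a \in u -> b \in u -> (a < b)%N -> (h a < h b)%N.
  by move=> au bu ab; have := cph a b au bu; rewrite /compat; lia.
have mem_h a : a \in u -> h a \in u'.
  by move=> au; rewrite mem_nth// -su index_mem.
pose L := sort leq (undup u).
have Lu i : (i \in L) = (i \in u) by rewrite mem_sort mem_undup.
have LE : sort leq (undup u') = map h L.
  apply: (@irr_sorted_eq _ ltn) => //; [exact: ltn_trans|exact: ltnn|exact: sorted_undup_sort| |].
    have := sorted_undup_sort u; rewrite -/L.
    have : {subset L <= u} by move=> i; rewrite Lu.
    case: (L) => //= a l; elim: l a => //= b l IH a sub /andP[ab bl].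
    rewrite h_mono ?sub ?inE ?eqxx ?orbT//= IH// => i il.
    by apply: sub; rewrite inE il orbT.
  move=> i; rewrite mem_sort mem_undup; apply/idP/mapP => [iu'|[a aL ->]]; last first.
    by apply: mem_h; rewrite -Lu.
  exists (nth 0%N u (index i u')).
    by rewrite Lu mem_nth// su index_mem.
  by rewrite hu ?nth_index// su index_mem.
have uL : uniq L by rewrite sort_uniq undup_uniq.
have uhL : uniq (map h L) by rewrite -LE sort_uniq undup_uniq.
have df : dep (mem u) f.
  move=> s s' ss'.
  have agree i : i \in u' -> exists2 j, (j < size u)%N & nth 0%N u' j = i.
    by move=> iu; exists (index i u'); rewrite ?nth_index// su index_mem.
  pose t i := s (nth 0%N u (index i u')).
  have tE : map s u = map t u'.
    apply: (@eq_from_nth _ x0); rewrite !size_map// => i iu.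
    rewrite !(nth_map 0%N) -?su// /t.
    have ju : (index (nth 0%N u' i) u' < size u)%N.
      by rewrite su index_mem mem_nth// -su.
    have := cp i _ iu ju; rewrite nth_index ?mem_nth -?su//.
    by rewrite /compat => cpi; congr (s _); lia.
  rewrite (ff' s t tE); apply/esym/ff'; rewrite -tE.
  by apply/esym/eq_in_map => i iu; apply: ss'.
have df' : dep (mem u') f'.
  move=> s s' ss'.
  pose t i := s (h i).
  have tE : map t u = map s u'.
    apply: (@eq_from_nth _ x0); rewrite !size_map// => i iu.
    by rewrite !(nth_map 0%N) -?su// /t hu.
  rewrite -(ff' t s tE); apply: ff'; rewrite tE.
  by apply/eq_in_map => i iu; apply: ss'.
rewrite (ex_seqE s0 u0 df) (ex_seqE s0 u'0 df') -/L LE.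
apply: le_trans (EL_coupling _ _ _ _ fA _) _ => //.
- exact: (stochastic_kern chain).
- exact: (stochastic_kern chain).
- by rewrite size_map.
- move=> ys sys; apply: ff'; apply: (@eq_from_nth _ x0); rewrite !size_map// => i iu.
  rewrite !(nth_map 0%N) -?su// -hu//.
  set a := nth 0%N u i.
  have aL : a \in L by rewrite Lu mem_nth.
  have iL : (index a L < size L)%N by rewrite index_mem.
  rewrite -(nth_index 0%N aL) (upds_nth x0)//.
  by rewrite -(nth_map _ 0%N)// (upds_nth x0) ?size_map.
rewrite -mulrA ler_wpM2l//; first exact: le_trans (normr_ge0 _) (fA s0).
apply: (@le_trans _ _ ((size L)%:R * (2 * mixrate K))); last first.
  rewrite mulrA -natrM mulnC ler_wpM2r ?mixrate_ge0// ler_nat leq_pmul2l//.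
  by rewrite size_sort size_undup.
have step a l : a \in u -> path ltn a l -> {subset l <= u} ->
    kdists K0 K0 a (h a) l (map h l) <= (size l)%:R * (2 * mixrate K).
  elim: l a => [|v l IH] a au /=; first by rewrite mul0r.
  move=> /andP[av vl] lu; have vu : v \in u by apply: lu; rewrite mem_head.
  rewrite -natr1 mulrDl mul1r addrC lerD ?IH//.
    by move=> i il; apply: lu; rewrite inE il orbT.
  apply: kern_dist.
    have a0 := u0 a au; have ha0 := u'0 _ (mem_h a au).
    by rewrite (gtn_eqF a0) (gtn_eqF ha0).
  move=> _; have := cph a v au vu; rewrite /compat.
  have := h_mono a v au vu av; lia.
have := path_sort_undup u0; rewrite -/L.
have : {subset L <= u} by move=> i; rewrite Lu.
case: (L) => [|v l] /= lu; first by rewrite mul0r.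
move=> /andP[v0 vl]; rewrite -natr1 mulrDl mul1r addrC lerD//.
  by apply: step => //; [apply: lu; rewrite mem_head|move=> i il; apply: lu; rewrite inE il orbT].
by apply: kern_dist.
Qed.

Lemma EL_product u L s f : EL (fun _ _ _ => mu) u L s f =
  \sum_(t : (size L).-tuple X) f (upds s L t) * \prod_i mu (tnth t i).
Proof.
elim: L u s => [|v L IH] u s /=.
  rewrite (big_pred1 [tuple]) => [|t]; last by rewrite [t]tuple0 /= eqxx.
  by rewrite big_ord0 mulr1.
rewrite (reindex (fun z : X * (size L).-tuple X => [tuple of z.1 :: z.2])) /=; last first.
  exists (fun t => (thead t, [tuple of behead t])) => [[y t] _|t _] /=.
    by rewrite theadE; congr (_, _); apply/val_inj.
  by rewrite -tuple_eta.
rewrite -(pair_bigA _ (fun y (t : (size L).-tuple X) => f (upds (upd s v y) L t) *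
  \prod_(i < (size L).+1) mu (tnth [tuple of y :: t] i))) /=.
apply: eq_bigr => y _; rewrite IH mulr_sumr; apply: eq_bigr => t _.
rewrite big_ord_recl tnth0 mulrCA; congr (_ * (_ * _)).
by apply: eq_bigr => i _; rewrite tnthS.
Qed.

(** Every gap is at least [K], so each kernel may be replaced by [mu], which makes the observed
    states independent. *)
Lemma ex_spaced (q : nat) (u : q.-tuple nat) K (F : q.-tuple X -> R) (A : R) :
  (forall t, `|F t| <= A) -> path (fun a b => (a < b) && (a + K <= b))%N 0%N u ->
  `|E (fun s => F [tuple of map s u]) - pmf_int (@pmf_pow R X mu q) F|
  <= A * q%:R * mixrate K.
Proof.
move=> FA uK.
have [x0 _] : exists x : X, True.
  apply: contrapT => nx; have := smc_distr_sum1 chain.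
  rewrite big1 => [/esym/eqP|x _]; first by rewrite oner_eq0.
  by exfalso; apply: nx; exists x.
pose s0 := fun _ : nat => x0.
have pu : path ltn 0%N u by apply: sub_path uK => a b /andP[].
have uu : uniq u.
  have : sorted ltn u by move: pu; case: (tval u) => //= a l /andP[].
  exact: (sorted_uniq ltn_trans ltnn).
rewrite /E (ex_EL chain s0 pu); last first.
  move=> s s' ss'; congr F; apply/val_inj => /=; apply/eq_in_map => i iu; exact: ss'.
have -> : pmf_int (@pmf_pow R X mu q) F =
    EL (fun _ _ _ => mu) 0%N u s0 (fun s => F [tuple of map s u]).
  rewrite EL_product /pmf_int /pmf_pow.
  move: (size_tuple u) => E0; rewrite (reindex (fun t : (size u).-tuple X => tcast E0 t)) /=; last first.
    exists (fun t => tcast (esym E0) t) => t _; first by rewrite tcastK.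
    by rewrite tcastKV.
  apply: eq_bigr => t _; congr (_ * _).
    congr F; apply/val_inj => /=; rewrite val_tcast.
    have tu : size t = size u by exact: size_tuple.
    apply: (@eq_from_nth _ x0); first by rewrite size_map.
    by move=> i; rewrite tu => iu; rewrite (nth_map 0%N)// (upds_nth x0).
  rewrite -!(big_tuple _ _ _ xpredT mu).
  by rewrite val_tcast.
apply: le_trans (EL_coupling _ _ _ _ _ _) _ => //.
- exact: (stochastic_kern chain).
- move=> a b; split; first by move=> _; exact: smc_distr_ge0 chain.
  by move=> _; exact: smc_distr_sum1 chain.
rewrite -mulrA ler_wpM2l//; first exact: le_trans (normr_ge0 _) (FA [tuple of map s0 u]).
rewrite -[q in leRHS](size_tuple u).
elim: (tval u) 0%N uK => [|v l IH] a /=; first by rewrite mul0r.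
move=> /andP[/andP[av aK] vl]; rewrite -natr1 mulrDl mul1r addrC lerD ?IH//.
exact: kern_dist_mu.
Qed.

End Mixing.

(** * Stein's method *)

Section NonconventionalSums.
Variables (R : realType) (X : finType) (m : nat) (F : m.+1.-tuple X -> R).
Implicit Types (f g : (nat -> X) -> R).

Definition times (n : nat) : m.+1.-tuple nat := [tuple (i.+1 * n)%N | i < m.+1].
Definition term (n : nat) (s : nat -> X) : R := F [tuple of map s (times n)].
Definition psum (N : nat) (A : pred nat) (s : nat -> X) : R :=
  \sum_(1 <= n < N.+1 | A n) term n s.

Lemma nonconv_sumE (Omega : Type) (xi : nat -> Omega -> X) N w : nonconv_sum xi F N w = psum N xpredT (xi^~ w).
Proof.
apply: eq_bigr => n _; congr F; apply: eq_from_tnth => i.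
by rewrite tnth_map !tnth_mktuple.
Qed.

Lemma dep_term n : dep (mem (times n)) (term n).
Proof. by move=> s s' ss'; congr F; apply/val_inj/eq_in_map => i; apply: ss'. Qed.

Lemma timesP n u : reflect (exists2 j : nat, (j < m.+1)%N & u = (j.+1 * n)%N) (u \in times n).
Proof.
apply: (iffP mapP) => [[i _ ->]|[j jm ->]]; first by exists i.
by exists (Ordinal jm); rewrite ?mem_enum.
Qed.

Definition near_times (K n n' : nat) : bool :=
  has (fun u => has (fun v => (u < v + K) && (v < u + K))%N (times n')) (times n).

Lemma nnear_times K n n' u v : ~~ near_times K n n' -> u \in times n -> v \in times n' ->
  (u + K <= v)%N || (v + K <= u)%N.
Proof.
by move=> /hasPn H un vn; have := H u un => /hasPn /(_ v vn); lia.
Qed.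

Definition nearb (K : nat) : nat := (m.+1 * m.+1 * (2 * K))%N.

Lemma sum_nat_count (r : seq nat) (a : pred nat) : (\sum_(i <- r) a i = count a r)%N.
Proof. by elim: r => [|x r IH]; rewrite ?big_nil ?big_cons /= ?IH. Qed.

Lemma count_window N a b K :
  (\sum_(1 <= n' < N.+1) ((a < b.+1 * n' + K) && (b.+1 * n' < a + K)) <= 2 * K)%N.
Proof.
rewrite (sum_nat_count _ (fun n' => (a < b.+1 * n' + K) && (b.+1 * n' < a + K))%N).
rewrite -size_filter; set r := seq.filter _ _.
rewrite -(size_map (fun n' => b.+1 * n')%N r) -(size_iota (a.+1 - K) (2 * K)).
apply: uniq_leq_size.
  rewrite map_inj_uniq; first by rewrite filter_uniq ?iota_uniq.
  by move=> x y /= /eqP; rewrite eqn_pmul2l// => /eqP.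
by move=> x /mapP[y]; rewrite mem_filter mem_iota => /andP[/andP[H1 H2] _] ->; lia.
Qed.

(** For each pair of factors [i], [j] the multiples [j n'] are distinct and lie within [K] of [i n],
    which leaves at most [2 K] choices of [n'], whatever [N] is. *)
Lemma near_count K N n :
  (\sum_(1 <= n' < N.+1 | near_times K n n') 1 <= nearb K)%N.
Proof.
apply: (@leq_trans (\sum_(1 <= n' < N.+1) \sum_(z : 'I_m.+1 * 'I_m.+1)
   ((z.1.+1 * n < z.2.+1 * n' + K) && (z.2.+1 * n' < z.1.+1 * n + K)))%N).
  rewrite big_mkcond/=; apply: leq_sum => n' _; case: ifP => // /hasP[u /timesP[j jm ->]].
  move=> /hasP[v /timesP[j' jm' ->]] H.
  by rewrite (bigD1 (Ordinal jm, Ordinal jm'))//= H.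
rewrite exchange_big/=.
apply: (@leq_trans (\sum_(z : 'I_m.+1 * 'I_m.+1) 2 * K)%N); last first.
  by rewrite sum_nat_const card_prod !card_ord.
by apply: leq_sum => -[j j'] _ /=; exact: count_window.
Qed.

Lemma path_iota1 k : path ltn 0%N (iota 1 k).
Proof. by have := iota_ltn_sorted 0 k.+1. Qed.

Section FixedN.
Variable N : nat.

Lemma times_range n u : (0 < n <= N)%N -> u \in times n -> (0 < u <= m.+1 * N)%N.
Proof.
move=> /andP[n0 nN] /timesP[j jm ->]; rewrite muln_gt0 n0 /=.
by apply: leq_mul.
Qed.

Lemma dep_term_N n : (0 < n <= N)%N -> dep [pred i | 0 < i <= m.+1 * N]%N (term n).
Proof. by move=> nN; apply: dep_sub (@dep_term n) => i /=; exact: times_range. Qed.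

Definition alltimes (A : pred nat) : seq nat :=
  flatten [seq tval (times n) | n <- iota 1 N & A n].

Lemma alltimesP A u : reflect (exists2 n, (0 < n <= N)%N && A n & u \in times n)
  (u \in alltimes A).
Proof.
apply: (iffP flatten_mapP) => -[n].
  rewrite mem_filter mem_iota => H un; exists n => //; lia.
by move=> H un; exists n => //; rewrite mem_filter mem_iota; lia.
Qed.

Lemma dep_psum A : dep (mem (alltimes A)) (psum N A).
Proof.
move=> s s' ss'; rewrite /psum [LHS]big_nat_cond [RHS]big_nat_cond; apply: eq_bigr => n /andP[nN An].
apply: dep_term => i iu; apply: ss' => /=; apply/alltimesP.
by exists n => //; rewrite An andbT; lia.
Qed.

Lemma alltimes_range A u : u \in alltimes A -> (0 < u <= m.+1 * N)%N.
Proof. by move=> /alltimesP[n /andP[nN _]]; exact: times_range. Qed.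

Lemma dep_psum_N A : dep [pred i | 0 < i <= m.+1 * N]%N (psum N A).
Proof. by apply: dep_sub (@dep_psum A) => i /=; exact: alltimes_range. Qed.

End FixedN.
End NonconventionalSums.

Section TruncatedExpectation.
Variables (R : realType) (X : finType) (mu : X -> R) (p : X -> X -> R) (m : nat).
Variables (s0 : nat -> X) (N : nat).

(** All times up to [m.+1 * N] are observed, so one finite sum serves all functions of the first [N]
    terms, and its linearity requires no condition on the functions. *)
Definition trunc_ex (f : (nat -> X) -> R) : R := EL (kern mu p) 0%N (iota 1 (m.+1 * N)) s0 f.
Lemma trunc_exE d (Omega : measurableType d) (P : probability Omega R) (xi : nat -> Omega -> X) f :
  stationary_markov_chain P xi mu p ->
  dep [pred i | 0 < i <= m.+1 * N]%N f -> trunc_ex f = ex P xi f.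
Proof.
move=> chain df; rewrite (ex_EL chain s0 (path_iota1 (m.+1 * N)))//.
by apply: dep_sub df => i /=; rewrite mem_iota; lia.
Qed.

End TruncatedExpectation.

Section Stein.
Variables (R : realType) (d : measure_display) (Omega : measurableType d).
Variables (P : probability Omega R) (X : finType) (xi : nat -> Omega -> X).
Variables (mu : X -> R) (p : X -> X -> R).
Hypothesis chain : stationary_markov_chain P xi mu p.
Variables (C th : R).
Hypothesis C0 : 0 <= C.
Hypothesis th01 : 0 < th < 1.
Hypothesis mix : forall n x, \sum_y `|pn p n x y - mu y| <= C * th ^+ n.
Variables (m : nat) (F : m.+1.-tuple X -> R) (M : R).
Hypothesis FM : forall t, `|F t| <= M.
Hypothesis Fc : pmf_int (@pmf_pow R X mu m.+1) F = 0.
Variable s0 : nat -> X.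
Implicit Types (f g : (nat -> X) -> R).
Notation term := (term F).
Notation psum := (psum F).
Notation times := (times m).
Notation near_times := (near_times m).
Notation nearb := (nearb m).

Lemma M0 : 0 <= M.
Proof. exact: le_trans (normr_ge0 _) (FM [tuple of map s0 (times 0)]). Qed.

Lemma termM n s : `|term n s| <= M. Proof. exact: FM. Qed.

Lemma near_psum K N n (A : pred nat) s : (forall n', A n' -> near_times K n n') ->
  `|psum N A s| <= M * (nearb K)%:R.
Proof.
move=> An; apply: le_trans (ler_norm_sum _ _ _) _.
apply: (@le_trans _ _ (\sum_(1 <= n' < N.+1 | near_times K n n') M)).
  rewrite [leLHS]big_mkcond [leRHS]big_mkcond/=; apply: ler_sum => n' _.
  case: ifPn => [/An ->|_]; first exact: termM.
  by case: ifP => // _; exact: M0.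
rewrite -[X in \sum_(_ <= _ < _ | _) X]mulr1 -mulr_sumr ler_wpM2l ?M0//.
by rewrite -(natr_sum _ _ _ (fun=> 1%N)) ler_nat near_count.
Qed.

Section FixedN.
Variable N : nat.
Notation EN := (trunc_ex mu p m s0 N).
Notation alltimes := (alltimes m N).
Let sk : stochastics (kern mu p) := stochastic_kern chain.

Lemma EN_decouple (U V : seq nat) (K : nat) f g (A B : R) : (0 < K)%N ->
  (forall u, u \in U -> 0 < u <= m.+1 * N)%N -> (forall u, u \in V -> 0 < u <= m.+1 * N)%N ->
  (forall u v, u \in U -> v \in V -> (u + K <= v)%N || (v + K <= u)%N) ->
  dep (mem U) f -> dep (mem V) g ->
  (forall s, `|f s| <= A) -> (forall s, `|g s| <= B) ->
  `|EN (fun s => f s * g s) - EN f * EN g| <= A * B * (6 * size U)%:R * mixrate X C th K.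
Proof.
move=> K0 U0 V0 UV df dg fA gB.
have dfN : dep [pred i | 0 < i <= m.+1 * N]%N f by apply: dep_sub df => i /=; apply: U0.
have dgN : dep [pred i | 0 < i <= m.+1 * N]%N g by apply: dep_sub dg => i /=; apply: V0.
rewrite !(trunc_exE _ chain)//; last first.
  by move=> s s' ss'; congr (_ * _); [exact: dfN|exact: dgN].
apply: (ex_decouple chain C0 th01 mix K0 (V := V)) => // i.
by rewrite mem_cat => /orP[/U0|/V0] /andP[].
Qed.

(** The times [n, 2 n, ...] are [n] apart, so the mean is close to the integral of [F] under the
    product measure, which is 0. The error is summable in [n]. *)
Lemma EN_term_mean n : (0 < n <= N)%N ->
  `|EN (term n)| <= M * m.+1%:R * mixrate X C th n.
Proof.
move=> nN; rewrite (trunc_exE s0 chain); last exact: dep_term_N.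
have := @ex_spaced _ _ _ P X xi mu p chain C th C0 th01 mix m.+1 (times n) n F M FM.
rewrite Fc subr0; apply.
have H : forall q i, path (fun a b => (a < b) && (a + n <= b))%N (i * n)%N
    [seq (k.+1 * n)%N | k <- iota i q].
  elim=> //= q IH i; rewrite IH andbT; lia.
have := H m.+1 0%N; rewrite mul0n -val_enum_ord -map_comp; congr path.
Qed.

Section SteinBound.
Variables (K : nat) (psi psi' : R -> R) (B1 B2 : R).
Hypothesis K0 : (0 < K)%N.
Hypothesis psi1 : forall x, `|psi x| <= 1.
Hypothesis psi'1 : forall x, `|psi' x| <= B1.
Hypothesis psi_taylor : forall x h, `|psi (x + h) - psi x - h * psi' x| <= B2 * h ^+ 2.
Hypothesis psi'_lip : forall x h, `|psi' (x + h) - psi' x| <= B2 * `|h|.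

(** The part of the second moment due to pairs of near terms; by [cov_far] the other pairs
    contribute little. *)
Definition nearvar : R := \sum_(1 <= n < N.+1) \sum_(1 <= n' < N.+1 | near_times K n n')
  EN (fun s => term n s * term n' s).

Let Q : R := (nearb K)%:R.
Let S := psum N xpredT.
Let far n := psum N (predC (near_times K n)).
Let far2 n n' := psum N (predC (predU (near_times K n) (near_times K n'))).
Let mr := mixrate X C th.
Let l : R := m.+1%:R.

Lemma psum_split (A : pred nat) s : psum N xpredT s = psum N A s + psum N (predC A) s.
Proof. exact: (bigID A). Qed.

Lemma B2_ge0 : 0 <= B2.
Proof. by have := psi'_lip 0 1; rewrite normr1 mulr1; apply: le_trans. Qed.

Lemma B1_ge0 : 0 <= B1.
Proof. exact: le_trans (normr_ge0 _) (psi'1 0). Qed.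

Lemma Q_ge0 : 0 <= Q. Proof. exact: ler0n. Qed.

Lemma far2_far n n' s : `|far n s - far2 n n' s| <= M * Q.
Proof.
rewrite /far /psum (bigID (near_times K n'))/=.
rewrite (_ : \sum_(1 <= i < N.+1 | ~~ near_times K n i && ~~ near_times K n' i) _ = far2 n n' s); last first.
  by apply: eq_bigl => i /=; rewrite negb_or.
rewrite addrK; apply: (@near_psum K N n' [pred i | ~~ near_times K n i && near_times K n' i]).
by move=> i /= /andP[].
Qed.

Lemma far2_S n n' s : `|S s - far2 n n' s| <= 2 * (M * Q).
Proof.
rewrite (_ : S s - far2 n n' s = (S s - far n s) + (far n s - far2 n n' s)); last ring.
rewrite mulr2n mulrDl mul1r; apply: le_trans (ler_normD _ _) _.
rewrite lerD ?far2_far// /S (psum_split (near_times K n)) addrK.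
exact: (@near_psum K N n (near_times K n)).
Qed.

(** The sum [far n] still contains terms near [n'], so it is first reduced to [far2 n n'], which is
    decoupled from both terms; afterwards the full sum is restored. The first change costs [M * Q]
    and the second twice as much, hence the 3; the [12 * l] is 6 for each of [2 * l] times. *)
Lemma stein_pair n n' : (0 < n <= N)%N -> (0 < n' <= N)%N ->
  `|EN (fun s => term n s * term n' s * psi' (far n s)) -
    EN (fun s => term n s * term n' s) * EN (fun s => psi' (S s))|
  <= 3 * (M ^+ 3 * B2 * Q) + M ^+ 2 * B1 * (12 * l) * mr K.
Proof.
move=> nN nN'.
have M_0 := M0; have B_0 := B2_ge0; have Q_0 := Q_ge0.
set TT := fun s => term n s * term n' s.
have TM s : `|TT s| <= M ^+ 2 by rewrite normrM expr2 ler_pM ?termM.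
have c1 : `|EN (fun s => TT s * psi' (far n s)) - EN (fun s => TT s * psi' (far2 n n' s))|
   <= M ^+ 2 * (B2 * (M * Q)).
  rewrite -ELB; apply: EL_norm => // s; rewrite -mulrBr normrM ler_pM//.
  have := psi'_lip (far2 n n' s) (far n s - far2 n n' s); rewrite [far2 _ _ _ + _]addrC subrK => /le_trans; apply.
  by rewrite ler_wpM2l ?far2_far.
have c2 : `|EN (fun s => TT s * psi' (far2 n n' s)) - EN TT * EN (fun s => psi' (far2 n n' s))|
   <= M ^+ 2 * B1 * (12 * l) * mr K.
  have := @EN_decouple (times n ++ times n') (alltimes (predC (predU (near_times K n) (near_times K n'))))
    K TT (fun s => psi' (far2 n n' s)) (M ^+ 2) B1 K0.
  rewrite size_cat !size_tuple addnn -mul2n mulnA natrM; apply => //.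
  - by move=> u; rewrite mem_cat => /orP[]; apply: times_range.
  - exact: alltimes_range.
  - move=> u v; rewrite mem_cat => uU /alltimesP[i /andP[_ /=]]; rewrite negb_or => /andP[H1 H2] vi.
    by case/orP: uU => uU; [exact: (nnear_times H1)|exact: (nnear_times H2)].
  - move=> s s' ss'; congr (_ * _); apply: dep_term => i iu; apply: ss'; rewrite /= mem_cat.
      by apply/orP; left; exact: iu.
    by apply/orP; right; exact: iu.
  - by move=> s s' ss'; congr psi'; apply: dep_psum.
have c3 : `|EN TT * EN (fun s => psi' (far2 n n' s)) - EN TT * EN (fun s => psi' (S s))|
   <= M ^+ 2 * (B2 * (2 * (M * Q))).
  rewrite -mulrBr normrM ler_pM//; first exact: EL_norm.
  rewrite distrC -ELB; apply: EL_norm => // s.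
  have := psi'_lip (far2 n n' s) (S s - far2 n n' s); rewrite [far2 _ _ _ + _]addrC subrK => /le_trans; apply.
  by rewrite ler_wpM2l ?far2_S.
move: c1 c2 c3; set a := EN _; set b := EN _; set c := EN TT * EN _; set e := EN TT * EN _.
move=> c1 c2 c3.
rewrite (_ : a - e = (a - b) + (b - c) + (c - e)); last ring.
apply: le_trans (ler_normD _ _) _; apply: le_trans (lerD (ler_normD _ _) (lexx _)) _.
apply: le_trans (lerD (lerD c1 c2) c3) _.
rewrite le_eqVlt; apply/orP; left; apply/eqP; ring.
Qed.

(** Taylor expansion of [psi (S s)] at [far n s]. The leading term nearly vanishes, since [term n]
    is decoupled from [far n] and has small mean; the linear term yields the covariances with the
    near terms. *)
Lemma stein_one n : (0 < n <= N)%N ->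
  `|EN (fun s => term n s * psi (S s)) -
    (\sum_(1 <= n' < N.+1 | near_times K n n') EN (fun s => term n s * term n' s))
      * EN (fun s => psi' (S s))|
  <= 4 * (M ^+ 3 * B2 * Q ^+ 2) + M * l * mr n + 6 * (M * l * mr K)
     + 12 * (M ^+ 2 * B1 * l * Q * mr K).
Proof.
move=> nN.
have M_0 := M0; have B_0 := B2_ge0; have Q_0 := Q_ge0; have B1_0 := B1_ge0.
have m_0 := mixrate_ge0 X C0 th01 K.
pose D := psum N (near_times K n).
have DQ s : `|D s| <= M * Q by apply: (@near_psum K N n (near_times K n)).
have SE s : S s = far n s + D s by rewrite /S (psum_split (near_times K n)) addrC.
have a1 : `|EN (fun s => term n s * psi (S s)) - EN (fun s => term n s * psi (far n s))
    - EN (fun s => term n s * D s * psi' (far n s))| <= M * (B2 * (M * Q) ^+ 2).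
  rewrite -!ELB; apply: EL_norm => // s.
  rewrite -mulrA -!mulrBr normrM ler_pM ?termM// SE.
  apply: le_trans (psi_taylor _ _) _.
  by rewrite ler_wpM2l// -(ger0_norm (sqr_ge0 (D s))) normrX lerXn2r ?nnegrE ?mulr_ge0.
have a2 : `|EN (fun s => term n s * psi (far n s))| <= M * l * mr n + 6 * (M * l * mr K).
  have := @EN_decouple (times n) (alltimes (predC (near_times K n)))
    K (term n) (fun s => psi (far n s)) M 1 K0.
  rewrite size_tuple mulr1 => H.
  have {}H : `|EN (fun s => term n s * psi (far n s)) - EN (term n) * EN (fun s => psi (far n s))|
     <= M * (6 * m.+1)%:R * mixrate X C th K.
    apply: H => //.
    - by move=> u; apply: times_range.
    - exact: alltimes_range.
    - by move=> u v uU /alltimesP[i /andP[_ /= H1]] vi; exact: (nnear_times H1).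
    - exact: dep_term.
    - by move=> s s' ss'; congr psi; apply: dep_psum.
    - exact: termM.
  have H2 : `|EN (term n) * EN (fun s => psi (far n s))| <= M * l * mr n.
    rewrite normrM -[leRHS]mulr1 ler_pM//; first exact: EN_term_mean.
    by apply: EL_norm.
  rewrite -(subrK (EN (term n) * EN (fun s => psi (far n s))) (EN (fun s => _ * _))).
  apply: le_trans (ler_normD _ _) _; rewrite addrC lerD//; apply: le_trans H _.
  by rewrite natrM le_eqVlt; apply/orP; left; apply/eqP; rewrite /l /mr; ring.
have a3 : `|EN (fun s => term n s * D s * psi' (far n s)) -
   (\sum_(1 <= n' < N.+1 | near_times K n n') EN (fun s => term n s * term n' s))
      * EN (fun s => psi' (S s))| <=
   (3 * (M ^+ 3 * B2 * Q) + M ^+ 2 * B1 * (12 * l) * mr K) * Q.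
  have -> : EN (fun s => term n s * D s * psi' (far n s)) =
    \sum_(1 <= n' < N.+1 | near_times K n n') EN (fun s => term n s * term n' s * psi' (far n s)).
    rewrite -EL_sum; apply: eq_EL => s.
    by rewrite /D /psum mulr_sumr mulr_suml.
  rewrite mulr_suml -sumrB; apply: le_trans (ler_norm_sum _ _ _) _.
  set c := 3 * _ + _.
  have c0 : 0 <= c.
    by rewrite /c; apply: addr_ge0; repeat first [done | apply: exprn_ge0 | apply: mulr_ge0].
  apply: (@le_trans _ _ (\sum_(1 <= n' < N.+1 | near_times K n n') c)).
    rewrite [leLHS]big_nat_cond [leRHS]big_nat_cond; apply: ler_sum => n' /andP[n'N _].
    by apply: stein_pair => //; lia.
  rewrite -[X in \sum_(_ <= _ < _ | _) X]mulr1 -mulr_sumr ler_wpM2l//.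
  by rewrite -(natr_sum _ _ _ (fun=> 1%N)) ler_nat near_count.
move: a1 a2 a3; set a := EN _; set b := EN _; set c := EN _; set e := _ * EN _.
move=> a1 a2 a3.
rewrite (_ : a - e = (a - b - c) + b + (c - e)); last ring.
apply: le_trans (ler_normD _ _) _; apply: le_trans (lerD (ler_normD _ _) (lexx _)) _.
apply: le_trans (lerD (lerD a1 a2) a3) _.
rewrite le_eqVlt; apply/orP; left; apply/eqP; ring.
Qed.

(* [psi (S s)] is expanded around the part [far n] of the sum whose times are all at distance at
   least [K] from those of [term n], hence nearly independent of it. *)
Lemma stein_bound :
  `|EN (fun s => S s * psi (S s)) - nearvar * EN (fun s => psi' (S s))|
  <= N%:R * (4 * (M ^+ 3 * B2 * Q ^+ 2) + 6 * (M * l * mr K)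
     + 12 * (M ^+ 2 * B1 * l * Q * mr K)) + M * l * \sum_(1 <= n < N.+1) mr n.
Proof.
have -> : EN (fun s => S s * psi (S s)) = \sum_(1 <= n < N.+1) EN (fun s => term n s * psi (S s)).
  by rewrite -EL_sum; apply: eq_EL => s; rewrite mulr_suml.
rewrite /nearvar mulr_suml -sumrB; apply: le_trans (ler_norm_sum _ _ _) _.
apply: (@le_trans _ _ (\sum_(1 <= n < N.+1) ((4 * (M ^+ 3 * B2 * Q ^+ 2) + 6 * (M * l * mr K)
     + 12 * (M ^+ 2 * B1 * l * Q * mr K)) + M * l * mr n))).
  rewrite [leLHS]big_nat_cond [leRHS]big_nat_cond; apply: ler_sum => n /andP[nN _].
  apply: le_trans (stein_one _) _; first by lia.
  by rewrite le_eqVlt; apply/orP; left; apply/eqP; ring.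
by rewrite big_split/= sumr_const_nat subSS subn0 -[(_ + _) *+ N]mulr_natl -mulr_sumr.
Qed.
End SteinBound.
End FixedN.
End Stein.

(** * Existence of the limit variance *)

Section SequenceLemmas.
Variable R : realType.
Implicit Types (th : R) (a : nat -> R).

Lemma geometric_sum_le th n : 0 <= th < 1 -> \sum_(0 <= i < n) th ^+ i <= (1 - th)^-1.
Proof.
move=> /andP[t0 t1]; rewrite -[leRHS]mul1r ler_pdivlMr ?subr_gt0//.
rewrite big_mkord -opprB mulrN mulrC -subrX1 opprB.
by rewrite gerBl exprn_ge0.
Qed.

Lemma bernoulli_root th q : 0 < th < 1 -> exists2 t : R, 0 < t < 1 & th <= t ^+ q.
Proof.
move=> /andP[t0 t1].
pose u := (1 - th) / q.+1%:R.
have u0 : 0 < u by rewrite divr_gt0 ?ltr0n// subr_gt0.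
have uq : u * q.+1%:R = 1 - th by rewrite divfK// pnatr_eq0.
have u1 : u < 1.
  rewrite ltr_pdivrMr ?ltr0n// mul1r; apply: (@lt_le_trans _ _ 1); first by rewrite ltrBlDr ltrDl.
  by rewrite ler1n.
have ber k : 1 - k%:R * u <= (1 - u) ^+ k.
  elim: k => [|k IH]; first by rewrite expr0 mul0r subr0.
  rewrite exprS -natr1 mulrDl mul1r.
  have v0 : 0 <= 1 - u by rewrite subr_ge0 ltW.
  apply: le_trans (ler_wpM2l v0 IH).
  have : 0 <= k%:R :> R by rewrite ler0n.
  by move: u0; clear; nra.
exists (1 - u); first by rewrite subr_gt0 u1 ltrBlDr ltrDl.
apply: le_trans (ber q); rewrite lerBrDr -lerBrDl -uq mulrC ler_wpM2l ?(ltW u0)//.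
by rewrite ler_nat.
Qed.

(** With [th <= t ^+ (2 * q)] a factor [t ^+ n * t ^+ n] appears, up to a constant. One half absorbs
    [n.+1], since [n.+1%:R * t ^+ n] is at most a geometric sum. *)
Lemma linear_geometric th q : 0 < th < 1 -> (0 < q)%N ->
  exists2 C : R, 0 <= C & exists2 t : R, 0 < t < 1 &
    forall n, n.+1%:R * th ^+ (n %/ q) <= C * t ^+ n.
Proof.
move=> th01 q0; have [t /andP[t0 t1] tq] := bernoulli_root (2 * q) th01.
have tpos : 0 < 1 - t by rewrite subr_gt0.
exists ((t ^+ (2 * q))^-1 / (1 - t)); first by rewrite divr_ge0 ?invr_ge0 ?exprn_ge0// ltW.
exists t => [|n]; first by rewrite t0.
have H1 : n.+1%:R * t ^+ n <= (1 - t)^-1.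
  apply: le_trans (@geometric_sum_le t n.+1 _); last by rewrite ltW.
  rewrite mulr_natl -[n.+1 in leLHS]subn0 -sumr_const_nat.
  apply: ler_sum_nat => i /= iN; rewrite ler_wiXn2l//; try exact: ltW.
have H2 : th ^+ (n %/ q) <= (t ^+ (2 * q))^-1 * (t ^+ n * t ^+ n).
  rewrite mulrC ler_pdivlMr ?exprn_gt0//.
  apply: (@le_trans _ _ ((t ^+ (2 * q)) ^+ (n %/ q) * t ^+ (2 * q))).
    rewrite ler_wpM2r ?exprn_ge0// ?(ltW t0)// lerXn2r// ?nnegrE ?exprn_ge0 ?(ltW t0)//.
    by case/andP: th01 => /ltW.
  rewrite -exprM -!exprD ler_wiXn2l// ?(ltW t0) ?(ltW t1)//.
  have := ltn_ceil n q0; rewrite mulSn => H.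
  by rewrite -mulnA -mulnDr addnn -mul2n leq_pmul2l// mulnC addnC ltnW.
apply: le_trans (ler_wpM2l (ler0n _ _) H2) _.
set w := (t ^+ (2 * q))^-1.
rewrite [leLHS](_ : _ = w * t ^+ n * (n.+1%:R * t ^+ n)); last ring.
move: (n.+1%:R) H1 => N1 H1.
rewrite [leRHS]mulrAC ler_wpM2l// mulr_ge0 ?invr_ge0 ?exprn_ge0//;
exact: ltW.
Qed.

(* The increments of the second moment are almost periodic, not convergent, so the limit
   variance is a Cesaro limit. *)
Lemma cesaro_periodic a T (C th : R) : (0 < T)%N -> 0 <= C -> 0 < th < 1 ->
  (forall n, `|a (n + T)%N - a n| <= C * th ^+ n) ->
  cvgn (fun N : nat => (\sum_(0 <= n < N) a n) / N%:R).
Proof.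
move=> T0 C0 /andP[th0 th1] aT.
pose A := \sum_(0 <= i < T) `|a i| + C / (1 - th).
have A_0 : 0 <= C / (1 - th) by rewrite divr_ge0 ?subr_ge0 ?(ltW th1).
have aB n : `|a n| <= A.
  suff : `|a n| <= \sum_(0 <= i < T) `|a i| + C * \sum_(0 <= i < n) th ^+ i.
    move=> /le_trans; apply; rewrite lerD2l ler_wpM2l// geometric_sum_le//.
    by rewrite (ltW th0).
  elim/ltn_ind : n => n IH.
  have S0 k : 0 <= \sum_(0 <= i < k) th ^+ i :> R.
    by apply: sumr_ge0 => i _; rewrite exprn_ge0// ltW.
  have [nT|Tn] := ltnP n T.
    apply: (@le_trans _ _ (\sum_(0 <= i < T) `|a i|)); last by rewrite lerDl mulr_ge0.
    rewrite (@big_cat_nat _ _ _ n) ?(ltnW nT)//= [X in _ + X]big_ltn//.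
    by rewrite addrCA lerDl addr_ge0// sumr_ge0.
  have nTn : (n - T < n)%N by rewrite ltn_subrL T0 (leq_trans T0).
  have := aT (n - T)%N; rewrite subnK// => H.
  rewrite -(subrK (a (n - T)%N) (a n)); apply: le_trans (ler_normD _ _) _.
  apply: le_trans (lerD H (IH _ nTn)) _.
  rewrite addrCA lerD2l -mulrDr ler_wpM2l// addrC -big_nat_recr//=.
  rewrite [leRHS](@big_cat_nat _ _ _ (n - T).+1)//= lerDl.
  by apply: sumr_ge0 => i _; rewrite exprn_ge0// ltW.
have A0 : 0 <= A := le_trans (normr_ge0 _) (aB 0%N).
(* The sums over a full period converge, as their increments [a (n + T) - a n] are summable. Up to
   [O(1 / N)], their averages are [T] times those of [a]. *)
pose D n := \sum_(0 <= i < T) a (n + i)%N.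
have DS n : D n.+1 - D n = a (n + T)%N - a n.
  rewrite /D; case: T T0 {aT A aB A0 D} => // T _.
  rewrite big_nat_recr//= [X in _ - X]big_nat_recl//= addn0 addSnnS.
  have -> : \sum_(0 <= i < T) a (n.+1 + i)%N = \sum_(0 <= i < T) a (n + i.+1)%N.
    by apply: eq_bigr => i _; rewrite addSnnS.
  ring.
have cD : cvgn (D : R^o^nat).
  have -> : D = (fun n => D 0%N + series (telescope D) n).
    by apply/funext => n; exact: eq_sum_telescope.
  apply: is_cvgD; first exact: is_cvg_cst.
  apply: normed_cvg; apply: (@series_le_cvg _ _ (geometric C th)) => [n|n|n|].
  - exact: normr_ge0.
  - by rewrite /geometric/= mulr_ge0// exprn_ge0// ltW.
  - by rewrite /telescope/= DS; exact: aT.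
  - by apply: is_cvg_geometric_series; rewrite ger0_norm// ltW.
have cM := cesaro cD.
set L := limn _ in cM.
have close N : `|arithmetic_mean D N - T%:R * ((\sum_(0 <= n < N.+1) a n) / N.+1%:R)|
   <= 2 * T%:R * T%:R * A / N.+1%:R.
  rewrite /arithmetic_mean/= mulrC mulrA -mulrBl normrM [X in _ * X]ger0_norm ?invr_ge0//.
  rewrite ler_wpM2r ?invr_ge0// seriesEnat/= /D exchange_big/=.
  have sh i : `|\sum_(0 <= n < N.+1) a (n + i)%N - \sum_(0 <= n < N.+1) a n| <= 2 * i%:R * A.
    elim: i => [|i IH].
      by rewrite mulr0 mul0r normr_le0 subr_eq0; apply/eqP/eq_bigr => n _; rewrite addn0.
    have -> : \sum_(0 <= n < N.+1) a (n + i.+1)%N = \sum_(0 <= n < N.+1) a (n + i)%N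
        + (a (N.+1 + i)%N - a i).
      have := telescope_sumr (fun n => a (n + i)%N) (leq0n N.+1).
      rewrite add0n => <-; rewrite -big_split/=; apply: eq_bigr => n _.
      by rewrite addnS -addSn; ring.
    rewrite addrAC; apply: le_trans (ler_normD _ _) _.
    have -> : 2 * i.+1%:R * A = 2 * i%:R * A + (A + A) by rewrite -natr1; ring.
    by rewrite lerD//; apply: le_trans (ler_normB _ _) _; rewrite lerD.
  rewrite mulr_natl -[X in _ *+ X]subn0 -sumr_const_nat -sumrB.
  apply: le_trans (ler_norm_sum _ _ _) _.
  apply: (@le_trans _ _ (\sum_(0 <= i < T) (2 * T%:R * A))).
    apply: ler_sum_nat => i /= iT; apply: le_trans (sh i) _.
    by rewrite ler_wpM2r// ler_wpM2l// ler_nat ltnW.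
  by rewrite sumr_const_nat subn0 -mulr_natl le_eqVlt; apply/orP; left; apply/eqP; ring.
have TR : T%:R != 0 :> R by rewrite pnatr_eq0 -lt0n.
suff : (fun N : nat => (\sum_(0 <= n < N) a n) / N%:R) @ \oo --> T%:R^-1 * L.
  by move=> H; apply/cvg_ex; exists (T%:R^-1 * L).
rewrite -(cvg_shiftS (fun N : nat => (\sum_(0 <= n < N) a n) / N%:R)).
have -> : (fun n => (\sum_(0 <= n0 < n.+1) a n0) / n.+1%:R) =
  (fun n => T%:R^-1 * (arithmetic_mean D n -
     (arithmetic_mean D n - T%:R * ((\sum_(0 <= n0 < n.+1) a n0) / n.+1%:R)))).
  by apply/funext => n; rewrite opprB addrC subrK mulKf.
apply: cvgMr; rewrite -[L]subr0; apply: cvgB => //.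
apply/norm_cvg0P; apply: (@squeeze_cvgr _ _ _ _ (fun=> 0) (fun n => (2 * T%:R * T%:R * A) * n.+1%:R^-1)).
- by near=> n; rewrite normr_ge0/= close.
- exact: cvg_cst.
- rewrite -[X in _ --> X](mulr0 (2 * T%:R * T%:R * A)); apply: cvgMr; exact: cvg_harmonic.
Unshelve. all: by end_near. Qed.

End SequenceLemmas.

(** * Arithmetic of the pairs (n, N) near a line a n = b N *)

Section WindowArithmetic.
Local Open Scope nat_scope.

(* [|a n - b N| < K] without subtraction. *)
Definition window (K a b n N : nat) : bool := (a * n < b * N + K) && (b * N < a * n + K).

(** The shift [(c, T)] runs along the line [a n = b N]. Inside the window the condition [n <= N] is
    decided by the slope once [K <= N]: it holds if [b < a], fails if [a < b], and is invariant if
    [a = b], where [c = T]. *)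
Lemma window_shift K a b c T n N : 0 < a -> 0 < b -> 0 < K -> K <= N -> a * c = b * T -> 0 < T -> 0 < n ->
  (window K a b (n + c) (N + T) && (n + c <= N + T)) = (window K a b n N && (n <= N)).
Proof.
move=> a0 b0 K0 KN acbT T0 n0; rewrite /window !mulnDr acbT.
set an := a * n; set bN := b * N.
have -> : (an + b * T < bN + b * T + K) = (an < bN + K) by lia.
have -> : (bN + b * T < an + b * T + K) = (bN < an + K) by lia.
case: (ltnP an (bN + K)) => //= H1; case: (ltnP bN (an + K)) => //= H2.
have [ba|ab|ab] := ltngtP b a.
- have cT : c <= T by rewrite -(leq_pmul2l a0) acbT leq_mul2r ltnW ?orbT.
  apply/idP/idP => [H|]; last by lia.
  rewrite leqNgt; apply/negP => Nn.
  suff : bN + K <= an by lia.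
  apply: (@leq_trans (b.+1 * N)); first by rewrite mulSn addnC leq_add.
  by apply: leq_mul => //; exact: ltnW.
- have cT : T <= c by rewrite -(leq_pmul2l a0) acbT leq_mul2r ltnW ?orbT.
  have nN : N < n.
    rewrite ltnNge; apply/negP => nN.
    suff : an + K <= bN by lia.
    apply: (@leq_trans (a.+1 * N)); last by apply: leq_mul.
    by rewrite mulSn addnC leq_add// leq_mul.
  by lia.
- have -> : c = T by apply/eqP; rewrite -(eqn_pmul2l a0) acbT ab.
  by rewrite leq_add2r.
Qed.

(** These are the indices that are not of the form [n' + c] with [n'] positive; as they lie outside
    the window, shifting the summation index by [c] loses nothing. *)
Lemma window_small K a b c T n N : 0 < b -> K <= N -> a * c = b * T -> n <= c ->
  ~~ window K a b n (N + T).
Proof.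
move=> b0 KN acbT nc; rewrite /window mulnDr -acbT negb_and -!leqNgt orbC.
have : a * n <= a * c by rewrite leq_mul2l nc orbT.
have : N <= b * N by rewrite leq_pmull.
lia.
Qed.

(** If [al * b = be * a], the shift moves both times equally. Otherwise these products differ by at
    least 1, so [a] times the gap between the two times is at least [N - al * K], hence at least
    [a * K], and the shift does not narrow the gap. *)
Lemma compat_shift K l a b c T n N al be : 0 < a <= l -> 0 < b <= l -> 0 < K -> 4 * l * K <= N ->
  a * c = b * T -> 0 < al <= l -> 0 < be <= l -> window K a b n N ->
  compat K (al * n) (be * N) (al * (n + c)) (be * (N + T)).
Proof.
move=> /andP[a0 al_l] /andP[b0 bl] K0 KN acbT /andP[alpha0 alphal] /andP[beta0 betal] /andP[H1 H2].
have aK : (a + al) * K <= N.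
  apply: leq_trans KN; rewrite leq_mul2r; apply/orP; right; lia.
have bK : (a + al) * K <= N by [].
have acT : a * (al * c) = al * b * T by rewrite mulnCA acbT mulnA.
have abT : a * (be * T) = be * a * T by rewrite mulnCA mulnA.
have G1 : al * (b * N) <= al * (a * n) + al * K.
  by rewrite -mulnDr leq_mul2l ltnW ?orbT.
have G2 : al * (a * n) <= al * (b * N) + al * K.
  by rewrite -mulnDr leq_mul2l ltnW ?orbT.
have E1 : a * (al * n) = al * (a * n) by rewrite mulnCA.
have E2 : a * (be * N) = be * a * N by rewrite mulnCA mulnA.
have E3 : al * (b * N) = al * b * N by rewrite mulnA.
have [lt|lt|eq] := ltngtP (be * a) (al * b).
- have L1 : be * a * N + N <= al * b * N.
    by rewrite -mulSnr leq_mul2r lt orbT.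
  have L2 : be * a * T <= al * b * T by rewrite leq_mul2r ltnW ?orbT.
  rewrite mulnDl in aK.
  have X : be * N + K <= al * n.
    by rewrite -(leq_pmul2l a0) mulnDr E1 E2; lia.
  have Y : be * T <= al * c by rewrite -(leq_pmul2l a0) acT abT.
  rewrite /compat !mulnDr; lia.
- have L1 : al * b * N + N <= be * a * N.
    by rewrite -mulSnr leq_mul2r lt orbT.
  have L2 : al * b * T <= be * a * T by rewrite leq_mul2r ltnW ?orbT.
  rewrite mulnDl in aK.
  have X : al * n + K <= be * N.
    by rewrite -(leq_pmul2l a0) mulnDr E1 E2; lia.
  have Y : al * c <= be * T by rewrite -(leq_pmul2l a0) acT abT.
  rewrite /compat !mulnDr; lia.
- have Y : al * c = be * T by apply/eqP; rewrite -(eqn_pmul2l a0) acT abT eq.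
  rewrite /compat !mulnDr Y; lia.
Qed.

(** For different slopes [a' * b] and [a * b'] differ by at least 1, and the two windows are
    disjoint at such a height [N]. Equal slopes in lowest terms are equal pairs. *)
Lemma window_unique K a b a' b' n N l : 0 < a <= l -> 0 < a' <= l -> 0 < b -> 0 < b' ->
  coprime a b -> coprime a' b' -> 0 < K -> 4 * l * K <= N ->
  window K a b n N -> window K a' b' n N -> (a == a') && (b == b').
Proof.
move=> /andP[a0 al] /andP[a'0 a'l] b0 b'0 cab cab' K0 KN /andP[H1 H2] /andP[H3 H4].
have G1 : a' * (b * N) <= a' * (a * n) + a' * K by rewrite -mulnDr leq_mul2l ltnW ?orbT.
have G2 : a' * (a * n) <= a' * (b * N) + a' * K by rewrite -mulnDr leq_mul2l ltnW ?orbT.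
have G3 : a * (b' * N) <= a * (a' * n) + a * K by rewrite -mulnDr leq_mul2l ltnW ?orbT.
have G4 : a * (a' * n) <= a * (b' * N) + a * K by rewrite -mulnDr leq_mul2l ltnW ?orbT.
have E : a' * (a * n) = a * (a' * n) by rewrite mulnCA.
have aK : a * K <= l * K by rewrite leq_mul2r al orbT.
have a'K : a' * K <= l * K by rewrite leq_mul2r a'l orbT.
have E1 : a' * (b * N) = a' * b * N by rewrite mulnA.
have E2 : a * (b' * N) = a * b' * N by rewrite mulnA.
have lK : 0 < l * K by rewrite muln_gt0 K0 andbT (leq_trans a0).
have ab : a' * b = a * b'.
  have [lt|lt|//] := ltngtP (a' * b) (a * b').
    have L1 : a' * b * N + N <= a * b' * N by rewrite -mulSnr leq_mul2r lt orbT.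
    by rewrite -mulnA in KN; lia.
  have L1 : a * b' * N + N <= a' * b * N by rewrite -mulSnr leq_mul2r lt orbT.
  by rewrite -mulnA in KN; lia.
have aa' : a = a'.
  apply/eqP; rewrite eqn_dvd -(@Gauss_dvdl a a' b)// ab dvdn_mulr//=.
  by rewrite -(@Gauss_dvdl a' a b')// -ab dvdn_mulr.
by rewrite aa' eqxx /=; move: ab; rewrite -aa' => /eqP; rewrite eqn_pmul2l.
Qed.
End WindowArithmetic.

(** * Second moments and their increments *)

Section Variance.
Variables (R : realType) (d : measure_display) (Omega : measurableType d).
Variables (P : probability Omega R) (X : finType) (xi : nat -> Omega -> X).
Variables (mu : X -> R) (p : X -> X -> R).
Hypothesis chain : stationary_markov_chain P xi mu p.
Variables (C th : R).
Hypothesis C0 : 0 <= C.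
Hypothesis th01 : 0 < th < 1.
Hypothesis mix : forall n x, \sum_y `|pn p n x y - mu y| <= C * th ^+ n.
Variables (m : nat) (F : m.+1.-tuple X -> R) (M : R).
Hypothesis FM : forall t, `|F t| <= M.
Hypothesis Fc : pmf_int (@pmf_pow R X mu m.+1) F = 0.
Variable s0 : nat -> X.
Let l : R := m.+1%:R.
Let mr := mixrate X C th.
Notation EN := (trunc_ex mu p m s0).
Let M_0 : 0 <= M := M0 FM s0.
Let mr0 K : 0 <= mr K := mixrate_ge0 X C0 th01 K.
Let l0 : 0 <= l. Proof. exact: ler0n. Qed.

Definition cov (n n' : nat) : R := ex P xi (fun s => term F n s * term F n' s).
Definition second_moment (N : nat) : R := ex P xi (fun s => psum F N xpredT s ^+ 2).

Lemma dep_term2 N n n' : (0 < n <= N)%N -> (0 < n' <= N)%N ->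
  dep [pred i | 0 < i <= m.+1 * N]%N (fun s => term F n s * term F n' s).
Proof. by move=> nN nN' s s' ss'; congr (_ * _); apply: (@dep_term_N _ _ _ F N) ss'. Qed.

Lemma cov_EN N n n' : (0 < n <= N)%N -> (0 < n' <= N)%N ->
  cov n n' = EN N (fun s => term F n s * term F n' s).
Proof. by move=> nN nN'; rewrite (trunc_exE _ chain)//; exact: dep_term2. Qed.

Lemma covC n n' : cov n n' = cov n' n.
Proof. by congr ex; apply/funext => s; rewrite mulrC. Qed.

Lemma cov_bound n n' : (0 < n)%N -> (0 < n')%N -> `|cov n n'| <= M ^+ 2.
Proof.
move=> n0 n'0; rewrite (@cov_EN (maxn n n')); last 2 first; first by lia.
  by lia.
apply: EL_norm; first exact: (stochastic_kern chain).
by move=> s; rewrite normrM expr2 ler_pM ?termM.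
Qed.

Lemma cov_far K n n' : (0 < K)%N -> (0 < n)%N -> (0 < n')%N -> ~~ near_times m K n n' ->
  `|cov n n'| <= (M * l * mr n) * (M * l * mr n') + M ^+ 2 * (6 * l) * mr K.
Proof.
move=> K0 n0 n'0 far; pose N := maxn n n'.
have nN : (0 < n <= N)%N by rewrite /N; lia.
have nN' : (0 < n' <= N)%N by rewrite /N; lia.
rewrite (cov_EN nN nN').
have := @EN_decouple _ _ _ P X xi mu p chain C th C0 th01 mix m s0 N (times m n) (times m n') K
   (term F n) (term F n') M M K0.
rewrite size_tuple => H.
have {}H := H (fun u => times_range nN) (fun u => times_range nN')
  (fun u v => nnear_times far) (@dep_term _ _ _ F n) (@dep_term _ _ _ F n') (termM FM n) (termM FM n').
rewrite -(subrK (EN N (term F n) * EN N (term F n')) (EN N (fun s => _ * _))).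
apply: le_trans (ler_normD _ _) _; rewrite addrC lerD//.
  rewrite normrM ler_pM//; exact: (EN_term_mean chain C0 th01 mix FM Fc).
by apply: le_trans H _; rewrite natrM expr2.
Qed.

Lemma second_momentE N : second_moment N =
  \sum_(1 <= n < N.+1) \sum_(1 <= n' < N.+1) cov n n'.
Proof.
rewrite /second_moment -(@trunc_exE _ _ mu p m s0 N _ _ _ _ _ chain); last first.
  by move=> s s' ss'; congr (_ ^+ 2); apply: (@dep_psum_N _ _ _ F N xpredT) ss'.
transitivity (EN N (fun s => \sum_(1 <= n < N.+1) \sum_(1 <= n' < N.+1) term F n s * term F n' s)).
  by apply: eq_EL => s; rewrite expr2 mulr_suml; apply: eq_bigr => n _; rewrite mulr_sumr.
rewrite /trunc_ex EL_sum; rewrite [LHS]big_nat_cond [RHS]big_nat_cond.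
apply: eq_bigr => n /andP[nN _]; rewrite EL_sum [LHS]big_nat_cond [RHS]big_nat_cond.
by apply: eq_bigr => n' /andP[nN' _]; rewrite (@cov_EN N).
Qed.

Definition incr (N : nat) : R := 2 * (\sum_(1 <= n < N.+1) cov n N) - cov N N.

Lemma second_moment_incr N : second_moment N = \sum_(0 <= n < N) incr n.+1.
Proof.
elim: N => [|N IH]; first by rewrite second_momentE !big_nil.
rewrite big_nat_recr//= -IH !second_momentE [LHS]big_nat_recr//=.
under eq_bigr do rewrite big_nat_recr//=.
rewrite big_split/= /incr.
rewrite (big_nat_recr N.+1 1 (cov N.+1))//= (big_nat_recr N.+1 1 (cov^~ N.+1))//=.
under [\sum_(1 <= i < N.+1) cov N.+1 i]eq_bigr do rewrite covC.
ring.
Qed.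

(** The [2 * m.+1] times of the two terms remain compatible under the shift: times of different
    terms by [compat_shift], different times of one term because they are at least [K] apart before
    and after. The latter needs [K <= n], which follows from the window. *)
Lemma cov_shift K a b c T n N : (0 < a <= m.+1)%N -> (0 < b <= m.+1)%N -> (0 < K)%N ->
  (4 * m.+1 * K <= N)%N -> (a * c = b * T)%N -> (0 < n)%N -> window K a b n N ->
  `|cov (n + c) (N + T) - cov n N| <= M ^+ 2 * (4 * l) * mr K.
Proof.
move=> aP bP K0 KN acbT n0 w.
have KlN : (K <= N)%N by apply: leq_trans KN; rewrite -mulnA; nia.
have N0 : (0 < N)%N := leq_trans K0 KlN.
have Kn : (K <= n)%N.
  case/andP: w => _ H2.
  have H3 : (N <= b * N)%N by rewrite leq_pmull//; lia.
  have H4 : (a * n <= m.+1 * n)%N by rewrite leq_mul2r; apply/orP; right; lia.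
  rewrite leqNgt; apply/negP => nK.
  have H5 : (m.+1 * n <= m.+1 * K)%N by rewrite leq_mul2l ltnW ?orbT.
  have H6 : (K <= m.+1 * K)%N by rewrite leq_pmull.
  by rewrite -mulnA in KN; lia.
rewrite distrC.
have := @ex_compat _ _ _ P X xi mu p chain C th C0 th01 mix
  (times m n ++ times m N) (times m (n + c) ++ times m (N + T)) K
  (fun s => term F n s * term F N s) (fun s => term F (n + c) s * term F (N + T) s) (M ^+ 2) K0.
rewrite !size_cat !size_tuple => /(_ erefl) H.
apply: le_trans (H _ _ _ _ _) _.
- move=> i; rewrite mem_cat => /orP[] /timesP[j _ ->]; rewrite muln_gt0//=.
- move=> i; rewrite mem_cat => /orP[] /timesP[j _ ->]; rewrite muln_gt0//= addn_gt0 ?n0 ?N0//.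
- have nthT k i : (i < m.+1)%N -> nth 0%N (times m k) i = (i.+1 * k)%N.
    move=> im; rewrite (nth_map (Ordinal im)) ?size_enum_ord//.
    by congr (_.+1 * _)%N; exact: (@nth_enum_ord m.+1 (Ordinal im) i im).
  have nthC (k k' i : nat) : (i < m.+1 + m.+1)%N ->
      nth 0%N (times m k ++ times m k') i = if (i < m.+1)%N then (i.+1 * k)%N else ((i - m.+1).+1 * k')%N.
    move=> im; rewrite nth_cat size_tuple; case: ltnP => H'; first exact: nthT.
    by rewrite nthT//; lia.
  have same k k' al be : (K <= k)%N -> (k <= k')%N -> (0 < al)%N -> (0 < be)%N -> compat K (al * k) (be * k) (al * k') (be * k').
    move=> Kk kk' al0 be0; have [lt|lt|->] := ltngtP al be; last by rewrite /compat addnC eqxx.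
      have A1 k1 : (al * k1 + k1 <= be * k1)%N by rewrite -mulSnr leq_mul2r lt orbT.
      by have := A1 k; have := A1 k'; rewrite /compat; lia.
    have A1 k1 : (be * k1 + k1 <= al * k1)%N by rewrite -mulSnr leq_mul2r lt orbT.
    by have := A1 k; have := A1 k'; rewrite /compat; lia.
  have cross al be : (0 < al <= m.+1)%N -> (0 < be <= m.+1)%N ->
      compat K (al * n) (be * N) (al * (n + c)) (be * (N + T)).
    by move=> alP beP; apply: (compat_shift aP bP).
  have compatC x y x' y' : compat K x y x' y' -> compat K y x y' x' by rewrite /compat; lia.
  move=> i j im jm; rewrite !nthC//; case: (ltnP i) => iM; case: (ltnP j) => jM.
  + by apply: same => //; rewrite leq_addr.
  + by apply: cross; lia.
  + by apply/compatC/cross; lia.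
  + by apply: same => //; rewrite leq_addr.
- by move=> s; rewrite normrM expr2 ler_pM ?termM.
- move=> s s'; rewrite !map_cat => /eqP; rewrite eqseq_cat ?size_map ?size_tuple// => /andP[/eqP e1 /eqP e2].
  by congr (F _ * F _); apply/val_inj.
- rewrite ler_wpM2r ?mixrate_ge0// ler_wpM2l ?exprn_ge0// addnn -mul2n mulnA natrM.
  by [].
Qed.

(** Dividing a near pair of factors by its gcd keeps it in the window, and the reduced pair is
    unique. Nearness thus becomes a sum of window indicators, each of which has its own shift. *)
Lemma near_window K n N : (0 < n)%N -> (0 < K)%N -> (4 * m.+1 * K <= N)%N ->
  (near_times m K n N : nat) =
  (\sum_(z : 'I_m.+1 * 'I_m.+1) (coprime z.1.+1 z.2.+1 && window K z.1.+1 z.2.+1 n N))%N.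
Proof.
move=> n0 K0 KN.
have [/hasP[u /timesP[j jm ->] /hasP[v /timesP[j' jm' ->] H]]|far] := boolP (near_times m K n N).
  pose g := gcdn j.+1 j'.+1.
  have g0 : (0 < g)%N by rewrite gcdn_gt0.
  have jE : j.+1 = (g * (j.+1 %/ g))%N by rewrite mulnC divnK// dvdn_gcdl.
  have jE' : j'.+1 = (g * (j'.+1 %/ g))%N by rewrite mulnC divnK// dvdn_gcdr.
  set a := (j.+1 %/ g)%N in jE; set b := (j'.+1 %/ g)%N in jE'.
  have a0 : (0 < a)%N by move: (ltn0Sn j); rewrite jE muln_gt0 => /andP[].
  have b0 : (0 < b)%N by move: (ltn0Sn j'); rewrite jE' muln_gt0 => /andP[].
  have cab : coprime a b.
    by rewrite /coprime -(eqn_pmul2l g0) muln_gcdr -jE -jE' muln1.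
  have am : (a.-1 < m.+1)%N.
    by rewrite prednK// (leq_trans _ jm)// [leqRHS]jE leq_pmull.
  have bm : (b.-1 < m.+1)%N.
    by rewrite prednK// (leq_trans _ jm')// [leqRHS]jE' leq_pmull.
  have w : window K a b n N.
    have gK : (K <= g * K)%N by rewrite leq_pmull.
    move: H; rewrite jE jE' /window -!mulnA => /andP[H1 H2].
    apply/andP; split; rewrite ltnNge; apply/negP => H3.
      have : (g * (b * N) + g * K <= g * (a * n))%N by rewrite -mulnDr leq_mul2l H3 orbT.
      lia.
    have : (g * (a * n) + g * K <= g * (b * N))%N by rewrite -mulnDr leq_mul2l H3 orbT.
    lia.
  rewrite (bigD1 (Ordinal am, Ordinal bm))//= !prednK// cab w big1 ?addn0//.
  move=> [i i'] /= ne; apply/eqP; rewrite eqb0; apply: contra ne => /andP[cc ww].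
  have im := ltn_ord i; have im' := ltn_ord i'.
  have aM : (0 < a <= m.+1)%N by rewrite a0 -ltnS -{1}(prednK a0).
  have /andP[/eqP ai /eqP bi] := @window_unique K a b i.+1 i'.+1 n N m.+1 aM im b0 isT cab cc K0 KN w ww.
  by apply/eqP; congr (_, _); apply/val_inj; rewrite /= ?ai ?bi.
rewrite big1// => -[i i'] _ /=; apply/eqP; rewrite eqb0; apply: contra far => /andP[_ w].
apply/hasP; exists (i.+1 * n)%N; first by apply/timesP; exists i.
by apply/hasP; exists (i'.+1 * N)%N => //; apply/timesP; exists i'.
Qed.

Lemma window_sum_shift K a b T N : (0 < a <= m.+1)%N -> (0 < b <= m.+1)%N -> (0 < K)%N ->
  (4 * m.+1 * K <= N)%N -> (a %| T)%N -> (0 < T)%N ->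
  `|\sum_(1 <= n < (N + T).+1) (window K a b n (N + T))%:R * cov n (N + T) -
    \sum_(1 <= n < N.+1) (window K a b n N)%:R * cov n N|
  <= N%:R * (M ^+ 2 * (4 * l) * mr K).
Proof.
move=> aP bP K0 KN aT T0.
have KlN : (K <= N)%N by apply: leq_trans KN; rewrite -mulnA; nia.
case/andP: (aP) => a0 am; case/andP: (bP) => b0 bm.
pose c := (b * T %/ a)%N.
have acbT : (a * c = b * T)%N by rewrite mulnC divnK// dvdn_mull.
(* A common upper end: the conditions [n <= N] and [n <= N + T] move into the summands, so that both
   sums run over the same indices after the shift by [c]. *)
pose B := (N + T + c).+2.
pose f n := (window K a b n (N + T) && (n <= N + T)%N)%:R * cov n (N + T).
pose g n := (window K a b n N && (n <= N)%N)%:R * cov n N.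
have fE : \sum_(1 <= n < (N + T).+1) (window K a b n (N + T))%:R * cov n (N + T) =
   \sum_(1 <= n < B) f (n + c)%N.
  transitivity (\sum_(1 <= n < B + c) f n).
    rewrite [RHS](@big_cat_nat _ _ _ (N + T).+1)//=; last by rewrite /B; lia.
    rewrite [X in _ + X]big_nat_cond [X in _ + X]big1 ?addr0; last first.
      by move=> n /andP[/andP[H _] _]; rewrite /f [(n <= _)%N]leqNgt H andbF mul0r.
    rewrite big_nat_cond [RHS]big_nat_cond; apply: eq_bigr => n /andP[/andP[_ H] _].
    by rewrite /f -ltnS H andbT.
  rewrite (@big_cat_nat _ _ _ c.+1)//=; last by rewrite /B; lia.
  rewrite big_nat_cond big1 ?add0r; last first.
    move=> n /andP[/andP[_ H] _]; rewrite /f.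
    by rewrite (negbTE (@window_small K a b c T n N _ _ _ _))// mul0r.
  by rewrite -[c.+1]add1n big_addn addnK.
have gE : \sum_(1 <= n < N.+1) (window K a b n N)%:R * cov n N = \sum_(1 <= n < B) g n.
  rewrite [RHS](@big_cat_nat _ _ _ N.+1)//=; last by rewrite /B; lia.
  rewrite [X in _ + X]big_nat_cond [X in _ + X]big1 ?addr0; last first.
    by move=> n /andP[/andP[H _] _]; rewrite /g [(n <= _)%N]leqNgt H andbF mul0r.
  rewrite big_nat_cond [RHS]big_nat_cond; apply: eq_bigr => n /andP[/andP[_ H] _].
  by rewrite /g -ltnS H andbT.
set e := M ^+ 2 * _ * _.
have e0 : 0 <= e by rewrite /e mulr_ge0// mulr_ge0 ?exprn_ge0// mulr_ge0.
rewrite fE gE -sumrB; apply: le_trans (ler_norm_sum _ _ _) _.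
apply: (@le_trans _ _ (\sum_(1 <= n < B) (n <= N)%N%:R * e)).
  rewrite big_nat_cond [leRHS]big_nat_cond; apply: ler_sum => n /andP[/andP[n0 _] _].
  rewrite /f /g (@window_shift K a b c T n N)//.
  have [w|w] := boolP (window K a b n N); last by rewrite !mul0r subrr normr0 mulr_ge0.
  case: (n <= N)%N; last by rewrite !mul0r subrr normr0.
  by rewrite !mul1r; exact: (cov_shift aP bP).
rewrite -mulr_suml ler_wpM2r// (@big_cat_nat _ _ _ N.+1)//=; last by rewrite /B; lia.
rewrite [X in _ + X]big_nat_cond [X in _ + X]big1 ?addr0; last first.
  by move=> n /andP[/andP[H _] _]; rewrite [(n <= _)%N]leqNgt H.
apply: (@le_trans _ _ (\sum_(1 <= n < N.+1) (1 : R))).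
  by apply: ler_sum => n _; case: (n <= N)%N.
by rewrite sumr_const_nat subSS subn0.
Qed.

Definition farc : R := M ^+ 2 * (l ^+ 2 * mr 0%N + 6 * l).

Lemma farc_ge0 : 0 <= farc.
Proof. by rewrite /farc mulr_ge0 ?exprn_ge0// addr_ge0// mulr_ge0 ?exprn_ge0. Qed.

Lemma near_sum K N N' : (0 < K)%N -> (4 * m.+1 * K <= N)%N -> (N <= N')%N ->
  `|\sum_(1 <= n < N'.+1) cov n N' - \sum_(z : 'I_m.+1 * 'I_m.+1)
      (coprime z.1.+1 z.2.+1)%:R *
      \sum_(1 <= n < N'.+1) (window K z.1.+1 z.2.+1 n N')%:R * cov n N'|
  <= N'%:R * (farc * mr K).
Proof.
move=> K0 KN NN'.
have KlN : (K <= N)%N by apply: leq_trans KN; rewrite -mulnA; nia.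
have N'0 : (0 < N')%N by lia.
have -> : \sum_(z : 'I_m.+1 * 'I_m.+1) (coprime z.1.+1 z.2.+1)%:R *
      \sum_(1 <= n < N'.+1) (window K z.1.+1 z.2.+1 n N')%:R * cov n N' =
   \sum_(1 <= n < N'.+1) (near_times m K n N')%:R * cov n N'.
  under eq_bigr do rewrite mulr_sumr.
  rewrite exchange_big/= [LHS]big_nat_cond [RHS]big_nat_cond.
  apply: eq_bigr => n /andP[/andP[n0 _] _].
  rewrite near_window//; last exact: leq_trans KN _.
  rewrite natr_sum mulr_suml; apply: eq_bigr => z _.
  by rewrite mulrA -natrM mulnb.
rewrite -sumrB; apply: le_trans (ler_norm_sum _ _ _) _.
apply: (@le_trans _ _ (\sum_(1 <= n < N'.+1) (farc * mr K))); last first.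
  by rewrite sumr_const_nat subSS subn0 mulr_natl.
rewrite big_nat_cond [leRHS]big_nat_cond; apply: ler_sum => n /andP[/andP[n0 _] _].
have [near|far] := boolP (near_times m K n N').
  by rewrite mul1r subrr normr0 mulr_ge0// farc_ge0.
rewrite mul0r subr0; apply: le_trans (cov_far K0 n0 N'0 far) _.
rewrite /farc mulrDr mulrDl lerD//.
have H1 : mr n <= mr 0%N by exact: mixrate_le.
have H2 : mr N' <= mr K by apply: mixrate_le => //; lia.
rewrite [leLHS](_ : _ = M ^+ 2 * l ^+ 2 * (mr n * mr N')); last ring.
rewrite [leRHS](_ : _ = M ^+ 2 * l ^+ 2 * (mr 0%N * mr K)); last ring.
by rewrite ler_wpM2l ?mulr_ge0 ?exprn_ge0// ler_pM.
Qed.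

(* Moving [(n, N)] to [(n + c, N + T)] with [a c = b T] shifts the two time patterns [i n] and
   [j N] near the line [a n = b N] rigidly; [T = l!] serves all pairs [a, b <= l] at once. *)
Lemma incr_shift K N T : (0 < K)%N -> (4 * m.+1 * K <= N)%N -> T = m.+1`! ->
  `|incr (N + T) - incr N| <= (N + T).+1%:R *
     ((4 * farc + 8 * M ^+ 2 * l * l ^+ 2 + 4 * M ^+ 2 * l) * mr K).
Proof.
move=> K0 KN TE; have T0 : (0 < T)%N by rewrite TE fact_gt0.
have KlN : (K <= N)%N by apply: leq_trans KN; rewrite -mulnA; nia.
pose W N' := \sum_(z : 'I_m.+1 * 'I_m.+1) (coprime z.1.+1 z.2.+1)%:R *
      \sum_(1 <= n < N'.+1) (window K z.1.+1 z.2.+1 n N')%:R * cov n N'.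
have H1 := near_sum K0 KN (leqnn N); rewrite -/(W N) in H1.
have H2 := near_sum K0 KN (leq_addr T N); rewrite -/(W (N + T)%N) in H2.
have H3 : `|W (N + T)%N - W N| <= (l ^+ 2) * (N%:R * (M ^+ 2 * (4 * l) * mr K)).
  rewrite /W -sumrB; apply: le_trans (ler_norm_sum _ _ _) _.
  apply: (@le_trans _ _ (\sum_(z : 'I_m.+1 * 'I_m.+1) (N%:R * (M ^+ 2 * (4 * l) * mr K)))).
    apply: ler_sum => -[i j] _ /=; rewrite -mulrBr normrM -[leRHS]mul1r ler_pM//.
      by case: coprime; rewrite ?normr1 ?normr0.
    apply: window_sum_shift => //; rewrite ?ltn_ord//.
    by rewrite TE dvdn_fact//= ltn_ord.
  by rewrite sumr_const card_prod !card_ord -[_ *+ _]mulr_natl natrM expr2.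
have H4 : `|cov (N + T) (N + T) - cov N N| <= M ^+ 2 * (4 * l) * mr K.
  apply: (@cov_shift K 1 1 T T) => //; first by lia.
  by rewrite /window; lia.
have NT : N%:R <= (N + T).+1%:R :> R by rewrite ler_nat; lia.
have NT2 : (N + T)%:R <= (N + T).+1%:R :> R by rewrite ler_nat.
have NT1 : 1 <= (N + T).+1%:R :> R by rewrite ler1n.
move: NT NT2 NT1 H1 H2 H3 H4; set nt := (N + T).+1%:R; set n := N%:R; set n' := (N + T)%:R => NT NT2 NT1.
rewrite /incr; set s := \sum_(_ <= _ < _) _; set s' := \sum_(_ <= _ < _) _.
move=> H1 H2 H3 H4.
rewrite (_ : _ - _ = 2 * ((s' - W (N + T)%N) - (s - W N) + (W (N + T)%N - W N))
   - (cov (N + T) (N + T) - cov N N)); last ring.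
apply: le_trans (ler_normB _ _) _; rewrite normrM (ger0_norm (ler0n _ 2)).
have H5 : `|s' - W (N + T)%N - (s - W N) + (W (N + T)%N - W N)| <=
    n' * (farc * mr K) + n * (farc * mr K) + l ^+ 2 * (n * (M ^+ 2 * (4 * l) * mr K)).
  apply: le_trans (ler_normD _ _) _; rewrite lerD//.
  by apply: le_trans (ler_normB _ _) _; rewrite lerD.
apply: le_trans (lerD (ler_wpM2l (ler0n _ 2) H5) H4) _.
have G1 : n' * (farc * mr K) <= nt * (farc * mr K) by rewrite ler_wpM2r// mulr_ge0// farc_ge0.
have G2 : n * (farc * mr K) <= nt * (farc * mr K) by rewrite ler_wpM2r// mulr_ge0// farc_ge0.
have G30 : 0 <= M ^+ 2 * (4 * l) * mr K by rewrite mulr_ge0// mulr_ge0 ?exprn_ge0// mulr_ge0.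
have G3 : l ^+ 2 * (n * (M ^+ 2 * (4 * l) * mr K)) <= l ^+ 2 * (nt * (M ^+ 2 * (4 * l) * mr K)).
  by rewrite ler_wpM2l ?exprn_ge0// ler_wpM2r.
have G4 : M ^+ 2 * (4 * l) * mr K <= nt * (M ^+ 2 * (4 * l) * mr K) by rewrite ler_peMl.
apply: le_trans (lerD (ler_wpM2l (ler0n _ 2) (lerD (lerD G1 G2) G3)) G4) _.
by rewrite le_eqVlt; apply/orP; left; apply/eqP; ring.
Qed.

Lemma incr_bound N : (0 < N)%N -> `|incr N| <= 3 * N%:R * M ^+ 2.
Proof.
move=> N0; rewrite /incr; apply: le_trans (ler_normB _ _) _.
have H1 : `|\sum_(1 <= n < N.+1) cov n N| <= N%:R * M ^+ 2.
  apply: le_trans (ler_norm_sum _ _ _) _.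
  apply: (@le_trans _ _ (\sum_(1 <= n < N.+1) M ^+ 2)); last first.
    by rewrite sumr_const_nat subSS subn0 mulr_natl.
  rewrite big_nat_cond [leRHS]big_nat_cond; apply: ler_sum => n /andP[/andP[n0 _] _].
  exact: cov_bound.
have H2 : `|cov N N| <= N%:R * M ^+ 2.
  by apply: le_trans (cov_bound N0 N0) _; rewrite ler_peMl ?exprn_ge0// ler1n.
rewrite normrM (ger0_norm (ler0n _ 2)).
apply: le_trans (lerD (ler_wpM2l (ler0n _ 2) H1) H2) _.
by rewrite le_eqVlt; apply/orP; left; apply/eqP; ring.
Qed.

Lemma cvg_second_moment : cvgn (fun N : nat => second_moment N / N%:R).
Proof.
have -> : (fun N : nat => second_moment N / N%:R) =
    (fun N : nat => (\sum_(0 <= n < N) incr n.+1) / N%:R).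
  by apply/funext => N; rewrite second_moment_incr.
pose T := m.+1`!; pose q := (4 * m.+1)%N.
have [D D0 [t t01 Dt]] := linear_geometric th01 (isT : (0 < q)%N).
pose c1 := (4 * farc + 8 * M ^+ 2 * l * l ^+ 2 + 4 * M ^+ 2 * l) * (#|X|%:R * C).
pose c2 : R := (T + 2)%:R.
have c10 : 0 <= c1.
  rewrite /c1; have := farc_ge0 => H; have := exprn_ge0 2 M_0 => H2.
  by repeat first [done | apply: addr_ge0 | apply: exprn_ge0 | apply: mulr_ge0].
pose A := 3 * (q + T).+1%:R * M ^+ 2 * 2.
have A0 : 0 <= A by rewrite /A !mulr_ge0 ?exprn_ge0.
case/andP: (t01) => t0 t1.
apply: (@cesaro_periodic _ (fun n => incr n.+1) T (c2 * c1 * D + A / t ^+ q) t) => //.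
- exact: fact_gt0.
- have tq : 0 <= (t ^+ q)^-1 by rewrite invr_ge0 exprn_ge0// ltW.
  by apply: addr_ge0; [rewrite mulr_ge0// mulr_ge0|rewrite mulr_ge0].
(* At index [n.+1] the largest [K] with [4 * m.+1 * K <= n.+1] is taken; the mixing rate at this
   [K], times a factor linear in [n], is geometrically small. The finitely many [n] with [n.+1 < q]
   are covered by the constant [A]. *)
move=> n /=; have [nq|qn] := leqP q n.+1.
  have K0 : (0 < n.+1 %/ q)%N by rewrite divn_gt0.
  have KN : (4 * m.+1 * (n.+1 %/ q) <= n.+1)%N by rewrite mulnC leq_trunc_div.
  have := incr_shift K0 KN (erefl T); rewrite addSn => /le_trans; apply.
  have -> : (n + T).+2%:R * ((4 * farc + 8 * M ^+ 2 * l * l ^+ 2 + 4 * M ^+ 2 * l) * mr (n.+1 %/ q)) =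
     (n + T).+2%:R * c1 * th ^+ (n.+1 %/ q) by rewrite /mr /mixrate /c1; ring.
  apply: (@le_trans _ _ (c2 * n.+1%:R * c1 * th ^+ (n.+1 %/ q))).
    rewrite ler_wpM2r ?exprn_ge0//; first by case/andP: th01 => /ltW.
    rewrite ler_wpM2r// /c2 -natrM ler_nat; nia.
  have H' : n.+1%:R * th ^+ (n.+1 %/ q) <= D * t ^+ n.
    apply: (@le_trans _ _ (n.+2%:R * th ^+ (n.+1 %/ q))).
      rewrite ler_wpM2r ?ler_nat// exprn_ge0//; by case/andP: th01 => /ltW.
    apply: le_trans (Dt n.+1) _; rewrite ler_wpM2l// ler_wiXn2l//; exact: ltW.
  rewrite (_ : _ * _ = c2 * c1 * (n.+1%:R * th ^+ (n.+1 %/ q))); last ring.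
  apply: le_trans (ler_wpM2l _ H') _; first by rewrite mulr_ge0.
  rewrite mulrA ler_wpM2r ?exprn_ge0 ?(ltW t0)// lerDl.
  by rewrite divr_ge0// exprn_ge0// ltW.
apply: (@le_trans _ _ A).
  apply: le_trans (ler_normB _ _) _.
  have I1 := incr_bound (ltn0Sn (n + T)); have I2 := incr_bound (ltn0Sn n).
  rewrite /A mulrC mulr2n mulrDl mul1r; apply: lerD.
    apply: le_trans I1 _; rewrite ler_wpM2r ?exprn_ge0// ler_wpM2l// ler_nat.
    by rewrite ltnS leq_add2r ltnW// ltnW.
  apply: le_trans I2 _; rewrite ler_wpM2r ?exprn_ge0// ler_wpM2l// ler_nat ltnS.
  by rewrite (leq_trans _ (leq_addr _ _))// ltnW// ltnW.
apply: (@le_trans _ _ (A / t ^+ q * t ^+ n)); last first.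
  by rewrite ler_wpM2r ?exprn_ge0 ?(ltW t0)// lerDr mulr_ge0// mulr_ge0.
rewrite -mulrA ler_peMr// ler_pdivlMl ?exprn_gt0// mulr1 ler_wiXn2l ?(ltW t0) ?(ltW t1)//; lia.
Qed.

End Variance.

(** * Decay of characteristic functions *)

Section PhaseSums.
Variables (R : realType) (X : finType).
Variable q : X -> X -> R.
Hypothesis sq : stochastic q.
Implicit Types (fs : seq (X -> R)) (al be : R).

(* [top fs x al be] is the expectation of the first coordinate of the vector
   [(al, be)] rotated by the angle [f_1(z_1) + ... + f_r(z_r)], where
   [z_1, ..., z_r] are the successive states of the chain started at [x]. *)
Fixpoint top fs (x : X) al be : R :=
  if fs is f :: fs' then
    \sum_y q x y * top fs' y (al * cos (f y) - be * sin (f y)) (al * sin (f y) + be * cos (f y))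
  else al.

(** [P x] and [Q x] are the expectations of the cosine and the sine of the total phase of the chain
    started at [x]. *)
Lemma top_linear fs : exists P Q : X -> R, forall x al be, top fs x al be = P x * al - Q x * be.
Proof.
elim: fs => [|f fs [P [Q IH]]]; first by exists (fun=> 1), (fun=> 0) => x al be /=; ring.
exists (fun x => \sum_y q x y * (P y * cos (f y) - Q y * sin (f y))),
  (fun x => \sum_y q x y * (P y * sin (f y) + Q y * cos (f y))) => x al be /=.
rewrite !mulr_suml -sumrB; apply: eq_bigr => y _; rewrite IH; ring.
Qed.

Lemma rotation_norm al be t :
  (al * cos t - be * sin t) ^+ 2 + (al * sin t + be * cos t) ^+ 2 = al ^+ 2 + be ^+ 2.
Proof.
rewrite (_ : _ + _ = (al ^+ 2 + be ^+ 2) * (cos t ^+ 2 + sin t ^+ 2)); last ring.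
by rewrite cos2Dsin2 mulr1.
Qed.

Definition top_bounded fs (m : R) := forall x al be, al ^+ 2 + be ^+ 2 = 1 ->
  `|top fs x al be| <= m.

(** The supremum of [top] over unit vectors is the modulus of the complex number [P + i Q]; the
    vector [(P, - Q) / r] attains it. *)
Lemma top_modulus fs m P Q : 0 <= m -> top_bounded fs m ->
  (forall x al be, top fs x al be = P x * al - Q x * be) ->
  forall x, P x ^+ 2 + Q x ^+ 2 <= m ^+ 2.
Proof.
move=> m0 fm PQ x; set r2 := _ + _.
have r20 : 0 <= r2 by rewrite addr_ge0 ?sqr_ge0.
have [->|r2n] := eqVneq r2 0; first exact: sqr_ge0.
pose r := Num.sqrt r2.
have rr : r ^+ 2 = r2 by rewrite sqr_sqrtr.
have r0 : 0 < r by rewrite sqrtr_gt0 lt_neqAle eq_sym r2n.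
have := fm x (P x / r) (- (Q x / r)); rewrite PQ.
have -> : (P x / r) ^+ 2 + (- (Q x / r)) ^+ 2 = 1.
  by rewrite sqrrN !expr_div_n -mulrDl -/r2 rr divff.
move=> /(_ erefl).
have -> : P x * (P x / r) - Q x * - (Q x / r) = r.
  rewrite mulrN opprK !mulrA -mulrDl -!expr2 -/r2 -rr expr2 mulfK//; exact: lt0r_neq0.
rewrite ger0_norm ?(ltW r0)// => rm.
by rewrite -rr lerXn2r// nnegrE// ltW.
Qed.

Lemma top_nil : top_bounded [::] 1.
Proof.
move=> x al be ab /=; rewrite -[leRHS](@normr1 R) -ler_sqr ?nnegrE// !real_normK ?num_real//.
by rewrite expr1n -ab lerDl sqr_ge0.
Qed.

(** Rotations preserve the norm of the vector, so the steps of [fs] only average [b] over the state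
    reached. *)
Lemma top_prefix fs gs (b : X -> R) :
  (forall a al be, al ^+ 2 + be ^+ 2 = 1 -> `|top gs a al be| <= b a) ->
  forall x al be, al ^+ 2 + be ^+ 2 = 1 ->
  `|top (fs ++ gs) x al be| <= \sum_a pn q (size fs) x a * b a.
Proof.
move=> gb; elim: fs => [|f fs IH] x al be ab /=.
  by rewrite /pn sum_delta gb.
apply: le_trans (ler_norm_sum _ _ _) _.
apply: (@le_trans _ _ (\sum_y q x y * \sum_a pn q (size fs) y a * b a)).
  apply: ler_sum => y _; rewrite normrM ger0_norm ?sq.1// ler_wpM2l ?sq.1//.
  by apply: IH; rewrite rotation_norm.
under [leLHS]eq_bigr do rewrite mulr_sumr.
rewrite exchange_big/=; apply: ler_sum => a _.
by rewrite /pn /= mulr_suml; apply: ler_sum => y _; rewrite mulrA.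
Qed.

Lemma cauchy2 (A B c s m r : R) : 0 <= m -> 0 <= r -> A ^+ 2 + B ^+ 2 <= m ^+ 2 ->
  c ^+ 2 + s ^+ 2 <= r ^+ 2 -> `|A * c + B * s| <= m * r.
Proof.
move=> m0 r0 AB cs; rewrite -ler_sqr ?nnegrE ?mulr_ge0//.
rewrite real_normK ?num_real// exprMn.
apply: le_trans (ler_pM _ _ AB cs); rewrite ?addr_ge0 ?sqr_ge0//.
rewrite -subr_ge0 (_ : _ - _ = (A * s - B * c) ^+ 2); last ring.
exact: sqr_ge0.
Qed.

(** With [x = 1 - cos (t1 - t2)] the sum of the two unit vectors has squared norm [4 - 2 * x], which
    is at most [(2 - x / 2) ^+ 2]. *)
Lemma two_phases (A B m t1 t2 : R) : 0 <= m -> A ^+ 2 + B ^+ 2 <= m ^+ 2 ->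
  `|A * (cos t1 + cos t2) + B * (sin t1 + sin t2)| <= m * (2 - (1 - cos (t1 - t2)) / 2).
Proof.
move=> m0 AB; apply: cauchy2 => //.
  by have := cos_le1 (t1 - t2); have := cos_geN1 (t1 - t2); lra.
have -> : (cos t1 + cos t2) ^+ 2 + (sin t1 + sin t2) ^+ 2 = 2 + 2 * cos (t1 - t2).
  rewrite cosB (_ : _ + _ = (cos t1 ^+ 2 + sin t1 ^+ 2) + (cos t2 ^+ 2 + sin t2 ^+ 2) +
     2 * (cos t1 * cos t2 + sin t1 * sin t2)); last ring.
  by rewrite !cos2Dsin2 //.
set c := cos _; rewrite -subr_ge0 (_ : _ - _ = ((1 - c) / 2) ^+ 2); last by field.
exact: sqr_ge0.
Qed.

Variables (k : nat) (rho kap : R) (a0 z0 y1 y2 : X).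
Hypothesis rho0 : 0 <= rho.
Hypothesis kap0 : 0 <= kap.
Hypothesis qk : forall x, rho <= pn q k x a0.
Hypothesis q1 : kap <= q a0 y1 * q y1 z0.
Hypothesis q2 : kap <= q a0 y2 * q y2 z0.

(* The state [y1] or [y2] visited between [a0] and [z0] changes the phase, so that the two
   contributions partly cancel. *)
Lemma top_two_steps f f' fs m : 0 <= m -> top_bounded fs m ->
  forall a al be, al ^+ 2 + be ^+ 2 = 1 ->
  `|top (f :: f' :: fs) a al be| <=
    m * (1 - (a == a0)%:R * (kap * ((1 - cos (f y1 - f y2)) / 2))).
Proof.
move=> m0 fm a al be ab.
have [P [Q PQ]] := top_linear fs.
have PQm := top_modulus m0 fm PQ.
(* For fixed [z], [A z] and [B z] are the amplitudes of [cos (f y)] and [sin (f y)]: the initial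
   vector, the phase [f' z] and the phases after [z] do not depend on [y]. *)
pose A z := P z * (al * cos (f' z) - be * sin (f' z)) - Q z * (al * sin (f' z) + be * cos (f' z)).
pose B z := - P z * (be * cos (f' z) + al * sin (f' z)) - Q z * (al * cos (f' z) - be * sin (f' z)).
have ABm z : A z ^+ 2 + B z ^+ 2 <= m ^+ 2.
  have -> : A z ^+ 2 + B z ^+ 2 = (P z ^+ 2 + Q z ^+ 2) *
    ((al * cos (f' z) - be * sin (f' z)) ^+ 2 + (al * sin (f' z) + be * cos (f' z)) ^+ 2).
    by rewrite /A /B; ring.
  by rewrite rotation_norm ab mulr1.
pose e z y := A z * cos (f y) + B z * sin (f y).
have em z y : `|e z y| <= m.
  rewrite -[m]mulr1; apply: cauchy2 => //.
  by rewrite cos2Dsin2 expr1n.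
have -> : top (f :: f' :: fs) a al be = \sum_z \sum_y q a y * q y z * e z y.
  rewrite exchange_big/=; apply: eq_bigr => y _; rewrite mulr_sumr; apply: eq_bigr => z _.
  by rewrite PQ /e /A /B; ring.
have tot : \sum_z \sum_y q a y * q y z = 1.
  rewrite exchange_big/= -(sq.2 a); apply: eq_bigr => y _.
  by rewrite -mulr_sumr sq.2 mulr1.
have tot' : \sum_y q a y * q y z0 + \sum_(z | z != z0) \sum_y q a y * q y z = 1.
  by rewrite -tot [RHS](bigD1 z0).
have w0 z y : 0 <= q a y * q y z by rewrite mulr_ge0 ?sq.1.
have rowle z : `|\sum_y q a y * q y z * e z y| <= m * \sum_y q a y * q y z.
  apply: le_trans (ler_norm_sum _ _ _) _; rewrite mulr_sumr; apply: ler_sum => y _.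
  by rewrite normrM ger0_norm// mulrC ler_wpM2r.
apply: le_trans (ler_norm_sum _ _ _) _.
have [aa|aa] := eqVneq a a0; last first.
  rewrite mul0r subr0 mulr1; apply: le_trans (ler_sum _ (fun z _ => rowle z)) _.
  by rewrite -mulr_sumr tot mulr1.
rewrite mul1r (bigD1 z0)//=.
(* For [y1 = y2] there is no gain to prove. Otherwise mass [kap] is split off at both states; the
   remaining weights [w] stay nonnegative, and [two_phases] combines the two split parts. *)
have [y12|y12] := eqVneq y1 y2.
  rewrite y12 subrr cos0 subrr mul0r mulr0 subr0 mulr1.
  apply: le_trans (lerD (rowle z0) (ler_sum _ (fun z _ => rowle z))) _.
  by rewrite -mulr_sumr -mulrDr tot' mulr1.
have special : `|\sum_y q a y * q y z0 * e z0 y| <=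
   m * (\sum_y q a y * q y z0 - kap * ((1 - cos (f y1 - f y2)) / 2)).
  pose w y := q a y * q y z0 - kap * ((y == y1)%:R + (y == y2)%:R).
  have wge0 y : 0 <= w y.
    rewrite /w; case: (eqVneq y y1) => [->|n1]; last case: (eqVneq y y2) => [->|n2].
    - by rewrite (negbTE y12) addr0 mulr1 subr_ge0 aa.
    - by rewrite add0r mulr1 subr_ge0 aa.
    - by rewrite addr0 mulr0 subr0.
  have delta (h : X -> R) : \sum_y kap * ((y == y1)%:R + (y == y2)%:R) * h y =
      kap * (h y1 + h y2).
    transitivity (kap * (\sum_y (y1 == y)%:R * h y + \sum_y (y2 == y)%:R * h y)).
      rewrite -big_split/= mulr_sumr; apply: eq_bigr => y _.
      by rewrite [y1 == y]eq_sym [y2 == y]eq_sym; ring.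
    by rewrite !sum_delta.
  have -> : \sum_y q a y * q y z0 * e z0 y = \sum_y w y * e z0 y + kap * (e z0 y1 + e z0 y2).
    by rewrite -delta -big_split/=; apply: eq_bigr => y _; rewrite /w; ring.
  have -> : \sum_y q a y * q y z0 = \sum_y w y + kap * 2.
    have := delta (fun=> 1); rewrite -[1 + 1]/2 => <-; rewrite -big_split/=.
    by apply: eq_bigr => y _; rewrite /w; ring.
  apply: le_trans (ler_normD _ _) _.
  have -> : m * (\sum_y w y + kap * 2 - kap * ((1 - cos (f y1 - f y2)) / 2)) =
     \sum_y w y * m + kap * (m * (2 - (1 - cos (f y1 - f y2)) / 2)).
    by rewrite -mulr_suml; ring.
  apply: lerD.
    apply: le_trans (ler_norm_sum _ _ _) _; apply: ler_sum => y _.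
    by rewrite normrM ger0_norm// ler_wpM2l.
  rewrite normrM ger0_norm// ler_wpM2l//.
  have := @two_phases (A z0) (B z0) m (f y1) (f y2) m0 (ABm z0); congr (`|_| <= _).
  by rewrite /e; ring.
apply: le_trans (lerD special (ler_sum _ (fun z _ => rowle z))) _.
rewrite -mulr_sumr -mulrDr ler_wpM2l//.
by rewrite addrAC tot'.
Qed.

Lemma top_block fk f f' fs m : size fk = k -> 0 <= m -> top_bounded fs m ->
  top_bounded (fk ++ f :: f' :: fs) (m * (1 - rho * kap / 2 * (1 - cos (f y1 - f y2)))).
Proof.
move=> sk m0 fm x al be ab.
apply: le_trans (top_prefix fk (top_two_steps f f' m0 fm) x ab) _.
rewrite sk; set D := kap * _.
have D0 : 0 <= D.
  by rewrite /D mulr_ge0// divr_ge0// subr_ge0 cos_le1.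
have -> : \sum_a pn q k x a * (m * (1 - (a == a0)%:R * D)) =
    m * (1 - pn q k x a0 * D).
  transitivity (m * (\sum_a pn q k x a - \sum_a (a0 == a)%:R * (pn q k x a * D))).
    by rewrite -sumrB mulr_sumr; apply: eq_bigr => a _; rewrite eq_sym; ring.
  by rewrite sum_delta (pn_stochastic sq k).2.
rewrite ler_wpM2l// lerD2l lerN2.
have -> : rho * kap / 2 * (1 - cos (f y1 - f y2)) = rho * D by rewrite /D; field.
by rewrite ler_wpM2r.
Qed.

(** Each block has [k] steps to reach [a0] and two steps for the cancellation, which involves the
    phase at offset [k] in the block. The last [rem] steps bring no gain. *)
Lemma top_blocks (g : nat -> X -> R) (n Qb rem : nat) : rho <= 1 -> kap <= 1 ->
  top_bounded [seq g i | i <- iota n (Qb * k.+2 + rem)]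
    (\prod_(i < Qb) (1 - rho * kap / 2 * (1 - cos (g (n + i * k.+2 + k)%N y1 - g (n + i * k.+2 + k)%N y2)))).
Proof.
move=> rho1 kap1.
have rk : rho * kap <= 1 by rewrite -[1]mulr1 ler_pM.
elim: Qb n => [|Qb IH] n.
  rewrite mul0n add0n big_ord0; elim: (iota n rem) => [|i L IHL] /=; first exact: top_nil.
  move=> x al be ab /=; apply: le_trans (ler_norm_sum _ _ _) _.
  rewrite -(sq.2 x); apply: ler_sum => y _.
  rewrite normrM ger0_norm ?sq.1// -[leRHS]mulr1 ler_wpM2l ?sq.1//.
  by apply: IHL; rewrite rotation_norm.
have -> : (Qb.+1 * k.+2 + rem = k + (2 + (Qb * k.+2 + rem)))%N by rewrite mulSn; lia.
rewrite iotaD map_cat iotaD map_cat /= big_ord_recl mul0n addn0 mulrC.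
apply: top_block; first by rewrite size_map size_iota.
  apply: prodr_ge0 => i _; rewrite subr_ge0.
  set c := cos _; have := cos_geN1 (g (n + bump 0 i * k.+2 + k)%N y1 - g (n + bump 0 i * k.+2 + k)%N y2).
  rewrite -/c => cN1; have : 0 <= rho * kap by rewrite mulr_ge0.
  by nra.
have := IH (n + k + 2)%N; congr (top_bounded _ _); apply: eq_bigr => i _.
have -> : (n + k + 2 + i * k.+2 + k = n + bump 0 i * k.+2 + k)%N by rewrite /bump /= add1n mulSn; lia.
by [].
Qed.

End PhaseSums.

Lemma eq_EL_agree (R : realType) (X : finType) (k : nat -> nat -> X -> X -> R) u L
    (s : nat -> X) (f g : (nat -> X) -> R) :
  (forall s', (forall i, i \notin L -> s' i = s i) -> f s' = g s') ->
  EL k u L s f = EL k u L s g.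
Proof.
elim: L u s => [|v L IH] u s fg /=; first exact: fg.
apply: eq_bigr => y _; congr (_ * _); apply: IH => s' ss'; apply: fg => i.
by rewrite inE negb_or => /andP[iv iL]; rewrite ss'// upd_neq.
Qed.

Section Decay.
Variables (R : realType) (d : measure_display) (Omega : measurableType d).
Variables (P : probability Omega R) (X : finType) (xi : nat -> Omega -> X).
Variables (mu : X -> R) (p : X -> X -> R).
Hypothesis chain : stationary_markov_chain P xi mu p.
Variables (k : nat) (rho kap : R).
Hypothesis rho01 : 0 < rho <= 1.
Hypothesis kap01 : 0 < kap <= 1.
Hypothesis pk : forall g, (k <= g)%N -> forall x y, rho <= pn p g x y.
Variables (m : nat) (F : m.+1.-tuple X -> R).
Variable s0 : nat -> X.
Let E := ex P xi.
Let K0 := kern mu p.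
Let sK : stochastics K0 := stochastic_kern chain.
Let rho_ge0 : 0 <= rho. Proof. by case/andP: rho01 => /ltW. Qed.
Let rho_le1 : rho <= 1. Proof. by case/andP: rho01. Qed.

Lemma ex_le T (f g : (nat -> X) -> R) : dep [pred i | 0 < i <= T]%N f ->
  dep [pred i | 0 < i <= T]%N g -> (forall s, f s <= g s) -> E f <= E g.
Proof.
have iT i : (i \in iota 1 T) = (0 < i <= T)%N by rewrite mem_iota; lia.
move=> df dg fg; rewrite /E !(ex_EL chain s0 (path_iota1 T)).
- exact: EL_le.
- by apply: dep_sub dg => i /=; rewrite iT.
- by apply: dep_sub df => i /=; rewrite iT.
Qed.

Lemma path_gt (u : nat) L : path ltn u L -> forall v, v \in L -> (u < v)%N.
Proof. by move=> /(order_path_min ltn_trans)/allP. Qed.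

(** Successive times are at least [k] apart, so each observed state is [x] with conditional
    probability at least [rho], while the weights [D v] are already fixed by the past up to [u0]. *)
Lemma level_bound u0 u L (D : nat -> (nat -> X) -> R) x s : (0 < u)%N -> (u0 <= u)%N ->
  path (fun a b => (a < b) && (a + k <= b))%N u L ->
  (forall v, v \in L -> dep [pred i | (i <= u0)%N] (D v)) ->
  (forall v s', 0 <= D v s' <= 1) ->
  EL K0 u L s (fun s' => \prod_(v <- L) (1 - D v s' * (s' v == x)%:R))
  <= \prod_(v <- L) (1 - rho * D v s).
Proof.
move=> u_0 u0u + + D01; elim: L u u_0 u0u s => [|v L IH] u u_0 u0u s /=.
  by rewrite !big_nil.
move=> /andP[/andP[uv ukv] vL] dD.
have vL' : path ltn v L by apply: sub_path vL => a b /andP[].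
have Lv := path_gt vL'.
have vnL : v \notin L by apply/negP => /Lv; rewrite ltnn.
have Dv y v' : v' \in v :: L -> D v' (upd s v y) = D v' s.
  by move=> v'L; apply: (dD _ v'L) => i /= iu; rewrite upd_neq// ltn_eqF// (leq_ltn_trans (leq_trans iu u0u)).
have step y : EL K0 v L (upd s v y) (fun s' => \prod_(v' <- v :: L) (1 - D v' s' * (s' v' == x)%:R))
   <= (1 - D v s * (x == y)%:R) * \prod_(v' <- L) (1 - rho * D v' s).
  rewrite (@eq_EL_agree _ _ _ _ _ _ _ (fun s' => (1 - D v s * (x == y)%:R) *
      \prod_(v' <- L) (1 - D v' s' * (s' v' == x)%:R))); last first.
    move=> s' ss'; rewrite big_cons; congr ((1 - _ * _) * _); last by rewrite ss'// updE eq_sym.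
    rewrite -(Dv y v (mem_head _ _)); apply: (dD v (mem_head _ _)) => i /= iu; apply: ss'.
    by apply/negP => /Lv; rewrite ltnNge (leq_trans iu)// (leq_trans u0u)// ltnW.
  rewrite ELZ; apply: ler_wpM2l.
    by have /andP[d0 d1] := D01 v s; case: eqP => _; rewrite ?mulr0 ?mulr1 ?subr0// subr_ge0.
  apply: le_trans (IH v _ _ _ vL _) _.
  - exact: leq_trans uv.
  - exact: leq_trans u0u (ltnW uv).
  - by move=> v' v'L; apply: dD; rewrite inE v'L orbT.
  - by rewrite big_seq [leRHS]big_seq le_eqVlt; apply/orP; left; apply/eqP/eq_bigr => v' v'L;
       rewrite Dv// inE v'L orbT.
rewrite big_cons.
apply: (@le_trans _ _ (\sum_y K0 u v (s u) y * ((1 - D v s * (x == y)%:R) * \prod_(v' <- L) (1 - rho * D v' s)))).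
  by apply: ler_sum => y _; rewrite ler_wpM2l ?(sK _ _).1// step.
have pr0 : 0 <= \prod_(v' <- L) (1 - rho * D v' s).
  apply: prodr_ge0 => v' _; rewrite subr_ge0 -[1]mulr1; have /andP[? ?] := D01 v' s.
  by rewrite ler_pM.
rewrite (_ : \sum_y _ = (1 - D v s * K0 u v (s u) x) * \prod_(v' <- L) (1 - rho * D v' s)).
  rewrite ler_wpM2r// lerD2l lerN2 mulrC ler_wpM2l//; first by have /andP[] := D01 v s.
  by rewrite /K0 /kern gtn_eqF// pk// leq_subRL ?(ltnW uv).
under [LHS]eq_bigr do rewrite mulrA.
rewrite -mulr_suml; congr (_ * _).
under eq_bigr do rewrite mulrBr mulr1.
rewrite sumrB (sK _ _).2; congr (_ - _).
transitivity (\sum_y (x == y)%:R * (D v s * K0 u v (s u) y)); last exact: sum_delta.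
by apply: eq_bigr => y _; ring.
Qed.

Lemma ex_cst c : E (fun=> c) = c.
Proof.
rewrite /E (ex_EL chain s0 (L := [::]))//.
Qed.

Section Levels.
Variables (N n1 Qb : nat).
Hypothesis n1_gt0 : (0 < n1)%N.
Hypothesis n1_low : (m * N <= m.+1 * n1)%N.
Hypothesis nQ : (n1 + Qb * k.+2 <= N)%N.

(** Index of the term in the [i]-th block of [top_blocks] whose last argument may be [y1] or
    [y2]. *)
Definition midpoint (i : nat) : nat := (n1.+1 + i * k.+2 + k)%N.

Lemma midpoint_le i : (i < Qb)%N -> (midpoint i <= N)%N.
Proof.
move=> iQ; apply: leq_trans nQ; have : (i.+1 * k.+2 <= Qb * k.+2)%N by rewrite leq_mul2r iQ orbT.
by rewrite /midpoint mulSn; lia.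
Qed.

Lemma midpoint_gt0 i : (0 < midpoint i)%N.
Proof. by rewrite /midpoint; lia. Qed.

(** The ratio [J / (J + 1)] increases with [J], so the case [J = m] is the strongest. *)
Lemma n1_lowJ J : (J <= m)%N -> (J * N <= J.+1 * n1)%N.
Proof.
move=> Jm; have n1N : (n1 <= N)%N by apply: leq_trans nQ; rewrite leq_addr.
have : ((N - n1) * J <= (N - n1) * m)%N by rewrite leq_mul2l Jm orbT.
rewrite !mulnBl => H; move: n1_low; rewrite !mulSn => H2.
have H3 : (n1 * J <= N * J)%N by rewrite leq_mul2r n1N orbT.
have H4 : (n1 * m <= N * m)%N by rewrite leq_mul2r n1N orbT.
rewrite [(J * N)%N]mulnC [(J * n1)%N]mulnC; move: H2; rewrite [(m * N)%N]mulnC [(m * n1)%N]mulnC; lia.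
Qed.

Definition hits (x : nat -> X) (J n : nat) (s : nat -> X) : R :=
  \prod_(j < J) (s (j.+1 * n)%N == x j)%:R.

Lemma hitsS x J n s : hits x J.+1 n s = hits x J n s * (s (J.+1 * n)%N == x J)%:R.
Proof. by rewrite /hits big_ord_recr. Qed.

Lemma hits01 x J n s : 0 <= hits x J n s <= 1.
Proof.
rewrite /hits; elim: J => [|J /andP[I0 I1]]; first by rewrite big_ord0 ler01 lexx.
rewrite big_ord_recr/=; case: eqP => _; rewrite ?mulr1 ?mulr0 ?I0 ?I1//.
by rewrite lexx ler01.
Qed.

Lemma dep_hits x J n : dep [pred i | 0 < i <= J * n]%N (hits x J n) \/ n = 0%N.
Proof.
have [->|n0] := posnP n; [by right|left].
move=> s s' ss'; apply: eq_bigr => j _; rewrite ss'//=.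
by rewrite muln_gt0 n0 leq_mul2r ltn_ord orbT.
Qed.

(* Induction on the last prescribed coordinate: since [J N <= (J + 1) n1], the times
   [(J + 1) n], [n1 < n <= N], come after all times prescribed by [hits x J], and they are [k]
   apart for successive [midpoint]s, so each hit has conditional probability at least [rho]. *)
Lemma levels_bound x J (del : R) : (J <= m)%N -> 0 <= del <= 1 ->
  E (fun s => \prod_(i < Qb) (1 - del * hits x J (midpoint i) s)) <= (1 - del * rho ^+ J) ^+ Qb.
Proof.
elim: J del => [|J IH] del Jm /andP[d0 d1].
  rewrite (_ : (fun s => _) = (fun=> (1 - del * rho ^+ 0) ^+ Qb)) ?ex_cst//.
  apply/funext => s; under eq_bigr do rewrite /hits big_ord0.
  by rewrite prodr_const card_ord expr0.
set u := (J * N).+1.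
set L := [seq (J.+1 * midpoint i)%N | i <- iota 0 Qb].
have JN : (J * N <= J.+1 * n1)%N by apply: n1_lowJ; exact: ltnW.
have pL : path (fun a b => (a < b) && (a + k <= b))%N u L.
  have gen : forall q i u', (u' + k < J.+1 * midpoint i)%N ->
     path (fun a b => (a < b) && (a + k <= b))%N u' [seq (J.+1 * midpoint i)%N | i <- iota i q].
    elim=> //= q IHq i u' H; rewrite IHq ?andbT.
      by rewrite (ltnW H) andbT (leq_ltn_trans _ H)// leq_addr.
    have -> : midpoint i.+1 = (midpoint i + k.+2)%N by rewrite /midpoint mulSn; lia.
    rewrite mulnDr ltn_add2l (@leq_trans (1 * k.+2)%N)//; first by rewrite mul1n.
    by rewrite leq_mul2r.
  apply: gen; rewrite /u /midpoint mul0n addn0.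
  have -> : (n1.+1 + k = n1 + k.+1)%N by lia.
  rewrite mulnDr; have : (k.+1 <= J.+1 * k.+1)%N by rewrite leq_pmull.
  have [->|J0] := posnP J; first by rewrite !mul1n mul0n; lia.
  have : (k.+1 + k.+1 <= J.+1 * k.+1)%N by rewrite addnn -mul2n leq_mul2r ltnS J0 orbT.
  lia.
have depE : dep [pred i | (i <= u)%N || (i \in L)]
   (fun s => \prod_(i < Qb) (1 - del * hits x J.+1 (midpoint i) s)).
  move=> s s' ss'; apply: eq_bigr => i _; congr (1 - del * _).
  rewrite !hitsS; congr (_ * _); last first.
    rewrite (ss' (J.+1 * midpoint i)%N)//=; apply/orP; right; apply/mapP.
    by exists (i : nat); rewrite ?mem_iota ?add0n ?leq0n //=; exact: ltn_ord.
  case: (dep_hits x J (midpoint i)) => [|H]; last by have := midpoint_gt0 i; rewrite H.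
  apply => j /= /andP[_ jJ]; apply: ss' => /=.
  rewrite (leq_trans jJ)// /u (@leq_trans (J * N)%N)// leq_mul2l midpoint_le ?orbT//.
pose D v s := del * hits x J (v %/ J.+1) s.
have midK i : ((J.+1 * midpoint i) %/ J.+1 = midpoint i)%N by rewrite mulKn.
rewrite /E (ex_EL_from chain (u := u) (L := L))//; last first.
  by apply: sub_path pL => a b /andP[].
apply: (@le_trans _ _ (E (fun s => \prod_(i < Qb) (1 - del * rho * hits x J (midpoint i) s)))); last first.
  rewrite exprSr mulrA mulrAC; apply: IH; first exact: ltnW.
  by rewrite mulr_ge0//= -[leRHS]mulr1 ler_pM.
have prodL (h : nat -> R) : \prod_(v <- L) h (v %/ J.+1)%N = \prod_(i < Qb) h (midpoint i).
  rewrite /L big_map -(big_mkord xpredT (fun i => h (midpoint i))) /index_iota subn0.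
  by apply: eq_bigr => i _; rewrite midK.
have depJ (a : R) T : (J * N <= T)%N -> dep [pred i | 0 < i <= T]%N
   (fun s => \prod_(i < Qb) (1 - a * hits x J (midpoint i) s)).
  move=> JT s s' ss'; apply: eq_bigr => i _; congr (1 - a * _).
  case: (dep_hits x J (midpoint i)) => [|H]; last by have := midpoint_gt0 i; rewrite H.
  apply => j /= /andP[j0 jJ]; apply: ss' => /=; rewrite j0 (leq_trans jJ)//.
  by rewrite (leq_trans _ JT)// leq_mul2l midpoint_le ?orbT.
apply: (@ex_le u).
- have dE := @dep_EL _ _ K0 u L _ [pred i | (0 < i <= u)%N].
  apply: dep_sub (dE _ _) => [i /= /orP[//|/eqP->]|]; first by rewrite /u ltn0Sn leqnn.
  move=> s s' ss'; apply: eq_bigr => i _; congr (1 - del * _).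
  rewrite !hitsS; congr (_ * _); last first.
    rewrite (ss' (J.+1 * midpoint i)%N)//=; apply/orP; right; apply/mapP.
    by exists (i : nat); rewrite ?mem_iota ?add0n ?leq0n //=; exact: ltn_ord.
  case: (dep_hits x J (midpoint i)) => [|H]; last by have := midpoint_gt0 i; rewrite H.
  apply => j /= /andP[j0 jJ]; apply: ss' => /=; rewrite j0.
  rewrite (leq_trans jJ)// /u (@leq_trans (J * N)%N)// leq_mul2l midpoint_le ?orbT//.
- by apply: depJ; rewrite /u.
move=> s.
have D01 v s' : 0 <= D v s' <= 1.
  have /andP[h0 h1] := hits01 x J (v %/ J.+1) s'.
  by rewrite /D mulr_ge0//= -[leRHS]mulr1 ler_pM.
have dD v : v \in L -> dep [pred i | (i <= u)%N] (D v).
  move=> /mapP[i]; rewrite mem_iota add0n => /andP[_ iQ] ->; rewrite /D midK.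
  move=> s1 s2 ss; congr (_ * _).
  case: (dep_hits x J (midpoint i)) => [|H]; last by have := midpoint_gt0 i; rewrite H.
  apply => j /= /andP[j0 jJ]; apply: ss => /=.
  rewrite (leq_trans jJ)// /u (@leq_trans (J * N)%N)// leq_mul2l midpoint_le ?orbT//.
have := @level_bound u u L D (x J) s isT (leqnn _) pL dD D01.
rewrite (prodL (fun n => 1 - rho * (del * hits x J n s))).
have -> : (fun s' => \prod_(v <- L) (1 - D v s' * (s' v == x J)%:R)) =
    (fun s' => \prod_(i < Qb) (1 - del * hits x J.+1 (midpoint i) s')).
  apply/funext => s'; rewrite /L big_map -(big_mkord xpredT (fun i => 1 - del * hits x J.+1 (midpoint i) s')).
  rewrite /index_iota subn0; apply: eq_bigr => i _.
  by rewrite /D midK hitsS mulrA.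
move=> /le_trans; apply; rewrite le_eqVlt; apply/orP; left; apply/eqP/eq_bigr => i _.
by ring.
Qed.

(* As [m (n + r) <= (m + 1) n], only the last arguments of the terms of index in [(n, n + r]] are
   observed after time [(m + 1) n]: conditionally on the past, their sum is additive along the
   chain with kernel [pn p m.+1]. *)
Lemma EL_top r n t al be s : (0 < n)%N -> (m * (n + r) <= m.+1 * n)%N ->
  EL K0 (m.+1 * n) [seq (m.+1 * i)%N | i <- iota n.+1 r] s
    (fun s' => al * cos (t * \sum_(i <- iota n.+1 r) term F i s') -
               be * sin (t * \sum_(i <- iota n.+1 r) term F i s')) =
  top (pn p m.+1) [seq (fun y => t * term F i (upd s (m.+1 * i) y)) | i <- iota n.+1 r]
    (s (m.+1 * n)%N) al be.
Proof.
elim: r n al be s => [|r IH] n al be s n0 low /=.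
  by rewrite big_nil mulr0 cos0 sin0 mulr1 mulr0 subr0.
apply: eq_bigr => y _; congr (_ * _).
  rewrite /K0 /kern gtn_eqF; last by rewrite muln_gt0.
  by rewrite -mulnBr subSnn muln1.
set v := (m.+1 * n.+1)%N.
set th1 := t * term F n.+1 (upd s v y).
have low' : (m * (n.+1 + r) <= m.+1 * n.+1)%N.
  by rewrite addSnnS (leq_trans low)// leq_mul2l leqW.
have vL i : i \in [seq (m.+1 * i)%N | i <- iota n.+2 r] -> (v < i)%N.
  move=> /mapP[j]; rewrite mem_iota => /andP[nj _] ->.
  by rewrite /v ltn_pmul2l.
rewrite (@eq_EL_agree _ _ _ _ _ _ _ (fun s' =>
   (al * cos th1 - be * sin th1) * cos (t * \sum_(i <- iota n.+2 r) term F i s') -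
   (al * sin th1 + be * cos th1) * sin (t * \sum_(i <- iota n.+2 r) term F i s'))); last first.
  move=> s' ss'; rewrite big_cons mulrDr.
  have -> : term F n.+1 s' = term F n.+1 (upd s v y).
    apply: dep_term => i /timesP[j jm ->]; apply: ss'; apply/negP => /vL.
    by rewrite ltnNge /v leq_mul.
  by rewrite -/th1 cosD sinD; ring.
rewrite IH//; congr top; last by rewrite updE.
apply/eq_in_map => i; rewrite mem_iota => /andP[ni ir]; apply/funext => y'.
congr (_ * _); apply: dep_term => a /timesP[j jm ->]; rewrite /upd; case: eqP => // /eqP ne.
rewrite ifN//; apply: contra_neq ne => e; apply/eqP.
have jm' : (j.+1 <= m)%N.
  rewrite ltn_neqAle -ltnS jm andbT; apply/eqP => jE; move: e; rewrite jE => /eqP.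
  by rewrite eqn_pmul2l// => /eqP ie; move: ni; rewrite ie ltnn.
have : (j.+1 * i < v)%N.
  apply: (@leq_ltn_trans (m * (n + r.+1))); first by apply: leq_mul => //; lia.
  by apply: leq_ltn_trans low _; rewrite /v ltn_pmul2l.
by rewrite e ltnn.
Qed.

Variables (xs : m.-tuple X) (y1 y2 a0 z0 : X).
Let q := pn p m.+1.
Hypothesis q1 : kap <= q a0 y1 * q y1 z0.
Hypothesis q2 : kap <= q a0 y2 * q y2 z0.

Definition Flast (y : X) : R := F [tuple of rcons xs y].
Let xx (j : nat) : X := nth y1 xs j.

Lemma term_last n s y : (0 < n)%N -> hits xx m n s = 1 -> term F n (upd s (m.+1 * n) y) = Flast y.
Proof.
move=> n0 h; congr F; apply: val_inj; change (map (upd s (m.+1 * n) y) (times m n) = rcons xs y).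
have hj j : (j < m)%N -> s (j.+1 * n)%N = xx j.
  move=> jm; apply/eqP; apply: contraT => ne; move: h; rewrite /hits.
  rewrite (bigD1 (Ordinal jm))//= (negbTE ne) mul0r => /eqP; rewrite eq_sym.
  by rewrite oner_eq0.
apply: (@eq_from_nth _ y1); first by rewrite size_map size_rcons !size_tuple.
move=> i; rewrite size_map size_tuple => im.
have iT : (i < size (times m n))%N by rewrite size_tuple.
rewrite (nth_map 0%N)// nth_rcons size_tuple.
have -> : nth 0%N (times m n) i = (i.+1 * n)%N.
  rewrite (nth_map (Ordinal im)) ?size_enum_ord//.
  by congr (_.+1 * _)%N; exact: (@nth_enum_ord m.+1 (Ordinal im) i im).
have [i_m|mi] := ltnP i m.
  rewrite upd_neq ?hj// eqn_pmul2r// neq_ltn ltnS i_m//.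
by rewrite (_ : i = m) ?eqxx ?updE//; lia.
Qed.

(** Given the past, [top_blocks] gains a factor in each block at whose midpoint the first [m]
    arguments are [xs]. Averaging over the past by [levels_bound] turns this into a gain in every
    block, reduced by [rho ^+ m]. *)
Lemma decay_bound t al be rem : N = (n1 + (Qb * k.+2 + rem))%N ->
  al ^+ 2 + be ^+ 2 = 1 ->
  `|trunc_ex mu p m s0 N (fun s => al * cos (t * psum F N xpredT s) - be * sin (t * psum F N xpredT s))|
  <= (1 - rho * kap / 2 * (1 - cos (t * (Flast y1 - Flast y2))) * rho ^+ m) ^+ Qb.
Proof.
move=> NE ab; set f := fun s => _ - _.
set r := (Qb * k.+2 + rem)%N in NE.
have rN : (n1 + r = N)%N by rewrite NE.
(* The first [m] arguments of all terms are read at times at most [m * N <= m.+1 * n1], hence in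
   [L1]; [L2] consists of the times of the last arguments of the terms beyond [n1]. *)
set L1 := iota 1 (m.+1 * n1); set L2 := [seq (m.+1 * i)%N | i <- iota n1.+1 r].
have lastL1 : last 0%N L1 = (m.+1 * n1)%N.
  rewrite -nth_last size_iota nth_iota; last by rewrite prednK// muln_gt0.
  by rewrite add1n prednK// muln_gt0.
have fdep : dep [pred i | 0 < i <= m.+1 * N]%N f.
  by move=> s s' ss'; rewrite /f (@dep_psum_N _ _ _ F N xpredT s s' ss').
have pL : path ltn 0%N (L1 ++ L2).
  rewrite cat_path path_iota1 lastL1 /=; have gen : forall q n, path ltn (m.+1 * n) [seq (m.+1 * i)%N | i <- iota n.+1 q].
    by elim=> // q' IHq n; apply/andP; split; [rewrite /= ltn_pmul2l|exact: IHq].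
  exact: gen.
rewrite (trunc_exE s0 chain)// (ex_EL chain s0 pL); last first.
  move=> s s' ss'; rewrite /f (_ : psum F N xpredT s = psum F N xpredT s')//.
  rewrite /psum [LHS]big_nat_cond [RHS]big_nat_cond; apply: eq_bigr => n /andP[/andP[n0 nN] _].
  apply: dep_term => i /timesP[j jm ->]; apply: ss' => /=; rewrite mem_cat.
  have [lo|hi] := leqP (j.+1 * n) (m.+1 * n1).
    by rewrite mem_iota add1n ltnS lo muln_gt0 n0.
  apply/orP; right; apply/mapP; exists n.
    rewrite mem_iota; apply/andP; split; last by lia.
    rewrite -(ltn_pmul2l (ltn0Sn m)); apply: leq_trans hi _.
    by rewrite leq_mul2r jm orbT.
  congr (_ * _)%N; apply/eqP; rewrite eqn_leq jm /= leqNgt; apply/negP => jm'.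
  have : (j.+1 * n <= m * N)%N by apply: leq_mul; lia.
  by lia.
rewrite EL_cat lastL1.
(* The terms up to [n1] are known at time [m.+1 * n1] and only rotate the initial vector. *)
pose A s := \sum_(1 <= n < n1.+1) term F n s.
pose al' s := al * cos (t * A s) - be * sin (t * A s).
pose be' s := al * sin (t * A s) + be * cos (t * A s).
have inner s : EL K0 (m.+1 * n1) L2 s f =
  top q [seq (fun y => t * term F i (upd s (m.+1 * i) y)) | i <- iota n1.+1 r]
     (s (m.+1 * n1)%N) (al' s) (be' s).
  rewrite -EL_top//; last by rewrite rN.
  apply: eq_EL_agree => s' ss'; rewrite /f.
  have -> : psum F N xpredT s' = A s + \sum_(i <- iota n1.+1 r) term F i s'.
    rewrite /psum (@big_cat_nat _ _ _ n1.+1)//=; last by lia.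
    congr (_ + _); last by rewrite /index_iota subSS -rN addKn.
    rewrite /A [LHS]big_nat_cond [RHS]big_nat_cond; apply: eq_bigr => n /andP[/andP[n0 nn1] _].
    apply: dep_term => i /timesP[j jm ->]; apply: ss'; apply/negP => /mapP[i'].
    rewrite mem_iota => /andP[H _] e.
    have : (j.+1 * n <= m.+1 * n1)%N by apply: leq_mul.
    by rewrite e leq_pmul2l// leqNgt H.
  by rewrite mulrDr cosD sinD /al' /be'; ring.
pose del := rho * kap / 2 * (1 - cos (t * (Flast y1 - Flast y2))).
have c01 : 0 <= rho * kap / 2 <= 1 / 2.
  have /andP[k0 k1] := kap01; have /andP[r0 r1] := rho01.
  have H0 : 0 <= rho * kap by rewrite mulr_ge0// ltW.
  have H1 : rho * kap <= 1 by rewrite -[leRHS]mulr1 ler_pM// ltW.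
  lra.
have del01 : 0 <= del <= 1.
  rewrite /del; set c := cos _; have := cos_le1 (t * (Flast y1 - Flast y2)).
  have := cos_geN1 (t * (Flast y1 - Flast y2)); rewrite -/c => H1 H2.
  by move: c01; set w := rho * kap / 2 => w01; nra.
apply: le_trans (EL_norm_le _ _ _ _ sK) _.
apply: (@le_trans _ _ (EL K0 0%N L1 s0 (fun s => \prod_(i < Qb) (1 - del * hits xx m (midpoint i) s)))).
  apply: EL_le => // s; rewrite inner.
  have /andP[k0 k1] := kap01; have /andP[r0 r1] := rho01.
  have qk x : rho <= pn q k x a0.
    rewrite /q (_ : pn (pn p m.+1) k x a0 = pn p (k * m.+1) x a0).
      by apply: pk; rewrite leq_pmulr.
    elim: (k) x => [//|k' IHk] x; rewrite mulSn pnD /pn -/pn -/(pn q).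
    by apply: eq_bigr => z _; rewrite IHk.
  have ab' : al' s ^+ 2 + be' s ^+ 2 = 1 by rewrite rotation_norm.
  have := @top_blocks R X q (pn_stochastic (stochastic_p chain) m.+1) k rho kap a0 z0 y1 y2
     (ltW r0) (ltW k0) qk q1 q2 (fun i y => t * term F i (upd s (m.+1 * i) y)) n1.+1 Qb rem r1 k1
     (s (m.+1 * n1)%N) _ _ ab'.
  move=> /le_trans; apply; apply: ler_prod => i _; rewrite -/(midpoint i).
  set g := cos _.
  have g1 : g <= 1 by exact: cos_le1.
  have gN1 : -1 <= g by exact: cos_geN1.
  apply/andP; split; first by move: c01; set w := rho * kap / 2 => w01; nra.
  have /andP[h0 h1] := hits01 xx m (midpoint i) s.
  have [h|h] : hits xx m (midpoint i) s = 1 \/ hits xx m (midpoint i) s = 0.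
  - rewrite /hits; elim/big_rec: _ => [|j z _ [->|->]]; first by left.
      by case: eqP => _; rewrite ?mul1r ?mul0r; [left|right].
    by rewrite mulr0; right.
  - rewrite h mulr1 /del /g !(term_last _ (midpoint_gt0 i) h) -mulrBr.
    by [].
  - rewrite h mulr0 subr0 gerBl mulr_ge0 ?subr_ge0//; by case/andP: c01.
have -> : EL K0 0%N L1 s0 (fun s => \prod_(i < Qb) (1 - del * hits xx m (midpoint i) s)) =
   E (fun s => \prod_(i < Qb) (1 - del * hits xx m (midpoint i) s)).
  rewrite /E (ex_EL chain s0 (path_iota1 (m.+1 * n1)))//.
  move=> s s' ss'; apply: eq_bigr => i _; congr (1 - del * _).
  case: (dep_hits xx m (midpoint i)) => [|H]; last by have := midpoint_gt0 i; rewrite H.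
  apply => j /= /andP[j0 jJ]; apply: ss' => /=; rewrite mem_iota j0 /= add1n ltnS (leq_trans jJ)//.
  by rewrite (leq_trans _ n1_low)// leq_mul2l midpoint_le ?orbT.
exact: levels_bound.
Qed.

End Levels.
End Decay.

(** * The central limit theorem *)

Section RealLemmas.
Variable R : realType.
Implicit Types (f df : R -> R) (x y a b : R).

Lemma mean_value_bound f df a b B : (forall x, is_derive x 1 f (df x)) ->
  (forall x, Num.min a b <= x <= Num.max a b -> `|df x| <= B) ->
  `|f b - f a| <= B * `|b - a|.
Proof.
wlog ab : a b / a <= b => [H fd dB|fd].
  have [ab|/ltW ba] := leP a b; first exact: H.
  rewrite distrC [`|b - a|]distrC; apply: H => // x; rewrite minC maxC; exact: dB.
rewrite (min_idPl ab) (max_idPr ab) => dB.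
have cf : {within `[a, b], continuous f}.
  by apply: derivable_within_continuous => x _; exact: (@ex_derive _ _ _ _ _ _ _ (fd x)).
have [c cab ->] := MVT_segment ab (fun x _ => fd x) cf.
rewrite normrM ler_wpM2r//; apply: dB.
by move: cab; rewrite in_itv.
Qed.

Lemma sin_lipschitz x y : `|sin x - sin y| <= `|x - y|.
Proof.
rewrite -[leRHS]mul1r; apply: (@mean_value_bound sin cos) => z _.
by rewrite ler_norml cos_geN1 cos_le1.
Qed.

Lemma cos_lipschitz x y : `|cos x - cos y| <= `|x - y|.
Proof.
rewrite -[leRHS]mul1r; apply: (@mean_value_bound cos (fun x => - sin x)) => z _.
by rewrite normrN ler_norml sin_geN1 sin_le1.
Qed.

Lemma sin_taylor a b : `|sin (a + b) - sin a - b * cos a| <= b ^+ 2.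
Proof.
pose f x := sin x - x * cos a.
have fd x : is_derive x 1 f (cos x - cos a).
  rewrite /f; have H1 : is_derive x 1 (fun x : R => x * cos a) (cos a).
    have := is_deriveM (is_derive_id x (1 : R)) (is_derive_cst (cos a) x (1 : R)).
    by rewrite scaler0 add0r /GRing.scale/= mulr1.
  exact: (is_deriveB (is_derive_sin x) H1).
have := @mean_value_bound f (fun x => cos x - cos a) a (a + b) `|b| fd.
rewrite /f (_ : _ - _ - _ = sin (a + b) - sin a - b * cos a); last ring.
rewrite (_ : a + b - a = b); last ring.
rewrite -expr2 real_normK ?num_real//; apply => x xab.
apply: le_trans (cos_lipschitz _ _) _.
move: xab; case: (leP a (a + b)) => H /andP[H1 H2]; rewrite ler_norml.
  rewrite ger0_norm; lra.
rewrite ltr0_norm; lra.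
Qed.

Lemma is_derive_sumf (I : Type) (r : seq I) (h : I -> R -> R) (dh : I -> R) x :
  (forall i, is_derive x 1 (h i) (dh i)) ->
  is_derive x 1 (fun t => \sum_(i <- r) h i t) (\sum_(i <- r) dh i).
Proof.
move=> hd; elim: r => [|i r IH].
  rewrite big_nil (_ : (fun t => _) = cst 0); first exact: is_derive_cst.
  by apply/funext => t; rewrite big_nil.
rewrite big_cons (_ : (fun t => _) = (fun t => h i t + \sum_(i <- r) h i t)).
  exact: is_deriveD.
by apply/funext => t; rewrite big_cons.
Qed.

Lemma is_derive_EL (X : finType) (k : nat -> nat -> X -> X -> R) u L s
    (f df : R -> (nat -> X) -> R) x :
  (forall s', is_derive x 1 (f^~ s') (df x s')) ->
  is_derive x 1 (fun t => EL k u L s (f t)) (EL k u L s (df x)).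
Proof.
move=> fd; elim: L u s => [|v L IH] u s //=.
by apply: is_derive_sumf => y; exact: (is_deriveZ (k u v (s u) y) (IH v (upd s v y))).
Qed.

Lemma polynomial_geometric (th : R) j : 0 < th < 1 ->
  exists2 C : R, 0 <= C & exists2 t : R, 0 < t < 1 &
    forall n, n.+1%:R ^+ j * th ^+ n <= C * t ^+ n.
Proof.
elim: j th => [|j IH] th th01.
  by exists 1 => //; exists th => // n; rewrite expr0.
have [C C0 [t t01 Ct]] := linear_geometric th01 (isT : (0 < 1)%N).
have [C' C'0 [t' t'01 Ct']] := IH t t01.
exists (C * C'); first by rewrite mulr_ge0.
exists t' => // n; rewrite exprSr -mulrA -mulrA.
have H := Ct n; rewrite divn1 in H.
apply: le_trans (ler_wpM2l _ H) _; first by rewrite exprn_ge0.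
by rewrite mulrCA ler_wpM2l.
Qed.

End RealLemmas.

Section CentralLimit.
Variables (R : realType) (d : measure_display) (Omega : measurableType d).
Variables (P : probability Omega R) (X : finType) (xi : nat -> Omega -> X).
Variables (mu : X -> R) (p : X -> X -> R).
Hypothesis chain : stationary_markov_chain P xi mu p.
Variables (C th : R).
Hypothesis C0 : 0 <= C.
Hypothesis th01 : 0 < th < 1.
Hypothesis mix : forall n x, \sum_y `|pn p n x y - mu y| <= C * th ^+ n.
Variables (m : nat) (F : m.+1.-tuple X -> R) (M : R).
Hypothesis FM : forall t, `|F t| <= M.
Hypothesis Fc : pmf_int (@pmf_pow R X mu m.+1) F = 0.
Variable s0 : nat -> X.
Variable sig2 : R.
Hypothesis sig2_ge0 : 0 <= sig2.
Hypothesis var_cvg : second_moment P xi F N / N%:R @[N --> \oo] --> sig2.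
Let l : R := m.+1%:R.
Let mr := mixrate X C th.
Notation EN := (trunc_ex mu p m s0).
Let S N := psum F N xpredT.
Let M_0 : 0 <= M := M0 FM s0.
Let mr0 K : 0 <= mr K := mixrate_ge0 X C0 th01 K.
Let l0 : 0 <= l. Proof. exact: ler0n. Qed.
Let sk : stochastics (kern mu p) := stochastic_kern chain.

Definition mixtotal : R := #|X|%:R * C * (1 - th)^-1.

Lemma mixtotal_ge0 : 0 <= mixtotal.
Proof.
case/andP: th01 => t0 t1; rewrite /mixtotal mulr_ge0 ?invr_ge0 ?subr_ge0 ?(ltW t1)//.
by rewrite mulr_ge0 ?ler0n.
Qed.

Lemma mixtotal_bound N : \sum_(1 <= n < N.+1) mr n <= mixtotal.
Proof.
rewrite /mr /mixrate -mulr_sumr /mixtotal ler_wpM2l ?mulr_ge0 ?ler0n//.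
apply: le_trans (@geometric_sum_le _ th N.+1 _).
  by rewrite [leRHS]big_ltn// lerDr expr0.
by case/andP: th01 => t0 t1; rewrite (ltW t0).
Qed.

Lemma mean_bound N : `|EN N (S N)| <= M * l * mixtotal.
Proof.
rewrite /S /trunc_ex EL_sum; apply: le_trans (ler_norm_sum _ _ _) _.
apply: (@le_trans _ _ (\sum_(1 <= n < N.+1) M * l * mr n)); last first.
  by rewrite -mulr_sumr ler_wpM2l ?mulr_ge0// mixtotal_bound.
rewrite [leLHS]big_nat_cond [leRHS]big_nat_cond; apply: ler_sum => n /andP[nN _].
by apply: (EN_term_mean chain C0 th01 mix FM Fc); lia.
Qed.

(** The far pairs contribute products of means, which are summable, and at most [N ^ 2] decoupling
    errors, which are negligible when [K] is a power of [N]. *)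
Lemma nearvar_second_moment N K : (0 < K)%N ->
  `|nearvar mu p F s0 N K - second_moment P xi F N| <=
  (M * l * mixtotal) ^+ 2 + N%:R ^+ 2 * (M ^+ 2 * (6 * l) * mr K).
Proof.
move=> K0.
have -> : nearvar mu p F s0 N K = \sum_(1 <= n < N.+1) \sum_(1 <= n' < N.+1 | near_times m K n n') cov P xi F n n'.
  rewrite /nearvar [LHS]big_nat_cond [RHS]big_nat_cond; apply: eq_bigr => n /andP[nN _].
  rewrite [LHS]big_nat_cond [RHS]big_nat_cond; apply: eq_bigr => n' /andP[nN' _].
  by rewrite (cov_EN chain F s0 nN nN').
rewrite (second_momentE chain F s0) distrC -sumrB.
have split n : \sum_(1 <= n' < N.+1) cov P xi F n n' -
   \sum_(1 <= n' < N.+1 | near_times m K n n') cov P xi F n n' =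
   \sum_(1 <= n' < N.+1 | ~~ near_times m K n n') cov P xi F n n'.
  by rewrite (bigID (near_times m K n))/= addrAC subrr add0r.
under eq_bigr do rewrite split.
apply: le_trans (ler_norm_sum _ _ _) _.
have c0 : 0 <= M ^+ 2 * (6 * l) * mr K by rewrite mulr_ge0// mulr_ge0 ?exprn_ge0// mulr_ge0.
apply: (@le_trans _ _ (\sum_(1 <= n < N.+1) \sum_(1 <= n' < N.+1)
   ((M * l * mr n) * (M * l * mr n') + M ^+ 2 * (6 * l) * mr K))).
  rewrite [leLHS]big_nat_cond [leRHS]big_nat_cond; apply: ler_sum => n /andP[/andP[n0 _] _].
  apply: le_trans (ler_norm_sum _ _ _) _; rewrite [leLHS]big_mkcond/=.
  rewrite [leLHS]big_nat_cond [leRHS]big_nat_cond; apply: ler_sum => n' /andP[/andP[n'0 _] _].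
  case: ifPn => far; first exact: (cov_far chain C0 th01 mix FM Fc s0 K0 n0 n'0 far).
  by rewrite addr_ge0// mulr_ge0// mulr_ge0// mulr_ge0.
under eq_bigr do rewrite big_split/= -mulr_sumr sumr_const_nat subSS subn0.
rewrite big_split/= -mulr_suml sumr_const_nat subSS subn0 -mulr_sumr.
apply: lerD.
  have Z0 : 0 <= M * l * \sum_(1 <= i < N.+1) mr i by apply: mulr_ge0; [exact: mulr_ge0|exact: sumr_ge0].
  have Z1 : M * l * \sum_(1 <= i < N.+1) mr i <= M * l * mixtotal.
    by apply: ler_wpM2l; [exact: mulr_ge0|exact: mixtotal_bound].
  by rewrite expr2; apply: ler_pM.
by rewrite -[leLHS]mulr_natl -[(_ * mr K) *+ N]mulr_natl mulrA -expr2.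
Qed.

(** Gives the width [K] of nearness: the Taylor error in Stein's method, of order [K ^ 2 / sqrt N],
    is then [O(1 / K)], while [N] is bounded by a polynomial in [K], which [th ^+ K] beats. *)
Lemma eighth_root (N : nat) : (0 < N)%N ->
  exists K : nat, [/\ (0 < K)%N, (K ^ 8 <= N)%N & (N < K.+1 ^ 8)%N].
Proof.
move=> N0; have H1 : exists K, (K ^ 8 <= N)%N by exists 1%N.
have H2 K : (K ^ 8 <= N)%N -> (K <= N)%N.
  by case: K => // K; apply: leq_trans; rewrite -[K.+1 in leqLHS]expn1 leq_pexp2l.
case: (ex_maxnP H1 H2) => K KN Kmax; exists K; split => //; first exact: Kmax.
by rewrite ltnNge; apply/negP => /Kmax; rewrite ltnn.
Qed.

(** Sum of the coefficients in [stein_scaled], once every remainder is bounded by a multiple of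
    [1 / K] or of [K.+1%:R ^+ 8 * th ^+ K]. *)
Definition stein_const (A : R) : R :=
  16 * (M ^+ 3 * A ^+ 2 * l ^+ 4) + 6 * (M * l * (#|X|%:R * C)) +
  24 * (M ^+ 2 * A * l ^+ 3 * (#|X|%:R * C)) + M * l * mixtotal +
  A * ((M * l * mixtotal) ^+ 2 + 6 * (M ^+ 2 * l * (#|X|%:R * C))).

Lemma stein_scaled N K (A s phi : R) : 0 <= A -> `|s| <= A ->
  (0 < K)%N -> (K ^ 8 <= N)%N -> (N < K.+1 ^ 8)%N ->
  `|EN N (fun w => S N w / Num.sqrt N%:R * sin (s / Num.sqrt N%:R * S N w + phi)) -
    s * sig2 * EN N (fun w => cos (s / Num.sqrt N%:R * S N w + phi))| <=
  stein_const A * (K%:R^-1 + K.+1%:R ^+ 8 * th ^+ K) +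
  A * `|second_moment P xi F N / N%:R - sig2|.
Proof.
move=> A0 sA K0 KN NK.
have kk1 : 1 <= K%:R :> R by rewrite ler1n.
have N0 : 0 < N%:R :> R by rewrite ltr0n (leq_trans _ KN)// expn_gt0 K0.
set rN := Num.sqrt N%:R.
set tau := s / rN.
have rN0 : 0 < rN by rewrite sqrtr_gt0.
have rNE : N%:R = rN ^+ 2 :> R by rewrite sqr_sqrtr// ltW.
have rNlow : K%:R ^+ 4 <= rN.
  rewrite -(@ler_pXn2r _ 2)// ?nnegrE ?exprn_ge0 ?(ltW rN0) ?ler0n//.
  by rewrite -rNE -exprM -natrX ler_nat.
have rNhigh : rN <= K.+1%:R ^+ 4.
  rewrite -(@ler_pXn2r _ 2)// ?nnegrE ?exprn_ge0 ?(ltW rN0) ?ler0n//.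
  by rewrite -rNE -exprM -natrX ler_nat ltnW.
(* As [tau] is of order [1 / sqrt N], the constants [B1 = |tau|] and [B2 = tau ^+ 2] of
   [stein_bound] are small. *)
pose psi x := sin (tau * x + phi).
pose psi' x := tau * cos (tau * x + phi).
have stein := @stein_bound R d Omega P X xi mu p chain C th C0 th01 mix m F M FM Fc s0 N K psi psi'
  `|tau| (tau ^+ 2) K0.
have {}stein := stein (fun x => _) (fun x => _) (fun x h => _) (fun x h => _).
set err := N%:R * _ + _ in stein.
have {}stein : `|EN N (fun w => S N w * psi (S N w)) - nearvar mu p F s0 N K *
    EN N (fun w => psi' (S N w))| <= err.
  apply: stein.
  - by move=> x; rewrite /psi ler_norml sin_geN1 sin_le1.
  - move=> x; rewrite /psi' normrM -[leRHS]mulr1 ler_wpM2l//.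
    by rewrite ler_norml cos_geN1 cos_le1.
  - move=> x h; rewrite /psi /psi' (_ : tau * (x + h) + phi = (tau * x + phi) + tau * h); last ring.
    rewrite (_ : h * _ = tau * h * cos (tau * x + phi)); last ring.
    by rewrite -exprMn; exact: sin_taylor.
  - move=> x h; rewrite /psi' -mulrBr normrM.
    apply: le_trans (ler_wpM2l _ (cos_lipschitz _ _)) _ => //.
    rewrite (_ : _ - _ = tau * h); last ring.
    by rewrite [`|tau * h|]normrM mulrA -expr2 real_normK ?num_real.
set cs := EN N (fun w => cos (tau * S N w + phi)).
have cs1 : `|cs| <= 1 by apply: EL_norm => // w; rewrite ler_norml cos_geN1 cos_le1.
have e1 : EN N (fun w => S N w / rN * sin (tau * S N w + phi)) =
    rN^-1 * EN N (fun w => S N w * psi (S N w)).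
  by rewrite /trunc_ex -ELZ; apply: eq_EL => w; rewrite /psi; ring.
have e2 : EN N (fun w => psi' (S N w)) = tau * cs by rewrite /cs /trunc_ex -ELZ.
rewrite e2 in stein; rewrite e1 -/cs.
set V := nearvar _ _ _ _ _ _ in stein.
set V2 := second_moment _ _ _ _.
have nV : `|V - V2| <= (M * l * mixtotal) ^+ 2 + N%:R ^+ 2 * (M ^+ 2 * (6 * l) * mr K).
  exact: nearvar_second_moment.
set a := EN N _ in stein *.
have -> : rN^-1 * a - s * sig2 * cs = rN^-1 * (a - V * (tau * cs))
   + s * ((V - V2) / N%:R) * cs + s * (V2 / N%:R - sig2) * cs.
  rewrite /tau rNE; field; exact: lt0r_neq0.
apply: le_trans (ler_normD _ _) _; apply: lerD; last first.
  rewrite 2!normrM -[leRHS]mulr1; apply: ler_pM => //.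
  by rewrite ler_wpM2r.
apply: le_trans (ler_normD _ _) _.
set cX := #|X|%:R * C; have cX0 : 0 <= cX by rewrite mulr_ge0 ?ler0n.
case/andP: (th01) => t0 t1.
set u := K%:R^-1; set W := K.+1%:R ^+ 8 * th ^+ K.
have u0 : 0 <= u by rewrite invr_ge0 ler0n.
have W0 : 0 <= W by rewrite mulr_ge0 ?exprn_ge0 ?ler0n ?(ltW t0).
have thK0 : 0 <= th ^+ K by rewrite exprn_ge0// ltW.
have mrK : mr K = cX * th ^+ K by [].
have kk0 : 0 < K%:R :> R by rewrite ltr0n.
have iN0 : 0 <= rN^-1 by rewrite invr_ge0 ltW.
have kS1 : 1 <= K.+1%:R :> R by rewrite ler1n.
have G1 : rN^-1 * K%:R ^+ 2 <= u.
  rewrite mulrC ler_pdivrMr// /u ler_pdivlMl// -exprS.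
  by apply: le_trans rNlow; rewrite ler_weXn2l.
have G2 : rN^-1 <= u.
  rewrite /u lef_pV2 ?posrE//; apply: le_trans rNlow; exact: ler_eXnr.
have G3 : rN <= K.+1%:R ^+ 8 by apply: le_trans rNhigh _; rewrite ler_weXn2l.
have G4 : K%:R <= K.+1%:R ^+ 8 :> R.
  by apply: (@le_trans _ _ K.+1%:R); [rewrite ler_nat|exact: ler_eXnr].
have G5 : N%:R^-1 <= u.
  rewrite /u lef_pV2 ?posrE// ler_nat; apply: leq_trans KN.
  by rewrite -[K in leqLHS]expn1 leq_pexp2l.
have G6 : N%:R <= K.+1%:R ^+ 8 :> R by rewrite -natrX ler_nat ltnW.
have QE : (nearb m K)%:R = 2 * l ^+ 2 * K%:R :> R by rewrite /nearb !natrM; ring.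
have s2 : s ^+ 2 <= A ^+ 2 by rewrite -(real_normK (num_real s)) lerXn2r ?nnegrE.
have B1 : rN^-1 * err <= 16 * (M ^+ 3 * A ^+ 2 * l ^+ 4) * u + 6 * (M * l * cX) * W +
    24 * (M ^+ 2 * A * l ^+ 3 * cX) * W + M * l * mixtotal * u.
  have -> : rN^-1 * err = 16 * M ^+ 3 * l ^+ 4 * (s ^+ 2 * (rN^-1 * K%:R ^+ 2)) +
     6 * (M * l * cX) * (rN * th ^+ K) + 24 * (M ^+ 2 * l ^+ 3 * cX) * (`|s| * (K%:R * th ^+ K))
     + M * l * (rN^-1 * \sum_(1 <= n < N.+1) mr n).
    have -> : err = N%:R * (4 * (M ^+ 3 * tau ^+ 2 * (nearb m K)%:R ^+ 2) + 6 * (M * l * mr K) +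
        12 * (M ^+ 2 * `|tau| * l * (nearb m K)%:R * mr K)) + M * l * \sum_(1 <= n < N.+1) mr n by [].
    rewrite QE mrK rNE /tau normrM normrV ?unitfE ?lt0r_neq0// (gtr0_norm rN0).
    field; exact: lt0r_neq0.
  have P1 : 0 <= M ^+ 3 * l ^+ 4 by rewrite mulr_ge0 ?exprn_ge0.
  have P2 : 0 <= M * l * cX by rewrite mulr_ge0// mulr_ge0.
  have P3 : 0 <= M ^+ 2 * l ^+ 3 * cX by rewrite mulr_ge0// mulr_ge0 ?exprn_ge0.
  apply: lerD; [apply: lerD; [apply: lerD|]|].
  - rewrite (_ : 16 * (M ^+ 3 * A ^+ 2 * l ^+ 4) * u = 16 * M ^+ 3 * l ^+ 4 * (A ^+ 2 * u)); last ring.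
    rewrite ler_wpM2l//; first by rewrite -mulrA mulr_ge0.
    by apply: ler_pM => //; rewrite ?sqr_ge0 ?mulr_ge0 ?exprn_ge0 ?ler0n.
  - by rewrite ler_wpM2l ?mulr_ge0// /W ler_wpM2r.
  - rewrite (_ : 24 * (M ^+ 2 * A * l ^+ 3 * cX) * W = 24 * (M ^+ 2 * l ^+ 3 * cX) * (A * W)); last ring.
    rewrite ler_wpM2l ?mulr_ge0//.
    apply: ler_pM => //; first by rewrite mulr_ge0 ?ler0n.
    by rewrite /W ler_wpM2r.
  - rewrite -[leRHS]mulrA [mixtotal * u]mulrC ler_wpM2l ?mulr_ge0// ler_pM//.
      by apply: sumr_ge0 => n _.
    exact: mixtotal_bound.
have B2 : `|V - V2| / N%:R <= (M * l * mixtotal) ^+ 2 * u + 6 * (M ^+ 2 * l * cX) * W.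
  rewrite ler_pdivrMr//; apply: le_trans nV _; rewrite [leRHS]mulrDl; apply: lerD.
    by rewrite -[leRHS]mulrA ler_peMr ?sqr_ge0// -ler_pdivrMr// mul1r.
  rewrite mrK (_ : N%:R ^+ 2 * _ = 6 * (M ^+ 2 * l * cX) * (N%:R * th ^+ K) * N%:R); last ring.
  rewrite ler_wpM2r ?ler0n// ler_wpM2l//.
    by rewrite mulr_ge0// mulr_ge0// mulr_ge0 ?exprn_ge0.
  by rewrite /W ler_wpM2r.
have B3 : `|s * ((V - V2) / N%:R) * cs| <= A * ((M * l * mixtotal) ^+ 2 * u + 6 * (M ^+ 2 * l * cX) * W).
  rewrite 2!normrM -[leRHS]mulr1; apply: ler_pM => //.
  by apply: ler_pM => //; rewrite normrM [X in _ * X]gtr0_norm ?invr_gt0.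
have B4 : `|rN^-1 * (a - V * (tau * cs))| <= rN^-1 * err.
  by rewrite normrM ger0_norm// ler_wpM2l.
apply: le_trans (lerD (le_trans B4 B1) B3) _.
rewrite /stein_const -/cX; set c1 := 16 * _; set c2 := 6 * _; set c3 := 24 * _; set c4 := _ * mixtotal.
set c5 := (c4 ^+ 2); set c6 := 6 * _.
have c_ge : [/\ 0 <= c1, 0 <= c2, 0 <= c3, 0 <= c4 & 0 <= c5 /\ 0 <= c6].
  have mt := mixtotal_ge0.
  by split; [| | | |split]; repeat first [done | apply: exprn_ge0 | apply: mulr_ge0 | exact: sqr_ge0].
case: c_ge => c1p c2p c3p c4p [c5p c6p].
have P5 : 0 <= A * c5 by rewrite mulr_ge0.
have P6 : 0 <= A * c6 by rewrite mulr_ge0.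
rewrite -subr_ge0 (_ : _ - _ = c1 * W + c2 * u + c3 * u + c4 * W + (A * c5) * W + (A * c6) * u).
  by repeat first [done | apply: addr_ge0 | apply: mulr_ge0].
ring.
Qed.

Lemma stein_limit (A e : R) : 0 <= A -> 0 < e -> \forall N \near \oo, forall s phi, `|s| <= A ->
  `|EN N (fun w => S N w / Num.sqrt N%:R * sin (s / Num.sqrt N%:R * S N w + phi)) -
    s * sig2 * EN N (fun w => cos (s / Num.sqrt N%:R * S N w + phi))| <= e.
Proof.
move=> A0 e0.
have [D D0 [t /andP[t0 t1] Dt]] := polynomial_geometric 8 th01.
have cvK : stein_const A * (K.+1%:R^-1 + D * t ^+ K.+1) @[K --> \oo] --> (0 : R).
  rewrite -[X in _ --> X](mulr0 (stein_const A)); apply: cvgMr.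
  rewrite -[X in _ --> X](addr0 0); apply: cvgD; first exact: cvg_harmonic.
  rewrite -[X in _ --> X](mulr0 D); apply: cvgMr.
  by rewrite (cvg_shiftS (fun n => t ^+ n)); apply: cvg_expr; rewrite gtr0_norm.
have e2 : 0 < e / 2 by rewrite divr_gt0.
have /cvgrPdist_lt/(_ _ e2)[K0 _ K0P] := cvK.
have e3 : 0 < e / 2 / (A + 1) by rewrite divr_gt0// ltr_wpDl.
have /cvgrPdist_lt/(_ _ e3)[N1 _ N1P] := var_cvg.
exists (maxn N1 (K0.+1 ^ 8)) => // N /=; rewrite geq_max => /andP[N1N K0N] s phi sA.
have N0 : (0 < N)%N by apply: leq_trans K0N; rewrite expn_gt0.
have [K [Kp KN NK]] := eighth_root N0.
have K0K : (K0 <= K.-1)%N.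
  rewrite -ltnS prednK// -ltnS -(@ltn_exp2r _ _ 8)//; exact: leq_ltn_trans NK.
apply: le_trans (stein_scaled phi A0 sA Kp KN NK) _.
rewrite [e]splitr; apply: lerD.
  have := K0P _ K0K; rewrite prednK// sub0r normrN => /ltW; apply: le_trans.
  apply: le_trans (ler_norm _); rewrite ler_wpM2l ?lerD2l//.
  rewrite /stein_const; have mt := mixtotal_ge0.
  have cX0 : 0 <= #|X|%:R * C by rewrite mulr_ge0 ?ler0n.
  by repeat first [done | apply: addr_ge0 | apply: exprn_ge0 | apply: mulr_ge0].
have := N1P _ N1N; rewrite distrC ltr_pdivlMr ?ltr_wpDl// => /ltW; apply: le_trans.
by rewrite mulrC ler_wpM2l// lerDl.
Qed.

(** By [stein_limit] the product [h] of the characteristic function and [expR (x ^+ 2 * sig2 / 2)]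
    has a small derivative on bounded sets, so it stays near its value [cos phi] at 0. *)
Lemma charfun_cvg (A e : R) : 0 <= A -> 0 < e -> \forall N \near \oo, forall s phi, `|s| <= A ->
  `|EN N (fun w => cos (s / Num.sqrt N%:R * S N w + phi)) - cos phi * expR (- (s ^+ 2 * sig2 / 2))| <= e.
Proof.
move=> A0 e0.
pose G := expR (A ^+ 2 * sig2 / 2) * (A + 1).
have G0 : 0 < G by rewrite mulr_gt0 ?expR_gt0// ltr_wpDl.
have [N1 _ N1P] := @stein_limit A (e / G) A0 (divr_gt0 e0 G0).
exists N1 => // N N1N s phi sA.
pose h (x : R) : R := EN N (fun w => cos (x / Num.sqrt N%:R * S N w + phi)) * expR (x ^+ 2 * sig2 / 2).
pose dh (x : R) : R := - (EN N (fun w => S N w / Num.sqrt N%:R * sin (x / Num.sqrt N%:R * S N w + phi)) -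
    x * sig2 * EN N (fun w => cos (x / Num.sqrt N%:R * S N w + phi))) * expR (x ^+ 2 * sig2 / 2).
have hd (x : R) : is_derive x 1 h (dh x).
  have d1 w : is_derive x 1 (fun x : R => cos (x / Num.sqrt N%:R * S N w + phi))
      (- (S N w / Num.sqrt N%:R * sin (x / Num.sqrt N%:R * S N w + phi))).
    have lin : is_derive x 1 (fun x : R => x / Num.sqrt N%:R * S N w + phi) (S N w / Num.sqrt N%:R).
      have H : is_derive x 1 (fun z : R => S N w / Num.sqrt N%:R * z + phi) (S N w / Num.sqrt N%:R * 1 + 0).
        exact: (is_deriveD (is_deriveZ (S N w / Num.sqrt N%:R) (is_derive_id x (1 : R))) (is_derive_cst phi x (1 : R))).
      rewrite mulr1 addr0 in H; rewrite (_ : (fun x0 : R => _) = (fun z : R => S N w / Num.sqrt N%:R * z + phi))//.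
      by apply/funext => z; ring.
    have := is_derive1_comp (is_derive_cos _) lin.
    by rewrite mulNr [sin _ * _]mulrC.
  have d2 := @is_derive_EL _ X (kern mu p) 0%N (iota 1 (m.+1 * N)) s0 _ (fun x w => - (S N w / Num.sqrt N%:R * sin (x / Num.sqrt N%:R * S N w + phi))) x d1.
  have d3 : is_derive x 1 (fun x : R => expR (x ^+ 2 * sig2 / 2)) (expR (x ^+ 2 * sig2 / 2) * (x * sig2)).
    have lin : is_derive x 1 (fun x : R => x ^+ 2 * sig2 / 2) (x * sig2).
      have H : is_derive x 1 (fun z : R => sig2 / 2 * (z * z)) (sig2 / 2 * (x * 1 + x * 1)).
        exact: (is_deriveZ (sig2 / 2) (is_deriveM (is_derive_id x (1 : R)) (is_derive_id x (1 : R)))).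
      rewrite (_ : (fun x0 : R => _) = (fun z : R => sig2 / 2 * (z * z))); last first.
        by apply/funext => z; ring.
      by rewrite (_ : x * sig2 = sig2 / 2 * (x * 1 + x * 1))//; field.
    exact: (is_derive1_comp (is_derive_expR _) lin).
  have := is_deriveM d2 d3; rewrite /GRing.scale/=.
  rewrite (_ : _ + _ = dh x)// /dh.
  rewrite (_ : EL _ _ _ _ (fun w => - _) = - EN N (fun w => S N w / Num.sqrt N%:R * sin (x / Num.sqrt N%:R * S N w + phi))).
    rewrite -/(trunc_ex _ _ _ _ _ _); ring.
  by rewrite -mulN1r /trunc_ex -ELZ; apply: eq_EL => w; rewrite mulN1r.
have h0 : h 0 = cos phi.
  rewrite /h (_ : 0 ^+ 2 * sig2 / 2 = 0); last ring.
  rewrite expR0 mulr1 (_ : (fun w => _) = (fun=> cos phi)).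
    exact: EL_cst.
  by apply/funext => w; rewrite mul0r mul0r add0r.
have hs : `|h s - cos phi| <= e.
  rewrite -h0.
  apply: le_trans (@mean_value_bound _ h dh 0 s (e / G * expR (A ^+ 2 * sig2 / 2)) hd _) _.
    move=> x xs; have xA : `|x| <= A.
      apply: le_trans sA.
      move: xs; have [s_0|s_0] := leP 0 s => /andP[x1 x2].
        by rewrite !ger0_norm.
      by rewrite (ltr0_norm s_0) ler0_norm// lerN2.
    rewrite /dh normrM normrN; apply: ler_pM => //; first exact: N1P.
    rewrite gtr0_norm ?expR_gt0// ler_expR !ler_wpM2r//.
    by rewrite -(real_normK (num_real x)) lerXn2r ?nnegrE.
  rewrite subr0 [leLHS](_ : _ = e / G * (expR (A ^+ 2 * sig2 / 2) * `|s|)); last ring.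
  rewrite -[leRHS](divfK (lt0r_neq0 G0)) ler_wpM2l ?divr_ge0 ?(ltW e0) ?(ltW G0)//.
  by rewrite /G ler_wpM2l ?expR_ge0// (le_trans sA)// lerDl.
have E0 : 0 <= expR (- (s ^+ 2 * sig2 / 2)) <= 1.
  by rewrite expR_ge0 -expR0 ler_expR oppr_le0 divr_ge0// mulr_ge0// sqr_ge0.
have -> : EN N (fun w => cos (s / Num.sqrt N%:R * S N w + phi)) = h s * expR (- (s ^+ 2 * sig2 / 2)).
  by rewrite /h -mulrA -expRD subrr expR0 mulr1.
case/andP: E0 => E0 E1; rewrite -mulrBl normrM (ger0_norm E0) -[leRHS]mulr1.
exact: ler_pM.
Qed.

End CentralLimit.

(** * Uniform phase gaps and decay of the characteristic function *)

Section TrigGap.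
Variable R : realType.

Lemma continuous_sumf (I : Type) (r : seq I) (f : I -> R -> R) :
  (forall i, continuous (f i)) -> continuous (fun x => \sum_(i <- r) f i x).
Proof.
by move=> cf x; apply: (cvg_big (op := +%R) add_continuous) => i _; exact: cf.
Qed.

Lemma cos_quadratic (x : R) : `|x| <= 1 -> x ^+ 2 / 8 <= 1 - cos x.
Proof.
move=> x1; pose y := x / 2.
have xE : x = y + y by rewrite /y -splitr.
have cE : 1 - cos x = 2 * sin y ^+ 2.
  have := cos2Dsin2 y; rewrite xE cosD -!expr2.
  by move: (cos y ^+ 2) (sin y ^+ 2) => A B; lra.
rewrite cE.
have yb : `|y| <= 1 / 2 by rewrite /y normrM [X in _ * X]gtr0_norm ?invr_gt0// ler_wpM2r.
have := sin_taylor 0 y; rewrite add0r sin0 subr0 cos0 mulr1 => sy.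
have y2 : y ^+ 2 = `|y| ^+ 2 by rewrite real_normK ?num_real.
have h1 : `|y| / 2 <= `|sin y|.
  have h : `|y| - `|sin y| <= `|y| ^+ 2.
    by rewrite -y2; apply: le_trans sy; rewrite distrC; exact: lerB_dist.
  have := normr_ge0 y; nra.
rewrite -[sin y ^+ 2](real_normK (num_real _)).
have h2 : (`|y| / 2) ^+ 2 <= `|sin y| ^+ 2.
  by rewrite lerXn2r ?nnegrE// divr_ge0.
rewrite (_ : x ^+ 2 / 8 = 2 * (`|y| / 2) ^+ 2); first by rewrite ler_wpM2l.
by rewrite expr_div_n -y2 xE; field.
Qed.

(** Near 0 a single pair with [f a != f b] gives a quadratic gap. Away from 0 the sum [G] of the
    gaps over all pairs is continuous and positive, hence bounded below on a compact interval, and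
    some pair contributes at least half its average share. The pair may depend on [t]. *)
Lemma cos_gap (X : finType) (f : X -> R) (T : R) : 0 < T ->
  (forall t, 0 < t <= T -> exists y1 y2, cos (t * (f y1 - f y2)) != 1) ->
  exists2 c, 0 < c & forall t, `|t| <= T ->
    exists y1 y2, c * t ^+ 2 <= 1 - cos (t * (f y1 - f y2)).
Proof.
move=> T0 gap.
have [a [b fab]] : exists a b, f a - f b != 0.
  have [|y1 [y2 h]] := gap T; first by rewrite T0 lexx.
  by exists y1, y2; apply: contra_neq h => ->; rewrite mulr0 cos0.
pose D := `|f a - f b|.
have D0 : 0 < D by rewrite normr_gt0.
pose G t := \sum_(z : X * X) (1 - cos (t * (f z.1 - f z.2))).
have term_ge0 t z : 0 <= 1 - cos (t * (f z.1 - f z.2)) by rewrite subr_ge0 cos_le1.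
have cG : continuous G.
  apply: continuous_sumf => z t; apply: cvgB; first exact: cvg_cst.
  by apply: continuous_comp; [exact: mulrr_continuous|exact: continuous_cos].
pose A := Num.min T D^-1.
have A0 : 0 < A by rewrite lt_min T0 invr_gt0.
have AT : A <= T by rewrite ge_min lexx.
have [t0 /itvP t0A t0min] := EVT_min AT (continuous_subspaceT cG).
have t00 : 0 < t0 <= T by rewrite (lt_le_trans A0) ?t0A.
have Gt0 : 0 < G t0.
  have [y1 [y2 h]] := gap _ t00.
  rewrite /G (bigD1 (y1, y2))//= ltr_pwDl//.
    by rewrite subr_gt0 lt_neqAle h cos_le1.
  by apply: sumr_ge0 => z _.
have [q [q0 qE]] : exists q : R, 0 < q /\ forall c : R, \sum_(z : X * X) c = q * c.
  exists (#|{: X * X}|%:R); split=> [|c]; last by rewrite sumr_const -[LHS]mulr_natl.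
  by rewrite ltr0n; apply/card_gt0P; exists (a, b).
pose n := 2 * q.
have n0 : 0 < n by rewrite mulr_gt0.
exists (Num.min (D ^+ 2 / 8) (G t0 / (n * T ^+ 2))).
  by rewrite lt_min !divr_gt0 ?exprn_gt0// mulr_gt0 ?exprn_gt0.
move=> t tT.
have nt y1 y2 : cos (t * (f y1 - f y2)) = cos (`|t| * (f y1 - f y2)).
  by case: ger0P => // _; rewrite mulNr cosN.
have [tA|At] := leP `|t| A.
  exists a, b; rewrite mulrC.
  apply: le_trans (cos_quadratic _); last first.
    rewrite normrM -/D -ler_pdivlMr// mul1r; apply: le_trans tA _.
    by rewrite ge_min lexx orbT.
  rewrite exprMn -[(f a - f b) ^+ 2](real_normK (num_real _)) -/D -[leRHS]mulrA.
  by rewrite ler_wpM2l ?sqr_ge0// ge_min lexx.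
have Gt : G t0 <= G `|t| by apply: t0min; rewrite in_itv/= (ltW At).
have [z hz] : exists z : X * X, G t0 / n <= 1 - cos (`|t| * (f z.1 - f z.2)).
  apply/not_existsP => H.
  have : G `|t| <= \sum_(z : X * X) G t0 / n.
    by apply: ler_sum => z _; rewrite leNgt; apply/negP => /ltW; exact: (H z).
  rewrite qE /n => /(le_trans Gt); apply/negP; rewrite -ltNge.
  rewrite (_ : q * _ = G t0 / 2); first by rewrite ltr_pdivrMr// ltr_pMr// ltr1n.
  by field; rewrite lt0r_neq0.
exists z.1, z.2; rewrite nt; apply: le_trans hz.
have t2 : t ^+ 2 <= T ^+ 2.
  by rewrite -(real_normK (num_real t)) lerXn2r ?nnegrE// ltW.
apply: (@le_trans _ _ (G t0 / (n * T ^+ 2) * T ^+ 2)).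
  apply: ler_pM => //; rewrite ?sqr_ge0// ?ge_min ?lexx ?orbT//.
  by rewrite le_min !divr_ge0 ?sqr_ge0 ?ltW// mulr_gt0 ?exprn_gt0.
by rewrite le_eqVlt; apply/orP; left; apply/eqP; field; rewrite !lt0r_neq0.
Qed.

Lemma common_positive_lower_bound (T : finType) (f : T -> R) :
  exists2 c, 0 < c <= 1 & forall x, 0 < f x -> c <= f x.
Proof.
exists (\big[Num.min/1]_(x | 0 < f x) f x).
  by rewrite lt_bigmin// ?ltr01//= bigmin_le_id.
by move=> x fx; exact: bigmin_le_cond.
Qed.

End TrigGap.

Section OverlapPaths.
Variables (R : realType) (X : finType) (q : X -> X -> R).
Hypothesis row : forall i j, 0 < \sum_k Num.min (q i k) (q j k).
Hypothesis col : forall i j, 0 < \sum_k Num.min (q k i) (q k j).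

(** [col] gives the common predecessor and [row] the common successor; [kap] is the square of a
    lower bound of all positive entries, hence uniform in the pair. *)
Lemma overlap_paths : exists2 kap, 0 < kap <= 1 & forall y1 y2, exists a0 z0,
  kap <= q a0 y1 * q y1 z0 /\ kap <= q a0 y2 * q y2 z0.
Proof.
have [c /andP[c0 c1] cP] := common_positive_lower_bound (fun z : X * X => q z.1 z.2).
have pick (g h : X -> R) : 0 < \sum_k Num.min (g k) (h k) -> exists k, 0 < g k /\ 0 < h k.
  move=> s0; apply/not_existsP => H; move: s0; apply/negP; rewrite -leNgt.
  apply: sumr_le0 => k _; rewrite ge_min.
  have [//|gk] := leP (g k) 0; have [//|hk] := leP (h k) 0.
  by case: (H k).
exists (c * c); first by rewrite mulr_gt0// mulr_ile1// ltW.
move=> y1 y2; have [a0 [a1 a2]] := pick _ _ (col y1 y2).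
have [z0 [z1 z2]] := pick _ _ (row y1 y2).
exists a0, z0; split; apply: ler_pM; rewrite ?(ltW c0)//.
- exact: (cP (a0, y1)).
- exact: (cP (y1, z0)).
- exact: (cP (a0, y2)).
- exact: (cP (y2, z0)).
Qed.

End OverlapPaths.

Section CharfunDecay.
Variables (R : realType) (d : measure_display) (Omega : measurableType d).
Variables (P : probability Omega R) (X : finType) (xi : nat -> Omega -> X).
Variables (mu : X -> R) (p : X -> X -> R).
Hypothesis chain : stationary_markov_chain P xi mu p.
Variables (k : nat) (rho kap : R).
Hypothesis rho01 : 0 < rho <= 1.
Hypothesis kap01 : 0 < kap <= 1.
Hypothesis pk : forall g, (k <= g)%N -> forall x y, rho <= pn p g x y.
Variables (m : nat) (F : m.+1.-tuple X -> R).
Hypothesis overlap : forall y1 y2, exists a0 z0,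
  kap <= pn p m.+1 a0 y1 * pn p m.+1 y1 z0 /\ kap <= pn p m.+1 a0 y2 * pn p m.+1 y2 z0.
Variable s0 : nat -> X.
Variable xs : m.-tuple X.
Let f y := F [tuple of rcons xs y].
Notation EN := (trunc_ex mu p m s0).

Lemma charfun_decay (T : R) : 0 < T ->
  (forall t, 0 < t <= T -> exists y1 y2, cos (t * (f y1 - f y2)) != 1) ->
  exists2 c, 0 < c & \forall N \near \oo, forall t phi, `|t| <= T ->
    `|EN N (fun w => cos (t * psum F N xpredT w + phi))| <= expR (- (c * N%:R * t ^+ 2)).
Proof.
move=> T0 /(cos_gap T0)[c c0 cP].
have [rho0 rho1] := andP rho01; have [kap0 kap1] := andP kap01.
pose D := (2 * m.+1 * k.+2)%N.
have D0 : (0 < D)%N by rewrite !muln_gt0.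
pose c' := rho * kap / 2 * c * rho ^+ m.
have c'0 : 0 < c' by rewrite !mulr_gt0 ?exprn_gt0.
exists (c' / (2 * D)%:R); first by rewrite divr_gt0// ltr0n muln_gt0.
exists D => // N /= DN t phi tT.
have [y1 [y2 cy]] := cP t tT; have [a0 [z0 [k1 k2]]] := overlap y1 y2.
(* The last [r] terms are used. [N %/ m.+1] of them would respect [m * N <= m.+1 * n1]; the factor 2
   leaves [0 < n1] even for [m = 0]. *)
pose r := (N %/ (2 * m.+1))%N; pose Qb := (r %/ k.+2)%N; pose n1 := (N - r)%N.
have QbE : Qb = (N %/ D)%N by rewrite /Qb /r -divnMA.
have rN : (r * (2 * m.+1) <= N)%N := leq_trunc_div _ _.
have QN : (Qb * k.+2 <= r)%N := leq_trunc_div _ _.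
have NE : N = (n1 + (Qb * k.+2 + (r - Qb * k.+2)))%N.
  by rewrite subnKC// subnK//; apply: leq_trans rN; exact: leq_pmulr.
have N0 : (0 < N)%N := leq_trans D0 DN.
have h1 : (0 < n1)%N by rewrite subn_gt0 ltn_Pdiv// leq_pmulr.
have mr : (m.+1 * r <= N)%N by apply: leq_trans rN; rewrite mulnC leq_mul2l leq_pmull ?orbT.
have h2 : (m * N <= m.+1 * n1)%N by rewrite mulnBr [(m.+1 * N)%N]mulSn leq_subRL ?leq_add2r// (leq_trans mr)// leq_addr.
have h3 : (n1 + Qb * k.+2 <= N)%N by rewrite [leqRHS]NE leq_add2l leq_addr.
have ab : cos phi ^+ 2 + sin phi ^+ 2 = 1 :> R by rewrite cos2Dsin2.
have -> : (fun w => cos (t * psum F N xpredT w + phi)) =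
    (fun w => cos phi * cos (t * psum F N xpredT w) - sin phi * sin (t * psum F N xpredT w)).
  by apply/funext => w; rewrite cosD [cos _ * cos phi]mulrC [sin _ * sin phi]mulrC.
apply: le_trans (@decay_bound _ _ _ _ _ _ _ _ chain k rho kap rho01 kap01 pk m F s0 N n1 Qb h1 h2 h3 xs y1 y2 a0 z0 k1 k2 t _ _ _ NE ab) _.
set u := 1 - cos _ in cy *.
have u2 : u <= 2 by rewrite /u lerBlDr -lerBlDl (_ : 1 - 2 = -1) ?cos_geN1//; ring.
have u0 : 0 <= u by rewrite subr_ge0 cos_le1.
have rm1 : rho ^+ m <= 1 by rewrite exprn_ile1// ltW.
have rm0 : 0 < rho ^+ m by rewrite exprn_gt0.
set z := rho * kap / 2 * u * rho ^+ m.
have z1 : z <= 1.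
  rewrite /z -[leRHS](mulr1 1); apply: ler_pM => //; rewrite ?(ltW rm0)//.
    by rewrite !mulr_ge0// ltW.
  rewrite (_ : _ * u = rho * kap * (u / 2)); last ring.
  rewrite mulr_ile1 ?mulr_ge0 ?(ltW rho0) ?(ltW kap0)//.
    by rewrite mulr_ile1 ?(ltW rho0) ?(ltW kap0).
  by rewrite ler_pdivrMr// mul1r.
have zc : c' * t ^+ 2 <= z.
  rewrite /z /c' (_ : _ * t ^+ 2 = rho * kap / 2 * (c * t ^+ 2) * rho ^+ m); last ring.
  by rewrite ler_wpM2r ?(ltW rm0)// ler_wpM2l// !mulr_ge0// ltW.
(* The 2 absorbs the rounding of [N %/ D], as [D <= N]. *)
have Q2 : N%:R / (2 * D)%:R <= Qb%:R :> R.
  rewrite ler_pdivrMr ?ltr0n ?muln_gt0// -natrM ler_nat QbE.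
  apply: leq_trans (ltnW (ltn_ceil N D0)) _; rewrite mulnA leq_mul2r; apply/orP; right.
  by rewrite muln2 -addnn -addn1 leq_add2l divn_gt0.
apply: (@le_trans _ _ (expR (- z) ^+ Qb)).
  rewrite lerXn2r ?nnegrE ?expR_ge0 ?subr_ge0//.
  exact: expR_ge1Dx.
rewrite -expRM_natl ler_expR mulrN lerN2.
apply: le_trans (ler_wpM2l (ler0n _ Qb) zc).
have shuffle (x y z' w : R) : x / y * z' * w = z' / y * (x * w) by ring.
rewrite shuffle.
by rewrite ler_wpM2r// mulr_ge0 ?sqr_ge0// ltW.
Qed.

End CharfunDecay.

Section MarkovChainDecay.
Variables (R : realType) (d : measure_display) (Omega : measurableType d).
Variables (P : probability Omega R) (X : finType) (xi : nat -> Omega -> X).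
Variables (mu : X -> R) (p : X -> X -> R).
Hypothesis chain : stationary_markov_chain P xi mu p.
Variables (m : nat) (F : m.+1.-tuple X -> R).
Hypothesis positive_power : exists k : nat, forall i j, 0 < trans_prob p k i j.
Hypothesis row_overlap : forall i j, 0 < \sum_(k : X)
     Num.min (trans_prob p m.+1 i k) (trans_prob p m.+1 j k).
Hypothesis col_overlap : forall i j, 0 < \sum_(k : X)
     Num.min (trans_prob p m.+1 k i) (trans_prob p m.+1 k j).
Variable s0 : nat -> X.

Lemma chain_charfun_decay (xs : m.-tuple X) (T : R) : 0 < T ->
  (forall t, 0 < t <= T -> exists y1 y2,
     cos (t * (F [tuple of rcons xs y1] - F [tuple of rcons xs y2])) != 1) ->
  exists2 c, 0 < c & \forall N \near \oo, forall t phi, `|t| <= T ->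
    `|trunc_ex mu p m s0 N (fun w => cos (t * psum F N xpredT w + phi))| <=
      expR (- (c * N%:R * t ^+ 2)).
Proof.
have [k kpos] := positive_power.
have pnpos i j : 0 < pn p k i j by rewrite -trans_probE.
have [rho rho01 pk] := pn_lower_bound (stochastic_p chain) pnpos.
have qE i j : trans_prob p m.+1 i j = pn p m.+1 i j by rewrite trans_probE.
have [kap kap01 ov] := overlap_paths row_overlap col_overlap.
apply: (charfun_decay chain rho01 kap01 pk) => y1 y2.
by have [a0 [z0 []]] := ov y1 y2; rewrite !qE => h1 h2; exists a0, z0.
Qed.

End MarkovChainDecay.

(** * Laws with finitely many atoms and the law of the sum *)

Definition finite_law (R : realType) (L : seq (R * R)) : Prop :=
  (forall z, z \in L -> 0 <= z.1) /\ \sum_(z <- L) z.1 = 1.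

Definition law_mean (R : realType) (L : seq (R * R)) (f : R -> R) : R :=
  \sum_(z <- L) z.1 * f z.2.

(** The law of [S] as a list of weighted atoms frees the Fourier part from the chain. The lattice
    case uses that the atoms are values of [S]. *)
Lemma EL_law (R : realType) (X : finType) (k : nat -> nat -> X -> X -> R) u s0 V
    (S : (nat -> X) -> R) : stochastics k ->
  exists L : seq (R * R), [/\ finite_law L, forall z, z \in L -> exists s, z.2 = S s &
    forall f, EL k u V s0 (fun s => f (S s)) = law_mean L f].
Proof.
move=> sk; elim: V u s0 => [|v V IH] u s0 /=.
  exists [:: (1, S s0)]; split.
  - by split=> [z|]; rewrite ?big_seq1// inE => /eqP->.
  - by move=> z; rewrite inE => /eqP ->; exists s0.
  - by move=> f; rewrite /law_mean big_seq1 mul1r.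
have [L LP] := choice (fun y => IH v (upd s0 v y)).
have [k0 k1] := sk u v.
pose T := [seq (k u v (s0 u) y * z.1, z.2) | y <- index_enum X, z <- L y].
have TP z : z \in T -> exists y z', z' \in L y /\ z = (k u v (s0 u) y * z'.1, z'.2).
  by move=> /allpairsPdep[y [z' [_ zL ->]]]; exists y, z'.
have TS f : law_mean T f = \sum_y k u v (s0 u) y * law_mean (L y) f.
  rewrite /law_mean big_allpairs_dep/=; apply: eq_bigr => y _.
  by rewrite mulr_sumr; apply: eq_bigr => z _; rewrite mulrA.
exists T; split.
- split=> [z /TP[y [z' [zL ->]]]|] /=.
    by case: (LP y) => -[/(_ z' zL) z0 _] _ _; rewrite mulr_ge0.
  have mean1 L' : law_mean L' (fun=> 1) = \sum_(z <- L') z.1 by apply: eq_bigr => z _; rewrite mulr1.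
  rewrite -mean1 TS -[RHS](k1 (s0 u)); apply: eq_bigr => y _; case: (LP y) => -[_ Ly] _ _.
  by rewrite mean1 Ly mulr1.
- by move=> z /TP[y [z' [zL ->]]]; case: (LP y) => _ /(_ z' zL).
- by move=> f; rewrite TS; apply: eq_bigr => y _; case: (LP y) => _ _ ->.
Qed.

Section SumLaw.
Variables (R : realType) (d : measure_display) (Omega : measurableType d).
Variables (P : probability Omega R) (X : finType) (xi : nat -> Omega -> X).
Variables (mu : X -> R) (p : X -> X -> R).
Hypothesis chain : stationary_markov_chain P xi mu p.
Variables (m : nat) (F : m.+1.-tuple X -> R) (s0 : nat -> X).
Notation EN := (trunc_ex mu p m s0).
Let S N := psum F N xpredT.

Lemma expectation_nonconv_sum N (f : R -> R) :
  'E_P[fun w => f (nonconv_sum xi F N w)]%E = (EN N (fun s => f (S N s)))%:E.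
Proof.
have dS : dep [pred i | 0 < i <= m.+1 * N]%N (fun s => f (S N s)).
  by move=> s s' ss'; rewrite /S (@dep_psum_N _ _ _ F N xpredT s s' ss').
rewrite (trunc_exE s0 chain)// /ex (_ : (fun w => f (nonconv_sum xi F N w)) =
  (fun w => (fun s => f (S N s)) (xi^~ w))); last first.
  by apply/funext => w; rewrite nonconv_sumE.
have := @expectation_path _ _ _ _ _ _ _ _ chain (m.+1 * N)%N (fun s => f (S N s)).
by move=> ->//; apply: dep_sub dS => i /= /andP[].
Qed.

Lemma variance_nonconv_sum N :
  fine 'V_P[nonconv_sum xi F N]%E = second_moment P xi F N - EN N (S N) ^+ 2.
Proof.
have H1 : 'E_P[nonconv_sum xi F N]%E = (EN N (S N))%:E := expectation_nonconv_sum N id.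
have H2 := expectation_nonconv_sum N (fun x => (x - EN N (S N)) ^+ 2).
have -> : 'V_P[nonconv_sum xi F N]%E =
    'E_P[fun w => ((nonconv_sum xi F N w - EN N (S N)) ^+ 2)%R]%E.
  by rewrite /variance unlock H1.
rewrite H2 /second_moment -(@trunc_exE _ _ mu p m s0 N _ _ _ _ _ chain); last first.
  by move=> s s' ss'; congr (_ ^+ 2); apply: (@dep_psum_N _ _ _ F N xpredT) ss'.
rewrite /= /trunc_ex.
set e := EL _ _ _ _ (S N).
transitivity (EL (kern mu p) 0 (iota 1 (m.+1 * N)) s0 (fun s => psum F N xpredT s ^+ 2 + (- (2 * e) * S N s + e ^+ 2))).
  by apply: eq_EL => s; rewrite /S; ring.
rewrite ELD ELD ELZ EL_cst; last exact: stochastic_kern chain.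
by rewrite -/e; ring.
Qed.

Variables (C th : R).
Hypothesis C0 : 0 <= C.
Hypothesis th01 : 0 < th < 1.
Hypothesis mix : forall n x, \sum_y `|pn p n x y - mu y| <= C * th ^+ n.
Variable M : R.
Hypothesis FM : forall t, `|F t| <= M.
Hypothesis Fc : pmf_int (@pmf_pow R X mu m.+1) F = 0.
Let sig2 : R := limn (fun N => second_moment P xi F N / N%:R).

Lemma cvg_sig2 : second_moment P xi F N / N%:R @[N --> \oo] --> sig2.
Proof. exact: (cvg_second_moment chain C0 th01 mix FM Fc s0). Qed.

Lemma sig2_ge0 : 0 <= sig2.
Proof.
apply: limr_ge; first exact: cvg_sig2.
near=> N; rewrite divr_ge0// /second_moment -(@trunc_exE _ _ mu p m s0 N _ _ _ _ _ chain).
  rewrite /trunc_ex -(EL_cst 0%N (iota 1 (m.+1 * N)) s0 0 (stochastic_kern chain)).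
  by apply: EL_le => [|s]; [exact: stochastic_kern chain|exact: sqr_ge0].
by move=> s s' ss'; congr (_ ^+ 2); apply: (@dep_psum_N _ _ _ F N xpredT) ss'.
Unshelve. all: end_near. Qed.

(** The means of the sums stay bounded by [mean_bound], so variance and second moment have the same
    growth rate. *)
Lemma asymp_stddevE : asymp_stddev P (nonconv_sum xi F) = Num.sqrt sig2.
Proof.
congr Num.sqrt; apply: cvg_lim => //.
rewrite (_ : (fun N => _) = (fun N => second_moment P xi F N / N%:R - EN N (S N) ^+ 2 / N%:R)); last first.
  by apply/funext => N; rewrite variance_nonconv_sum mulrBl.
rewrite -[X in _ --> X]subr0; apply: cvgB; first exact: cvg_sig2.
pose B := (M * m.+1%:R * mixtotal X C th) ^+ 2.
apply: (@squeeze_cvgr _ _ _ _ (fun=> 0) (fun N => B / N%:R)).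
- near=> N; rewrite divr_ge0 ?sqr_ge0//= ler_wpM2r ?invr_ge0//.
  rewrite -(real_normK (num_real _)) lerXn2r ?nnegrE//; last first.
    exact: (mean_bound chain C0 th01 mix FM Fc).
  by apply: le_trans (normr_ge0 (EN N (S N))) _; exact: (mean_bound chain C0 th01 mix FM Fc).
- exact: cvg_cst.
- rewrite -[X in _ --> X](mulr0 B); apply: cvgMr.
  by rewrite -(cvg_shiftS (fun N => N%:R^-1 : R)); exact: cvg_harmonic.
Unshelve. all: end_near. Qed.

(** At [t = 1 / sqrt N] the decay bound is [expR (- c)], a constant below 1, whereas for [sig2 = 0]
    the characteristic function would tend to 1 there. *)
Lemma sig2_gt0 (T c : R) : 0 < T -> 0 < c ->
  (\forall N \near \oo, forall t phi, `|t| <= T ->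
    `|EN N (fun w => cos (t * S N w + phi))| <= expR (- (c * N%:R * t ^+ 2))) -> 0 < sig2.
Proof.
move=> T0 c0 decay; rewrite lt_neqAle sig2_ge0 andbT; apply/negP => /eqP sig0.
have c1 : expR (- c) < 1 by rewrite -expR0 ltr_expR oppr_lt0.
have e0 : 0 < (1 - expR (- c)) / 2 by rewrite divr_gt0// subr_gt0.
have clt := charfun_cvg chain C0 th01 mix FM Fc s0 sig2_ge0 cvg_sig2 ler01 e0.
have [N1 _ P1] := decay; have [N2 _ P2] := clt.
have [N3 _ P3] : \forall N \near \oo, (T^-1) ^+ 2 <= N%:R :> R by exact: nbhs_infty_ger.
pose N := (maxn N1 (maxn N2 N3)).+1.
have N0 : 0 < N%:R :> R by rewrite ltr0n.
have rN0 : 0 < Num.sqrt N%:R :> R by rewrite sqrtr_gt0.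
pose t : R := 1 / Num.sqrt N%:R.
have [N1N N2N N3N] : [/\ (N1 <= N)%N, (N2 <= N)%N & (N3 <= N)%N].
  by rewrite /N; split; apply: leqW; rewrite !leq_max leqnn ?orbT.
have tT : `|t| <= T.
  rewrite /t mul1r gtr0_norm ?invr_gt0// -[T]invrK lef_pV2 ?posrE ?invr_gt0//.
  rewrite -[leLHS]ger0_norm ?invr_ge0 ?(ltW T0)// -sqrtr_sqr ler_sqrt ?(ltW N0)//.
  exact: P3.
have := P1 N N1N t 0 tT; rewrite (_ : _ * t ^+ 2 = c); last first.
  by rewrite /t mul1r exprVn sqr_sqrtr ?(ltW N0)// mulfK// lt0r_neq0.
have := P2 N N2N 1 0; rewrite normr1 lexx -sig0 mulr0 mul0r oppr0 expR0 cos0 mulr1 => H1 H2.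
move: (H1 isT) => {}H1.
by move: H1 H2; rewrite !ler_norml => /andP[h1 _] /andP[_ h2]; lra.
Qed.

End SumLaw.

(** * The Gaussian Fourier transform *)

Section RealCalculus.
Variable R : realType.
Implicit Types (f g : R -> R) (x a b c : R).

Lemma cts_comp f g : continuous g -> continuous f -> continuous (fun x => g (f x)).
Proof. by move=> cg cf x; apply: (continuous_comp (cf x)); exact: cg. Qed.

Lemma cts_cst c : continuous (fun _ : R => c).
Proof. exact: cst_continuous. Qed.

Lemma cts_id : continuous (fun x : R => x).
Proof. by move=> x; exact: cvg_id. Qed.

Lemma ctsD f g : continuous f -> continuous g -> continuous (fun x => f x + g x).
Proof. by move=> cf cg x; apply: cvgD; [exact: cf|exact: cg]. Qed.

Lemma ctsN f : continuous f -> continuous (fun x => - f x).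
Proof. by move=> cf x; apply: cvgN; exact: cf. Qed.

Lemma ctsM f g : continuous f -> continuous g -> continuous (fun x => f x * g x).
Proof. by move=> cf cg x; apply: cvgM; [exact: cf|exact: cg]. Qed.

Lemma ctsX f n : continuous f -> continuous (fun x => f x ^+ n).
Proof. by move=> cf; apply: (cts_comp (g := fun y => y ^+ n)) => //; exact: exprn_continuous. Qed.

Lemma cts_cos f : continuous f -> continuous (fun x => cos (f x)).
Proof. by move=> cf; apply: (cts_comp _ cf); exact: continuous_cos. Qed.

Lemma cts_sin f : continuous f -> continuous (fun x => sin (f x)).
Proof. by move=> cf; apply: (cts_comp _ cf); exact: continuous_sin. Qed.

Lemma cts_exp f : continuous f -> continuous (fun x => expR (f x)).
Proof. by move=> cf; apply: (cts_comp _ cf); exact: continuous_expR. Qed.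

Lemma cts_norm f : continuous f -> continuous (fun x => `|f x|).
Proof. by move=> cf; apply: (cts_comp _ cf); exact: norm_continuous. Qed.

Lemma cts_lipschitz f K : (forall x y, `|f x - f y| <= K * `|x - y|) -> continuous f.
Proof.
move=> fK x; apply/cvgrPdist_le => e e0.
have K1 : 0 < `|K| + 1 by rewrite ltr_wpDl.
near=> y; apply: le_trans (fK x y) _.
have : `|x - y| <= e / (`|K| + 1).
  by near: y; apply: cvgr_dist_le; [exact: cvg_id|exact: divr_gt0].
rewrite ler_pdivlMr// => H; apply: le_trans H; rewrite mulrC ler_wpM2l//.
by apply: le_trans (ler_norm _) _; rewrite lerDl.
Unshelve. all: end_near. Qed.

(* [is_derive] is a type class, whose instance search interferes with explicit side goals. *)
Definition has_der f x a : Prop := is_derive x 1 f a.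

Lemma der_eq f x a b : has_der f x a -> a = b -> has_der f x b.
Proof. by move=> df <-. Qed.

Lemma derD f g x a b : has_der f x a -> has_der g x b -> has_der (fun x => f x + g x) x (a + b).
Proof. by rewrite /has_der => df dg; exact: (is_deriveD df dg). Qed.

Lemma derN f x a : has_der f x a -> has_der (fun x => - f x) x (- a).
Proof. by rewrite /has_der => df; exact: (is_deriveN df). Qed.

Lemma derM f g x a b : has_der f x a -> has_der g x b ->
  has_der (fun x => f x * g x) x (a * g x + f x * b).
Proof.
rewrite /has_der => df dg; apply: is_derive_eq (is_deriveM df dg) _.
by rewrite /GRing.scale/= addrC mulrC.
Qed.

Lemma der_id x : has_der (fun x : R => x) x 1.
Proof. exact: is_derive_id. Qed.

Lemma der_cst x c : has_der (fun _ : R => c) x 0.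
Proof. exact: is_derive_cst. Qed.

Lemma der_cos f x a : has_der f x a -> has_der (fun x => cos (f x)) x (- sin (f x) * a).
Proof. by rewrite /has_der => df; exact: (is_derive1_comp (is_derive_cos _) df). Qed.

Lemma der_sin f x a : has_der f x a -> has_der (fun x => sin (f x)) x (cos (f x) * a).
Proof. by rewrite /has_der => df; exact: (is_derive1_comp (is_derive_sin _) df). Qed.

Lemma der_exp f x a : has_der f x a -> has_der (fun x => expR (f x)) x (expR (f x) * a).
Proof. by rewrite /has_der => df; exact: (is_derive1_comp (is_derive_expR _) df). Qed.

Lemma der_sqr f x a : has_der f x a -> has_der (fun x => f x ^+ 2) x (2 * f x * a).
Proof. by move=> df; apply: der_eq (derM df df) _; ring. Qed.

Lemma der_cts f x a : has_der f x a -> {for x, continuous f}.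
Proof.
by rewrite /has_der => df; apply: differentiable_continuous; apply/derivable1_diffP.
Qed.

End RealCalculus.

Ltac cts_tac := repeat first
  [ assumption
  | lazymatch goal with
    | |- continuous (fun x => x) => exact: cts_id
    | |- continuous (fun _ => ?c) => exact: cts_cst
    | |- continuous (fun x => @?f x + @?g x) => apply: (@ctsD _ f g)
    | |- continuous (fun x => - @?f x) => apply: (@ctsN _ f)
    | |- continuous (fun x => @?f x * @?g x) => apply: (@ctsM _ f g)
    | |- continuous (fun x => @?f x ^+ ?n) => apply: (@ctsX _ f n)
    | |- continuous (fun x => cos (@?f x)) => apply: (@cts_cos _ f)
    | |- continuous (fun x => sin (@?f x)) => apply: (@cts_sin _ f)
    | |- continuous (fun x => expR (@?f x)) => apply: (@cts_exp _ f)
    | |- continuous (fun x => `|@?f x|) => apply: (@cts_norm _ f)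
    end].

Ltac der_tac := repeat first
  [ match goal with H : has_der _ _ _ |- _ => exact H end
  | lazymatch goal with
    | |- has_der (fun x => x) _ _ => exact: der_id
    | |- has_der (fun _ => ?c) _ _ => exact: der_cst
    | |- has_der (fun x => @?f x + @?g x) _ _ => apply: (@derD _ f g)
    | |- has_der (fun x => - @?f x) _ _ => apply: (@derN _ f)
    | |- has_der (fun x => @?f x * @?g x) _ _ => apply: (@derM _ f g)
    | |- has_der (fun x => @?f x ^+ 2) _ _ => apply: (@der_sqr _ f)
    | |- has_der (fun x => cos (@?f x)) _ _ => apply: (@der_cos _ f)
    | |- has_der (fun x => sin (@?f x)) _ _ => apply: (@der_sin _ f)
    | |- has_der (fun x => expR (@?f x)) _ _ => apply: (@der_exp _ f)
    end].

(** * Integrals of continuous functions over segments *)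

Section IntervalIntegral.
Variable R : realType.
Implicit Types (f g F : R -> R) (a b c k : R).

Definition iint a b f : R := (\int[@lebesgue_measure R]_(x in `[a, b]) f x)%R.

Lemma cts_integrable a b f : continuous f ->
  (@lebesgue_measure R).-integrable `[a, b] (EFin \o f).
Proof.
move=> cf; apply: continuous_compact_integrable; first exact: segment_compact.
exact: continuous_subspaceT.
Qed.

Lemma eq_iint a b f g : (forall x, a <= x <= b -> f x = g x) -> iint a b f = iint a b g.
Proof. by move=> fg; apply: eq_Rintegral => x; rewrite inE/= in_itv/=; exact: fg. Qed.

Lemma iintD a b f g : continuous f -> continuous g ->
  iint a b (fun x => f x + g x) = iint a b f + iint a b g.
Proof. by move=> cf cg; apply: RintegralD => //; exact: cts_integrable. Qed.

Lemma iintB a b f g : continuous f -> continuous g ->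
  iint a b (fun x => f x - g x) = iint a b f - iint a b g.
Proof. by move=> cf cg; apply: RintegralB => //; exact: cts_integrable. Qed.

Lemma iintZ a b k f : continuous f -> iint a b (fun x => k * f x) = k * iint a b f.
Proof. by move=> cf; apply: RintegralZl => //; exact: cts_integrable. Qed.

Lemma iint_cst a b k : a <= b -> iint a b (fun=> k) = k * (b - a).
Proof.
move=> ab; rewrite /iint Rintegral_cst//= lebesgue_measure_itv/= lte_fin.
by move: ab; rewrite le_eqVlt => /predU1P[->|->]; rewrite ?ltxx ?subrr.
Qed.

Lemma iint_sum (I : Type) (r : seq I) a b (f : I -> R -> R) : (forall i, continuous (f i)) ->
  iint a b (fun x => \sum_(i <- r) f i x) = \sum_(i <- r) iint a b (f i).
Proof.
move=> cf; elim: r => [|i r IH].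
  rewrite big_nil -[RHS](mul0r (iint a b (fun=> 0))) -iintZ; last exact: cts_cst.
  by apply: eq_iint => x _; rewrite big_nil mul0r.
rewrite big_cons -IH -iintD//; last exact: continuous_sumf.
by apply: eq_iint => x _; rewrite big_cons.
Qed.

Lemma le_iint a b f g : continuous f -> continuous g ->
  (forall x, a <= x <= b -> f x <= g x) -> iint a b f <= iint a b g.
Proof.
move=> cf cg fg.
apply: (le_Rintegral _ (@cts_integrable a b f cf) (@cts_integrable a b g cg)) => //.
Qed.

Lemma iint_norm a b f g : continuous f -> continuous g ->
  (forall x, a <= x <= b -> `|f x| <= g x) -> `|iint a b f| <= iint a b g.
Proof.
move=> cf cg fg; apply: (@le_trans _ _ (iint a b (fun x => `|f x|))).
  by apply: le_normr_Rintegral => //; exact: cts_integrable.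
by apply: le_iint => //; cts_tac.
Qed.

Lemma iint_norm_cst a b f k : a <= b -> continuous f ->
  (forall x, a <= x <= b -> `|f x| <= k) -> `|iint a b f| <= k * (b - a).
Proof.
by move=> ab cf fk; rewrite -iint_cst//; apply: iint_norm => //; exact: cts_cst.
Qed.

Lemma iint_split a b c f : a <= b -> b <= c -> continuous f ->
  iint a c f = iint a b f + iint b c f.
Proof.
move=> ab bc cf.
have := @Rintegral_itvB R f (BLeft a) (BRight c) b (@cts_integrable a c f cf).
rewrite !bnd_simp => /(_ ab bc).
rewrite Rintegral_itv_obnd_cbnd; last first.
  by apply: integrableS (@cts_integrable b c _ cf) => //; apply: subset_itvr; rewrite bnd_simp.
by rewrite /iint => <-; rewrite addrC subrK.
Qed.

Lemma iint_ftc a b F f : a <= b -> continuous f ->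
  (forall x, a <= x <= b -> has_der F x (f x)) -> iint a b f = F b - F a.
Proof.
move=> ab cf dF; have := ab; rewrite le_eqVlt => /predU1P[ab'|ab'].
  by rewrite -ab' /iint set_itv1 Rintegral_set1 subrr.
have itv x : x \in `]a, b[ -> a <= x <= b.
  by rewrite in_itv/= => /andP[ax xb]; rewrite !ltW.
have cF x : a <= x <= b -> {for x, continuous F} by move=> /dF; exact: der_cts.
rewrite /iint /Rintegral (@continuous_FTC2 _ f F a b ab')//.
- exact: continuous_subspaceT.
- split.
  + by move=> x /itv/dF[].
  + by apply: cvg_at_right_filter; apply: cF; rewrite lexx.
  + by apply: cvg_at_left_filter; apply: cF; rewrite lexx ab.
- by move=> x /itv/dF [_ <-]; rewrite derive1E.
Qed.

Lemma iint_primitive a x f : a < x -> continuous f ->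
  has_der (fun y => iint a y f) x (f x).
Proof.
move=> ax cf; have [] := @continuous_FTC1_closed R f a x (x + 1) _ (@cts_integrable a (x + 1) f cf) ax (cf x).
  by rewrite ltrDl.
by rewrite derive1E => d1 d2; apply: DeriveDef.
Qed.

Lemma iint_scale A k f : 0 <= A -> 0 < k -> continuous f ->
  iint 0 A (fun x => f (k * x)) = k^-1 * iint 0 (k * A) f.
Proof.
move=> A0 k0 cf; pose G x := iint (-1) x f.
have dG (x : R) : 0 <= x -> has_der G x (f x).
  by move=> x0; apply: iint_primitive => //; rewrite (lt_le_trans _ x0)// oppr_lt0.
have kA : 0 <= k * A by rewrite mulr_ge0// ltW.
have ck : continuous (fun x : R => k * x) by cts_tac.
have cfk := cts_comp cf ck.
have dG' x : 0 <= x <= k * A -> has_der G x (f x) by move=> /andP[x0 _]; exact: dG.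
have dGk (x : R) : 0 <= x <= A -> has_der (fun x => k^-1 * G (k * x)) x (f (k * x)).
  move=> /andP[x0 _].
  have dk : has_der (fun x => k * x) x k by apply: der_eq; [der_tac|rewrite /=; ring].
  have kx : 0 <= k * x by rewrite mulr_ge0// ltW.
  have d1 := is_derive1_comp (dG _ kx) dk.
  apply: der_eq (derM (der_cst x k^-1) d1) _.
  by field; rewrite lt0r_neq0.
by rewrite (iint_ftc A0 cfk dGk) (iint_ftc kA cf dG') mulr0 mulrBr.
Qed.

End IntervalIntegral.

(** For [s >= A >= 1] one has [s ^+ 2 >= s], which leaves an exponential with an explicit
    primitive. *)
Lemma gauss_tail (R : realType) (c A B : R) : 0 < c -> 1 <= A -> A <= B ->
  iint A B (fun s => expR (- (c * s ^+ 2))) <= expR (- (c * A)) / c.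
Proof.
move=> c0 A1 AB.
apply: (@le_trans _ _ (iint A B (fun s => expR (- (c * s))))).
  apply: le_iint => [||s /andP[As sB]]; [by cts_tac|by cts_tac|].
  rewrite ler_expR lerN2 ler_pM2l// expr2 ler_peMr//.
    by rewrite (le_trans _ As)// (le_trans _ A1).
  exact: le_trans As.
have c1 : continuous (fun s : R => expR (- (c * s))) by cts_tac.
have d1 (x : R) : A <= x <= B -> has_der (fun s => - (expR (- (c * s)) / c)) x (expR (- (c * x))).
  by move=> _; apply: der_eq; [der_tac|rewrite /=; field; rewrite lt0r_neq0].
rewrite (iint_ftc AB c1 d1).
by rewrite opprK gerDr oppr_le0 divr_ge0 ?expR_ge0 ?ltW.
Qed.

Section GaussianTransform.
Variables (R : realType) (v : R).
Hypothesis v0 : 0 < v.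

Definition gker (s : R) : R := expR (- (s ^+ 2 * v / 2)).

Definition psi (A y : R) : R := iint 0 A (fun s => cos (s * y) * gker s).

Lemma gker_ge0 s : 0 <= gker s. Proof. exact: expR_ge0. Qed.

Lemma gker_le1 s : gker s <= 1.
Proof.
by rewrite /gker -expR0 ler_expR oppr_le0 divr_ge0// mulr_ge0 ?sqr_ge0 ?(ltW v0).
Qed.

Lemma cts_gker : continuous gker.
Proof. by rewrite /gker; cts_tac. Qed.

Lemma psi_derive (A y : R) : has_der (psi A) y (iint 0 A (fun s => - (s * sin (s * y)) * gker s)).
Proof.
pose f (y s : R) := cos (s * y) * gker s.
have cg := cts_gker.
have cf z : continuous (f z) by rewrite /f; cts_tac.
have df (z s : R) : has_der (f ^~ s) z (- (s * sin (s * z)) * gker s).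
  by apply: der_eq; [rewrite /f; der_tac|rewrite /=; ring].
have d1 z s : partial1of2 f z s = - (s * sin (s * z)) * gker s.
  by rewrite partial1of2E; have [_ ->] := df z s.
have yI : [set` `]y - 1, y + 1[] y by rewrite /= in_itv/=; apply/andP; split; lra.
have mI : measurable `[(0:R), A] by [].
have iG : (@lebesgue_measure R).-integrable `[0, A] (EFin \o (fun=> `|A|)).
  by apply: cts_integrable; cts_tac.
have bnd x s : [set` `]y - 1, y + 1[] x -> [set` `[0, A]] s -> `|partial1of2 f x s| <= `|A|.
  move=> _ /=; rewrite in_itv/= => /andP[s0 sA]; rewrite d1 normrM normrN normrM.
  rewrite -[leRHS]mulr1; apply: ler_pM => //.
    rewrite -[leRHS]mulr1; apply: ler_pM => //; first by rewrite !ger0_norm// (le_trans s0).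
    by rewrite ler_norml sin_geN1 sin_le1.
  by rewrite ger0_norm ?gker_ge0 ?gker_le1.
have intf x : [set` `]y - 1, y + 1[] x -> (@lebesgue_measure R).-integrable `[0, A] (EFin \o f x).
  by move=> _; exact: cts_integrable.
have derf x s : [set` `]y - 1, y + 1[] x -> [set` `[0, A]] s -> derivable (f ^~ s) x 1.
  by move=> _ _; have [] := df x s.
have := @derivable_under_integral R _ _ (@lebesgue_measure R) f _ mI y _ _ yI intf derf _ (fun=> normr_ge0 _) iG bnd.
have := @differentiation_under_integral R _ _ (@lebesgue_measure R) f _ mI y _ _ yI intf derf _ (fun=> normr_ge0 _) iG bnd.
rewrite derive1E => e1 e2; apply: DeriveDef => //; rewrite e1.
by apply: eq_Rintegral => s _; rewrite d1.
Qed.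

(* Integration by parts turns the derivative of [psi A] into [- y / v * psi A y], up to a boundary
   term: this is the differential equation of the Gaussian density. *)
Lemma psi_ode (A y : R) : 0 <= A ->
  iint 0 A (fun s => - (s * sin (s * y)) * gker s) = (sin (A * y) * gker A - y * psi A y) / v.
Proof.
move=> A0; have cg := cts_gker.
have cs : continuous (fun s : R => cos (s * y) * gker s) by cts_tac.
have ci : continuous (fun s : R => - (s * sin (s * y)) * gker s) by cts_tac.
have c1 : continuous (fun s : R => y * (cos (s * y) * gker s) + v * (- (s * sin (s * y)) * gker s)) by cts_tac.
have d1 (x : R) : 0 <= x <= A -> has_der (fun s => sin (s * y) * gker s) x
    (y * (cos (x * y) * gker x) + v * (- (x * sin (x * y)) * gker x)).
  by move=> _; apply: der_eq; [rewrite /gker; der_tac|rewrite /gker/=; field].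
have := iint_ftc A0 c1 d1; rewrite mul0r sin0 mul0r subr0 => <-.
rewrite iintD; [|by cts_tac|by cts_tac].
by rewrite !iintZ// -/(psi A y); field; rewrite lt0r_neq0.
Qed.

(** By [psi_ode] the derivative of [psi A y * expR (y ^+ 2 / (2 * v))] reduces to the boundary term,
    which carries the factor [gker A]. *)
Lemma psi_gauss (A y : R) : 0 <= A ->
  `|psi A y * expR (y ^+ 2 / (2 * v)) - psi A 0| <= gker A / v * expR (y ^+ 2 / (2 * v)) * `|y|.
Proof.
move=> A0; pose H y := psi A y * expR (y ^+ 2 / (2 * v)).
have dH (z : R) : has_der H z (sin (A * z) * gker A / v * expR (z ^+ 2 / (2 * v))).
  have dp := psi_derive A z; rewrite psi_ode// in dp.
  apply: der_eq; first by rewrite /H; der_tac.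
  by rewrite /=; field; rewrite lt0r_neq0.
have H0 : H 0 = psi A 0 by rewrite /H expr0n/= mul0r expR0 mulr1.
rewrite -H0 -[X in _ * `|X|](subr0 y); apply: (mean_value_bound dH) => x xy.
have xy' : x ^+ 2 <= y ^+ 2.
  rewrite -(real_normK (num_real x)) -(real_normK (num_real y)) lerXn2r ?nnegrE//.
  move: xy; have [y0|y0] := leP 0 y => /andP[x1 x2].
    by rewrite !ger0_norm.
  by rewrite (ltr0_norm y0) ler0_norm// lerN2.
rewrite normrM [X in _ * X]gtr0_norm ?expR_gt0//; apply: ler_pM => //.
  rewrite -mulrA normrM -[leRHS]mul1r; apply: ler_pM => //.
    by rewrite ler_norml sin_geN1 sin_le1.
  by rewrite ger0_norm// divr_ge0 ?gker_ge0 ?ltW.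
by rewrite ler_expR ler_wpM2r// invr_ge0 mulr_ge0// ltW.
Qed.

(** Rescaling by [k = sqrt (v / 2)] reduces the value at 0 to the Gauss integral. *)
Lemma cvg_psi0 e : 0 < e ->
  \forall A \near +oo, `|psi A 0 - Num.sqrt (pi / (2 * v))| <= e.
Proof.
move=> e0; pose k := Num.sqrt (v / 2).
have k0 : 0 < k by rewrite sqrtr_gt0 divr_gt0.
have psiE (A : R) : 0 <= A -> psi A 0 = k^-1 * gauss_integral_proof.integral0_gauss (k * A).
  move=> A0; rewrite -(iint_scale A0 k0 (@continuous_gauss_fun R)).
  apply: eq_iint => x _; rewrite mulr0 cos0 mul1r /gker /gauss_fun exprMn sqr_sqrtr.
    by congr (expR (- _)); ring.
  by rewrite divr_ge0// ltW.
have cvg0 : gauss_integral_proof.integral0_gauss x @[x --> +oo] --> (Num.sqrt pi / 2 : R).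
  have : Num.sqrt (@gauss_integral_proof.integral0_gauss R x ^+ 2) @[x --> +oo] --> Num.sqrt (pi / 4).
    apply: continuous_cvg => //; first exact: sqrt_continuous.
    exact: gauss_integral_proof.cvg_integral0_gauss_sqr.
  rewrite sqrtrM ?pi_ge0// sqrtrV// (_ : 4 = 2 ^+ 2); last by rewrite expr2 -natrM.
  rewrite sqrtr_sqr ger0_norm// (_ : (fun _ => Num.sqrt _) = gauss_integral_proof.integral0_gauss)//.
  apply/funext => r; rewrite sqrtr_sqr ger0_norm//.
  exact: gauss_integral_proof.integral0_gauss_ge0.
have ke0 : 0 < k * e by rewrite mulr_gt0.
have /cvgrPdist_le/(_ _ ke0)[M0 [_ M0P]] := cvg0.
have limE : Num.sqrt (pi / (2 * v)) = k^-1 * (Num.sqrt pi / 2).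
  have -> : pi / (2 * v) = pi * (k * 2) ^- 2 :> R.
    rewrite exprMn sqr_sqrtr; last by rewrite divr_ge0// ltW.
    by field; rewrite lt0r_neq0.
  rewrite sqrtrM ?pi_ge0// sqrtrV ?sqr_ge0// sqrtr_sqr gtr0_norm ?mulr_gt0//.
  by field; rewrite lt0r_neq0.
near=> A; have A0 : 0 <= A by near: A; exact: nbhs_pinfty_ge.
rewrite psiE// limE -mulrBr normrM gtr0_norm ?invr_gt0// ler_pdivrMl// distrC.
apply: M0P; rewrite -ltr_pdivrMl//.
by near: A; apply: nbhs_pinfty_gt; rewrite num_real.
Unshelve. all: end_near. Qed.

(** The error in [psi_gauss] grows with [y], so that lemma is applied at an auxiliary end [B] which
    tends to infinity for fixed [y]. Only the tail between [A] and [B] remains, and its bound does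
    not depend on [y]. *)
Lemma gaussian_transform (A y : R) : 1 <= A ->
  `|psi A y - Num.sqrt (pi / (2 * v)) * expR (- (y ^+ 2 / (2 * v)))| <= expR (- (v / 2 * A)) / (v / 2).
Proof.
move=> A1; apply/ler_addgt0Pr => e e0.
set L := Num.sqrt _; set E := expR (y ^+ 2 / (2 * v)).
have E0 : 0 < E by exact: expR_gt0.
have Einv : expR (- (y ^+ 2 / (2 * v))) = E^-1 by rewrite expRN.
have cg := cts_gker.
have e2 : 0 < e / 2 by rewrite divr_gt0.
have v20 : 0 < v / 2 by rewrite divr_gt0.
have gker_le B : 1 <= B -> gker B <= expR (- (v / 2 * B)).
  move=> B1; rewrite ler_expR lerN2 -[leRHS]mulrA [leRHS]mulrC ler_pM2l// expr2 ler_peMr//.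
  exact: le_trans B1.
near (pinfty_nbhs R) => B.
have B1 : 1 <= B by near: B; apply: nbhs_pinfty_ge; rewrite num_real.
have B0 : 0 <= B by exact: le_trans B1.
have AB : A <= B by near: B; apply: nbhs_pinfty_ge; rewrite num_real.
have By : 2 * `|y| / (v / 2 * v * e) <= B by near: B; apply: nbhs_pinfty_ge; rewrite num_real.
have H1 : `|psi B 0 - L| <= e / 2 by near: B; exact: cvg_psi0.
have H2 : gker B / v * `|y| <= e / 2.
  have gB : gker B <= (v / 2 * B)^-1.
    apply: le_trans (gker_le B B1) _; rewrite expRN lef_pV2 ?posrE ?expR_gt0//.
      by apply: le_trans (expR_ge1Dx _); rewrite lerDr.
    by rewrite mulr_gt0// (lt_le_trans _ B1).
  apply: (@le_trans _ _ ((v / 2 * B)^-1 / v * `|y|)).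
    by rewrite ler_wpM2r// ler_wpM2r// invr_ge0 ltW.
  have B_0 : 0 < B by rewrite (lt_le_trans _ B1).
  rewrite ler_pdivrMr ?mulr_gt0// in By.
  rewrite -[leLHS]mulrA [leLHS]mulrC ler_pdivrMr ?mulr_gt0// mulrC ler_pdivrMr//.
  rewrite -(ler_pM2l (ltr0n _ 2)); apply: le_trans By _.
  by rewrite le_eqVlt; apply/orP; left; apply/eqP; field.
have H3 : `|psi B y - psi B 0 / E| <= e / 2.
  apply: le_trans H2.
  have := psi_gauss y B0; rewrite -/E => H.
  have -> : psi B y - psi B 0 / E = (psi B y * E - psi B 0) / E.
    by rewrite mulrBl mulfK ?lt0r_neq0.
  rewrite normrM normrV ?unitfE ?lt0r_neq0// (gtr0_norm E0) ler_pdivrMr//.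
  by apply: le_trans H _; rewrite mulrAC.
have H4 : `|psi A y - psi B y| <= expR (- (v / 2 * A)) / (v / 2).
  rewrite /psi (@iint_split _ 0 A B) ?(le_trans _ A1)//; last by cts_tac.
  rewrite opprD addrA subrr add0r normrN.
  have c1 : continuous (fun s : R => expR (- (v / 2 * s ^+ 2))) by cts_tac.
  apply: le_trans (gauss_tail v20 A1 AB); apply: iint_norm => //; first by cts_tac.
  move=> x _; rewrite normrM -[leRHS]mul1r; apply: ler_pM => //.
    by rewrite ler_norml cos_geN1 cos_le1.
  by rewrite ger0_norm ?gker_ge0// ler_expR lerN2 mulrC mulrA mulrAC.
have H5 : `|psi B 0 / E - L / E| <= e / 2.
  rewrite -mulrBl normrM normrV ?unitfE ?lt0r_neq0// (gtr0_norm E0) ler_pdivrMr//.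
  apply: le_trans H1 _; rewrite ler_peMr ?(ltW e2)//.
  by rewrite -expR0 ler_expR divr_ge0 ?sqr_ge0// mulr_ge0// ltW.
rewrite Einv (_ : psi A y - L / E = (psi A y - psi B y) + ((psi B y - psi B 0 / E) + (psi B 0 / E - L / E))); last ring.
apply: le_trans (ler_normD _ _) _; apply: lerD => //.
by apply: le_trans (ler_normD _ _) _; rewrite [e]splitr; apply: lerD.
Unshelve. all: end_near. Qed.

End GaussianTransform.

(** * Fourier inversion on a lattice *)

Section LawMean.
Variable R : realType.
Implicit Types (L : seq (R * R)) (f g : R -> R).

Lemma eq_law_mean L f g : (forall z, z \in L -> f z.2 = g z.2) -> law_mean L f = law_mean L g.
Proof. by move=> fg; apply: eq_big_seq => z /fg ->. Qed.

Lemma law_meanB L f g : law_mean L (fun x => f x - g x) = law_mean L f - law_mean L g.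
Proof. by rewrite /law_mean -sumrB; apply: eq_bigr => z _; rewrite mulrBr. Qed.

Lemma law_meanZ L k f : law_mean L (fun x => k * f x) = k * law_mean L f.
Proof. by rewrite /law_mean mulr_sumr; apply: eq_bigr => z _; rewrite mulrCA. Qed.

Lemma law_mean_sum (I : Type) (r : seq I) L (f : I -> R -> R) :
  law_mean L (fun x => \sum_(i <- r) f i x) = \sum_(i <- r) law_mean L (f i).
Proof.
by rewrite /law_mean exchange_big/=; apply: eq_bigr => z _; rewrite mulr_sumr.
Qed.

Lemma law_mean_norm L f g : finite_law L -> (forall x, `|f x| <= g x) ->
  `|law_mean L f| <= law_mean L g.
Proof.
move=> [L0 L1] fg; rewrite /law_mean big_seq [leRHS]big_seq.
apply: le_trans (ler_norm_sum _ _ _) _; apply: ler_sum => z /L0 z0.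
by rewrite normrM (ger0_norm z0) ler_wpM2l.
Qed.

Lemma cts_law_mean L (f : R -> R -> R) : (forall x, continuous (f^~ x)) ->
  continuous (fun s => law_mean L (f s)).
Proof.
move=> cf; apply: continuous_sumf => z; apply: ctsM; first exact: cts_cst.
exact: cf.
Qed.

Lemma law_mean_iint L a b (f : R -> R -> R) : (forall x, continuous (f^~ x)) ->
  iint a b (fun s => law_mean L (f s)) = law_mean L (fun x => iint a b (f^~ x)).
Proof.
move=> cf; rewrite /law_mean iint_sum; last first.
  by move=> z; apply: ctsM; [exact: cts_cst|exact: cf].
by apply: eq_bigr => z _; rewrite iintZ//; exact: cf.
Qed.

End LawMean.

Lemma sin_natpi (R : realType) (n : nat) : sin (n%:R * pi) = 0 :> R.
Proof.
elim: n => [|n IH]; first by rewrite mul0r sin0.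
by rewrite -natr1 mulrDl mul1r sinDpi IH oppr0.
Qed.

Lemma exp_small (R : realType) (c e : R) : 0 < c -> 0 < e ->
  \forall A \near +oo, expR (- (c * A)) / c <= e.
Proof.
move=> c0 e0; near=> A.
have A0 : 0 < A by near: A; apply: nbhs_pinfty_gt; rewrite num_real.
have A1 : (c * c * e)^-1 <= A by near: A; apply: nbhs_pinfty_ge; rewrite num_real.
have h : expR (- (c * A)) <= (c * A)^-1.
  rewrite expRN lef_pV2 ?posrE ?expR_gt0 ?mulr_gt0//.
  by apply: le_trans (expR_ge1Dx _); rewrite lerDr.
apply: (@le_trans _ _ ((c * A)^-1 / c)); first by rewrite ler_wpM2r// invr_ge0 ltW.
rewrite -invfM -[e]invrK lef_pV2 ?posrE ?mulr_gt0 ?invr_gt0//.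
rewrite -(ler_pM2l (mulr_gt0 (mulr_gt0 c0 c0) e0)) mulfV ?gt_eqF ?mulr_gt0// in A1.
rewrite -(ler_pM2r e0) mulVf ?gt_eqF//; apply: le_trans A1 _.
by rewrite le_eqVlt; apply/orP; left; apply/eqP; ring.
Unshelve. all: end_near. Qed.

Section LocalLimit.
Variables (R : realType) (nu : nat -> seq (R * R)) (v : R).
Hypothesis v0 : 0 < v.
Hypothesis nu_law : forall N, finite_law (nu N).
Notation E N := (law_mean (nu N)).
Hypothesis clt : forall A e, 0 <= A -> 0 < e -> \forall N \near \oo, forall s phi, `|s| <= A ->
  `|E N (fun x => cos (s / Num.sqrt N%:R * x + phi)) - cos phi * expR (- (s ^+ 2 * v / 2))| <= e.

Definition decay (T : R) : Prop := exists2 c, 0 < c & \forall N \near \oo, forall t phi,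
  `|t| <= T -> `|E N (fun x => cos (t * x + phi))| <= expR (- (c * N%:R * t ^+ 2)).

(* Fourier inversion integral in the variable [s = t * sqrt N], so that [A = T * sqrt N] stands
   for the frequency window [0 <= t <= T]; [W = 1] in the lattice case, while [W s = 1 - s / A]
   gives the Fejer kernel. *)
Definition cfint N (A : R) (W : R -> R) (u : R) : R :=
  iint 0 A (fun s => W s * E N (fun x => cos (s / Num.sqrt N%:R * (x - u)))).

Definition fejer_above (A : R) (W : R -> R) : Prop := continuous W /\
  forall s, 0 <= s <= A -> 1 - s / A <= W s <= 1.

Lemma near_sqrt (K : R) : \forall N \near \oo, K <= Num.sqrt N%:R.
Proof.
near=> N; have KN : K ^+ 2 <= N%:R by near: N; exact: nbhs_infty_ger.
by apply: le_trans (ler_norm _) _; rewrite -sqrtr_sqr ler_sqrt.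
Unshelve. all: end_near. Qed.

(** The cutoff [A] is chosen before [N]. On [[0, A]] the central limit estimate is uniform and [W]
    is within [A / (T * sqrt N)] of 1; beyond [A] the decay bound reads [expR (- (c * s ^+ 2))], so
    its tail is as small as the Gaussian one. The location [u] is only a phase. *)
Lemma cfint_limit T e : 0 < T -> decay T -> 0 < e -> \forall N \near \oo, forall u W,
  fejer_above (T * Num.sqrt N%:R) W ->
  `|cfint N (T * Num.sqrt N%:R) W u -
    Num.sqrt (pi / (2 * v)) * expR (- (u ^+ 2 / (2 * N%:R * v)))| <= e.
Proof.
move=> T0 [c c0 dec] e0.
have e4 : 0 < e / 4 by rewrite divr_gt0.
have v20 : 0 < v / 2 by rewrite divr_gt0.
near (pinfty_nbhs R) => A.
have A1 : 1 <= A by near: A; apply: nbhs_pinfty_ge; rewrite num_real.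
have A0 : 0 < A by rewrite (lt_le_trans _ A1).
have Ac : expR (- (c * A)) / c <= e / 4 by near: A; exact: exp_small.
have Av : expR (- (v / 2 * A)) / (v / 2) <= e / 4 by near: A; exact: exp_small.
pose del := e / 4 / A.
have del0 : 0 < del by rewrite divr_gt0.
have [N1 _ cltP] := clt (ltW A0) del0; have [N2 _ decP] := dec.
near=> N; set rN := Num.sqrt N%:R.
have rN0 : 0 < rN.
  by apply: (@lt_le_trans _ _ 1) => //; rewrite /rN; near: N; exact: near_sqrt.
pose B := T * rN.
have AB : A <= B.
  by rewrite /B mulrC -ler_pdivrMr// /rN; near: N; exact: near_sqrt.
have ABd : A / B <= del.
  have B0 : 0 < B by rewrite mulr_gt0.
  have : A / del / T <= rN by rewrite /rN; near: N; exact: near_sqrt.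
  by rewrite !ler_pdivrMr// /B => H; apply: le_trans H _; rewrite le_eqVlt; apply/orP; left; apply/eqP; ring.
have N1N : (N1 <= N)%N by near: N; exact: nbhs_infty_ge.
have cltN := cltP N N1N.
have N2N : (N2 <= N)%N by near: N; exact: nbhs_infty_ge.
have decN := decP N N2N.
move=> u W [cW WP].
have N0 : 0 < N%:R :> R by rewrite -(sqrtr_gt0 N%:R).
have rN2 : rN ^+ 2 = N%:R by rewrite sqr_sqrtr// ltW.
pose y := u / rN.
pose C s := E N (fun x => cos (s / rN * (x - u))).
have CE s : C s = E N (fun x => cos (s / rN * x + - (s * y))).
  by apply: eq_law_mean => z _; congr cos; rewrite /y; ring.
have cC : continuous C by apply: cts_law_mean => x; cts_tac.
have C_near s : 0 <= s <= A -> `|C s - cos (s * y) * gker v s| <= del.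
  move=> /andP[s0 sA]; rewrite CE -[cos (s * y)]cosN.
  move: s (- (s * y)) s0 sA => s phi s0 sA.
  by apply: cltN; rewrite ger0_norm.
have C_far s : 0 <= s <= B -> `|C s| <= expR (- (c * s ^+ 2)).
  move=> /andP[s0 sB]; rewrite CE.
  have -> : c * s ^+ 2 = c * N%:R * (s / rN) ^+ 2.
    by rewrite expr_div_n rN2; field; rewrite lt0r_neq0.
  by apply: decN; rewrite ger0_norm ?divr_ge0 ?(ltW rN0)// ler_pdivrMr.
have B0 : 0 < B by rewrite mulr_gt0.
have W1 s : 0 <= s <= B -> 0 <= W s <= 1.
  move=> sB; have /andP[w1 ->] := WP s sB; rewrite andbT; apply: le_trans w1.
  by rewrite subr_ge0 ler_pdivrMr// mul1r; case/andP: sB.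
have cg := @cts_gker R v.
have cWC : continuous (fun s : R => W s * C s) by cts_tac.
have ccg : continuous (fun s : R => cos (s * y) * gker v s) by cts_tac.
have uy : u ^+ 2 / (2 * N%:R * v) = y ^+ 2 / (2 * v).
  by rewrite /y expr_div_n rN2; field; rewrite !lt0r_neq0.
rewrite uy /cfint -/rN -/C (iint_split (ltW A0) AB cWC).
have H1 : `|iint 0 A (fun s => W s * C s) - psi v A y| <= e / 2.
  rewrite /psi -iintB//.
  apply: (@le_trans _ _ ((del + del) * (A - 0))).
    apply: iint_norm_cst => [||s /andP[s0 sA]]; [exact: ltW|by cts_tac|].
    have sB : 0 <= s <= B by rewrite s0 (le_trans sA).
    have -> : W s * C s - cos (s * y) * gker v s =
        W s * (C s - cos (s * y) * gker v s) + (W s - 1) * (cos (s * y) * gker v s) by ring.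
    apply: le_trans (ler_normD _ _) _; rewrite !normrM; apply: lerD.
      have /andP[w0 w1] := W1 s sB; rewrite (ger0_norm w0) -[leRHS]mul1r.
      by apply: ler_pM => //; apply: C_near; rewrite s0.
    rewrite -[leRHS]mulr1; apply: ler_pM => //.
      have /andP[w0 w1] := WP s sB; rewrite distrC ger0_norm ?subr_ge0//.
      apply: le_trans ABd; rewrite lerBlDr -lerBlDl; apply: le_trans w0.
      by rewrite lerB// ler_pM2r ?invr_gt0.
    rewrite -[leRHS]mulr1; apply: ler_pM => //.
      by rewrite ler_norml cos_geN1 cos_le1.
    by rewrite ger0_norm ?gker_ge0 ?gker_le1.
  by rewrite subr0 /del le_eqVlt; apply/orP; left; apply/eqP; field; rewrite lt0r_neq0.
have H2 : `|iint A B (fun s => W s * C s)| <= e / 4.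
  apply: le_trans Ac; apply: le_trans (gauss_tail c0 A1 AB).
  apply: iint_norm => [||s /andP[As sB]]; [by []|by cts_tac|].
  have sB' : 0 <= s <= B by rewrite sB (le_trans (ltW A0)).
  rewrite normrM -[leRHS]mul1r; apply: ler_pM => //; last exact: C_far.
  by have /andP[w0 w1] := W1 s sB'; rewrite ger0_norm.
have H3 := le_trans (gaussian_transform v0 y A1) Av.
set a := iint 0 A _ in H1 *; set b := iint A B _ in H2 *; set L := Num.sqrt _ * _ in H3 *.
have -> : a + b - L = (a - psi v A y) + (b + (psi v A y - L)) by ring.
apply: le_trans (ler_normD _ _) _; rewrite [leRHS]splitr; apply: lerD => //.
apply: le_trans (ler_normD _ _) _.
by rewrite [leRHS](_ : _ = e / 4 + e / 4); [apply: lerD|field].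
Unshelve. all: end_near. Qed.

(** In the variable [u / sqrt N] a bounded shift of [u] is of order [1 / sqrt N], so a Lipschitz
    bound valid on the whole line makes it harmless. *)
Lemma gauss_lipschitz (a b : R) :
  `|expR (- (a ^+ 2 / (2 * v))) - expR (- (b ^+ 2 / (2 * v)))| <= (1 + 2 * v) / v * `|a - b|.
Proof.
have d1 (x : R) : has_der (fun x : R => expR (- (x ^+ 2 / (2 * v)))) x (- (x / v * expR (- (x ^+ 2 / (2 * v))))).
  by apply: der_eq; [der_tac|rewrite /=; field; rewrite lt0r_neq0].
apply: (mean_value_bound d1) => x _.
rewrite normrN normrM (gtr0_norm (expR_gt0 _)) expRN ler_pdivrMr ?expR_gt0//.
apply: (@le_trans _ _ ((1 + 2 * v) / v * (1 + x ^+ 2 / (2 * v)))); last first.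
  by rewrite ler_wpM2l ?expR_ge1Dx// divr_ge0 ?(ltW v0)// addr_ge0// mulr_ge0// ltW.
rewrite normrM normfV (gtr0_norm v0) [leRHS]mulrAC ler_wpM2r ?invr_ge0 ?(ltW v0)//.
have -> : (1 + 2 * v) * (1 + x ^+ 2 / (2 * v)) = 1 + 2 * v + x ^+ 2 / (2 * v) + x ^+ 2.
  by field; rewrite lt0r_neq0.
have h1 : 0 <= x ^+ 2 / (2 * v) by rewrite divr_ge0 ?sqr_ge0// mulr_ge0// ltW.
have h2 : `|x| <= 1 + x ^+ 2.
  by rewrite -(real_normK (num_real x)); have := normr_ge0 x; nra.
by have := v0; lra.
Qed.

(* [kappa * pi * sqrt N] is [sigma * sqrt (2 * pi * N)] for [sigma ^+ 2 = v]. *)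
Definition kappa : R := Num.sqrt (2 * v / pi).

Lemma kappa_gt0 : 0 < kappa.
Proof. by rewrite sqrtr_gt0 divr_gt0 ?pi_gt0// mulr_gt0. Qed.

(** Bounded shifts [y] reach all points of the support of [g] while the Gaussian factor stays at
    [u]; [kappa] normalises this factor to 1 at [u = 0]. *)
Lemma cfint_shift T e Y : 0 < T -> decay T -> 0 < e -> \forall N \near \oo, forall u y W,
  `|y| <= Y -> fejer_above (T * Num.sqrt N%:R) W ->
  `|kappa * cfint N (T * Num.sqrt N%:R) W (u + y) - expR (- (u ^+ 2 / (2 * N%:R * v)))| <= e.
Proof.
move=> T0 dec e0.
have e1 : 0 < e / 2 / kappa by rewrite divr_gt0 ?kappa_gt0 ?divr_gt0.
have [N1 _ limP] := cfint_limit T0 dec e1.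
near=> N.
have rN0 : 0 < Num.sqrt N%:R :> R.
  by apply: (@lt_le_trans _ _ 1) => //; near: N; exact: near_sqrt.
have N0 : 0 < N%:R :> R by rewrite -(sqrtr_gt0 N%:R).
have rNY : Y * ((1 + 2 * v) / v) / (e / 2) <= Num.sqrt N%:R by near: N; exact: near_sqrt.
have N1N : (N1 <= N)%N by near: N; exact: nbhs_infty_ge.
have limN := limP N N1N.
move=> u y W yY fW.
have H1 : `|cfint N (T * Num.sqrt N%:R) W (u + y) -
    Num.sqrt (pi / (2 * v)) * expR (- ((u + y) ^+ 2 / (2 * N%:R * v)))| <= e / 2 / kappa.
  exact: limN.
have kL : kappa * Num.sqrt (pi / (2 * v)) = 1.
  rewrite /kappa -sqrtrM ?divr_ge0 ?pi_ge0 ?mulr_ge0 ?(ltW v0)//.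
  rewrite (_ : _ * _ = 1) ?sqrtr1//.
  by move: (@pi R) (pi_gt0 R) => q q0; field; rewrite !lt0r_neq0.
have scale w : w ^+ 2 / (2 * N%:R * v) = (w / Num.sqrt N%:R) ^+ 2 / (2 * v).
  by rewrite expr_div_n sqr_sqrtr ?(ltW N0)//; field; rewrite !lt0r_neq0.
have H2 : `|expR (- ((u + y) ^+ 2 / (2 * N%:R * v))) - expR (- (u ^+ 2 / (2 * N%:R * v)))| <= e / 2.
  rewrite !scale; apply: le_trans (gauss_lipschitz _ _) _.
  rewrite -mulrBl (_ : u + y - u = y); last ring.
  rewrite normrM (gtr0_norm (_ : 0 < (Num.sqrt N%:R)^-1)) ?invr_gt0// mulrA ler_pdivrMr//.
  have Y0 : 0 <= Y by apply: le_trans yY.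
  apply: (@le_trans _ _ ((1 + 2 * v) / v * Y)).
    by rewrite ler_wpM2l// divr_ge0 ?(ltW v0)// addr_ge0// mulr_ge0// ltW.
  by rewrite mulrC [leRHS]mulrC -ler_pdivrMr ?divr_gt0.
rewrite (_ : kappa * _ - _ = kappa * (cfint N (T * Num.sqrt N%:R) W (u + y) -
    Num.sqrt (pi / (2 * v)) * expR (- ((u + y) ^+ 2 / (2 * N%:R * v)))) +
    (expR (- ((u + y) ^+ 2 / (2 * N%:R * v))) - expR (- (u ^+ 2 / (2 * N%:R * v))))); last first.
  rewrite mulrBr mulrA kL; ring.
apply: le_trans (ler_normD _ _) _; rewrite [e]splitr; apply: lerD => //.
rewrite normrM (gtr0_norm kappa_gt0) mulrC.
by rewrite -ler_pdivlMr ?kappa_gt0.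
Unshelve. all: end_near. Qed.

Section Lattice.
Variables (h : R) (g : R -> R) (K : nat).
Hypothesis h0 : 0 < h.
Hypothesis g_supp : forall x, K%:R * h < `|x| -> g x = 0.
(** For [i] up to [2 * K], the lattice points from [- K * h] to [K * h], which contain all lattice
    points of the support of [g]. *)
Let node (i : nat) : R := (i%:R - K%:R) * h.

Lemma node_inj (i j : nat) : node i = node j -> i = j.
Proof.
move=> /(mulIf (lt0r_neq0 h0))/(addIr _)/eqP; rewrite eqr_nat.
by move=> /eqP.
Qed.

Lemma lattice_decomposition y : multiples h y ->
  g y = \sum_(i < K.*2.+1) g (node i) * (y == node i)%:R.
Proof.
move=> [a _ ya]; have [/existsP[i /eqP yi]|/existsPn noi] := boolP [exists i : 'I_K.*2.+1, y == node i].
  rewrite (bigD1 i)//= -yi eqxx mulr1 big1 ?addr0// => j ji.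
  rewrite (_ : (y == node j) = false) ?mulr0//; apply/negbTE; apply: contra_neq ji.
  by rewrite yi => /node_inj/val_inj.
rewrite big1 => [|i _]; last by rewrite (negbTE (noi i)) mulr0.
apply: g_supp; rewrite ltNge -ya normrM (gtr0_norm h0) ler_pM2r// -intr_norm [K%:R]pmulrn ler_int.
apply/negP => aK; have aK' : (`|(a + K%:Z)%R|%N < K.*2.+1)%N by lia.
have /eqP := noi (Ordinal aK'); apply; rewrite -ya /node /=; congr (_ * _).
have aE : (`|(a + K%:Z)%R|%N : int) = a + K by lia.
rewrite pmulrn aE rmorphD/= -pmulrn; ring.
Qed.

(** For a nonzero multiple [a * h] the primitive is a sine, which at the upper end, where
    [s / sqrt N = pi / h], has the argument [a * pi]. *)
Lemma character_orthogonality (N : nat) x : 0 < Num.sqrt N%:R :> R -> multiples h x ->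
  iint 0 (pi / h * Num.sqrt N%:R) (fun s => cos (s / Num.sqrt N%:R * x)) =
  pi / h * Num.sqrt N%:R * (x == 0)%:R.
Proof.
set r := Num.sqrt _ => r0 [a _ <-].
have B0 : 0 <= pi / h * r by rewrite mulr_ge0 ?(ltW r0)// divr_ge0 ?pi_ge0 ?ltW.
have [->|a0] := eqVneq a 0.
  rewrite mul0r eqxx mulr1; transitivity (iint 0 (pi / h * r) (fun=> 1)); last first.
    by rewrite iint_cst// mul1r subr0.
  by apply: eq_iint => s _; rewrite mulr0 cos0.
have ah0 : a%:~R * h != 0 by apply: mulf_neq0; [rewrite intr_eq0|exact: lt0r_neq0].
rewrite (negbTE ah0) mulr0.
have cc : continuous (fun s : R => cos (s / r * (a%:~R * h))) by cts_tac.
have dd (s : R) : 0 <= s <= pi / h * r ->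
    has_der (fun s => r / (a%:~R * h) * sin (s / r * (a%:~R * h))) s (cos (s / r * (a%:~R * h))).
  move=> _; apply: der_eq; [der_tac|rewrite /=].
  by move: (a%:~R * h) ah0 => b b0; field; rewrite b0 lt0r_neq0.
rewrite (iint_ftc B0 cc dd) !mul0r sin0 mulr0 subr0.
have -> : pi / h * r / r * (a%:~R * h) = a%:~R * pi :> R.
  by move: (@pi R) (a%:~R : R) => q b; field; rewrite !lt0r_neq0.
case: a {a0 ah0 cc dd} => n; first by rewrite -pmulrn sin_natpi mulr0.
have -> : (Negz n)%:~R * pi = - (n.+1%:R * pi) :> R by rewrite NegzE mulrNz mulNr -pmulrn.
by rewrite sinN sin_natpi oppr0 mulr0.
Qed.

Hypothesis nu_lattice : forall N z, z \in nu N -> multiples h z.2.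

Lemma multiplesD (x y : R) : multiples h x -> multiples h y -> multiples h (x + y).
Proof. by move=> [a _ <-] [b _ <-]; exists (a + b) => //; rewrite rmorphD/= mulrDl. Qed.

Lemma multiplesN (x : R) : multiples h x -> multiples h (- x).
Proof. by move=> [a _ <-]; exists (- a) => //; rewrite rmorphN/= mulNr. Qed.

Lemma multiples_node i : multiples h (node i).
Proof. by exists (i%:Z - K%:Z) => //; rewrite rmorphB/= -!pmulrn. Qed.

Lemma lattice_mass N u : 0 < Num.sqrt N%:R :> R -> multiples h u ->
  pi / h * Num.sqrt N%:R * E N (fun x => (x == u)%:R) =
  cfint N (pi / h * Num.sqrt N%:R) (fun=> 1) u.
Proof.
move=> r0 hu; rewrite /cfint.
rewrite (@eq_iint _ _ _ _ (fun s => E N (fun x => cos (s / Num.sqrt N%:R * (x - u))))); last first.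
  by move=> s _; rewrite mul1r.
rewrite law_mean_iint; last by move=> x; cts_tac.
rewrite -law_meanZ; apply: eq_law_mean => z zN.
by rewrite character_orthogonality ?subr_eq0//; apply: multiplesD; [exact: nu_lattice zN|exact: multiplesN].
Qed.

(** On the lattice [g] is a finite combination of indicators of points; [lattice_mass] writes the
    probability of each point [u + node i] as an inversion integral, and [cfint_shift] treats the
    bounded shift [node i]. *)
Lemma lattice_limit e : decay (pi / h) -> 0 < e ->
  \forall N \near \oo, forall u, multiples h u ->
  `|kappa * pi * Num.sqrt N%:R * E N (fun x => g (x - u)) -
    expR (- (u ^+ 2 / (2 * N%:R * v))) * \sum_(i < K.*2.+1) g (node i) * h| <= e.
Proof.
move=> dec e0; set n := K.*2.+1.
pose M := \sum_(i < n) `|g (node i) * h|.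
have M0 : 0 <= M by apply: sumr_ge0.
have M1 : 0 < M + 1 by rewrite ltr_wpDl.
have T0 : 0 < pi / h :> R by rewrite divr_gt0 ?pi_gt0.
have [N1 _ shift] := @cfint_shift (pi / h) (e / (M + 1)) (K%:R * h) T0 dec (divr_gt0 e0 M1).
near=> N.
have r0 : 0 < Num.sqrt N%:R :> R.
  by apply: (@lt_le_trans _ _ 1) => //; near: N; exact: near_sqrt.
have N1N : (N1 <= N)%N by near: N; exact: nbhs_infty_ge.
move=> u hu; set B := pi / h * Num.sqrt N%:R.
have B0 : 0 < B by rewrite mulr_gt0.
have fej : fejer_above B (fun=> 1).
  split; first exact: cts_cst.
  by move=> s /andP[s0 _]; rewrite lexx andbT gerBl divr_ge0// ltW.
have -> : kappa * pi * Num.sqrt N%:R * E N (fun x => g (x - u)) =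
    \sum_(i < n) g (node i) * h * (kappa * cfint N B (fun=> 1) (u + node i)).
  rewrite (@eq_law_mean _ _ _ (fun x => \sum_(i < n) g (node i) * (x == u + node i)%:R)); last first.
    move=> z zN; rewrite lattice_decomposition.
      by apply: eq_bigr => i _; rewrite subr_eq addrC.
    by apply: multiplesD; [exact: nu_lattice zN|exact: multiplesN].
  rewrite law_mean_sum mulr_sumr; apply: eq_bigr => i _.
  rewrite law_meanZ -lattice_mass//; last by apply: multiplesD => //; exact: multiples_node.
  rewrite -/B /B; move: (law_mean _ _) (g _) (@pi R) => a b q; field; exact: lt0r_neq0.
rewrite mulr_sumr -sumrB; apply: le_trans (ler_norm_sum _ _ _) _.
apply: (@le_trans _ _ (\sum_(i < n) `|g (node i) * h| * (e / (M + 1)))); last first.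
  by rewrite -mulr_suml -/M mulrCA ler_piMr ?(ltW e0)// ler_pdivrMr// mul1r lerDl.
apply: ler_sum => i _; rewrite [X in _ - X]mulrC -mulrBr normrM ler_wpM2l//.
apply: (shift N N1N) => //; rewrite normrM (gtr0_norm h0) ler_wpM2r ?(ltW h0)//.
have iK : (i <= K + K)%N by have := ltn_ord i; rewrite {2}/n; lia.
have [Ki|iK'] := leqP K i.
  by rewrite -natrB// normr_nat ler_nat leq_subLR.
by rewrite distrC -natrB 1?ltnW// normr_nat ler_nat leq_subr.
Unshelve. all: end_near. Qed.

End Lattice.

End LocalLimit.

(** * Fourier inversion on the line *)

Section TrigBounds.
Variable R : realType.
Implicit Types x y z : R.

Lemma one_sub_cos_bound z : 0 <= 1 - cos z <= z ^+ 2.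
Proof.
rewrite subr_ge0 cos_le1/=.
have d1 (x : R) : has_der (fun x : R => cos x) x (- sin x).
  by apply: der_eq; [der_tac|rewrite mulr1].
have := @mean_value_bound R cos (fun x => - sin x) 0 z `|z| d1.
rewrite cos0 subr0 -expr2 (real_normK (num_real z)) distrC => H.
apply: le_trans (ler_norm _) (H _) => x xz; rewrite normrN.
apply: (@le_trans _ _ `|x|).
  by have := sin_lipschitz x 0; rewrite sin0 !subr0.
move: xz; have [z0|z0] := leP 0 z => /andP[x1 x2].
  by rewrite !ger0_norm.
by rewrite (ltr0_norm z0) ler0_norm// lerN2.
Qed.

Lemma cos_fourth_order z : `|z ^+ 2 - 2 * (1 - cos z)| <= 2 * z ^+ 4.
Proof.
have seg (x w : R) : Num.min 0 w <= x <= Num.max 0 w -> `|x| <= `|w|.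
  have [w0|w0] := leP 0 w => /andP[x1 x2]; first by rewrite !ger0_norm.
  by rewrite (ltr0_norm w0) ler0_norm// lerN2.
have sq (w : R) : w ^+ 2 = `|w| ^+ 2 by rewrite real_normK ?num_real.
have S (w : R) : `|w - sin w| <= `|w| ^+ 3.
  have d1 (x : R) : has_der (fun x : R => x - sin x) x (1 - cos x).
    by apply: der_eq; [der_tac|rewrite mulr1].
  have := @mean_value_bound R _ _ 0 w (`|w| ^+ 2) d1.
  rewrite sin0 !subr0 -exprSr; apply => x /seg xw.
  have /andP[c0 c1] := one_sub_cos_bound x; rewrite ger0_norm//; apply: le_trans c1 _.
  by rewrite sq lerXn2r ?nnegrE.
have d2 (x : R) : has_der (fun x : R => x ^+ 2 - 2 * (1 - cos x)) x (2 * (x - sin x)).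
  by apply: der_eq; [der_tac|rewrite /=; ring].
have := @mean_value_bound R _ _ 0 z (2 * `|z| ^+ 3) d2.
rewrite cos0 subrr mulr0 expr0n/= !subr0 -mulrA -exprSr => H.
have -> : z ^+ 4 = `|z| ^+ 4 by rewrite -normrX ger0_norm// exprn_even_ge0.
apply: H => x /seg xz.
rewrite normrM (ger0_norm (ler0n R 2)) ler_wpM2l//; apply: le_trans (S x) _.
by rewrite lerXn2r ?nnegrE.
Qed.

(** Both reciprocals blow up like [1 / z ^+ 2], but their denominators differ only in fourth order,
    so the singularities cancel. *)
Lemma sinc_comparison z : 0 < `|z| <= 1 ->
  `|(z ^+ 2)^-1 - (2 * (1 - cos z))^-1| <= 8.
Proof.
move=> /andP[z0 z1]; set q := 2 * (1 - cos z).
have z2 : 0 < z ^+ 2 by rewrite -(real_normK (num_real z)) exprn_gt0.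
have q1 : z ^+ 2 / 4 <= q by have := cos_quadratic z1; rewrite /q; lra.
have q0 : 0 < q by apply: lt_le_trans q1; rewrite divr_gt0.
have -> : (z ^+ 2)^-1 - q^-1 = (q - z ^+ 2) / (z ^+ 2 * q).
  have gen (w r : R) : 0 < w -> 0 < r -> w^-1 - r^-1 = (r - w) / (w * r).
    by move=> w0 r0; field; rewrite !lt0r_neq0.
  exact: gen.
rewrite normrM normfV distrC (gtr0_norm (mulr_gt0 z2 q0)) (ler_pdivrMr _ _ (mulr_gt0 z2 q0)).
apply: le_trans (cos_fourth_order z) _.
have -> : z ^+ 4 = z ^+ 2 * z ^+ 2 by rewrite -exprD.
by move: (z ^+ 2) z2 q1 => w w0 q1; nra.
Qed.

End TrigBounds.

(** * The Fejer kernel and its mass *)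

Section FejerKernel.
Variable R : realType.
Implicit Types A x y z : R.

(** By [fej_closed] this is [(1 - cos (A * y)) / (A * y ^+ 2)] for [y != 0]. Its integral over the
    line is [pi], which is why the convolution with [g] is compared with [pi * g]. *)
Definition fej A y : R := iint 0 A (fun s => (1 - s / A) * cos (s * y)).

Lemma fej0 A : 0 < A -> fej A 0 = A / 2.
Proof.
move=> A0; have cf : continuous (fun s : R => (1 - s / A) * cos (s * 0)) by cts_tac.
have dF (s : R) : 0 <= s <= A -> has_der (fun s : R => s - s ^+ 2 / (2 * A)) s ((1 - s / A) * cos (s * 0)).
  by move=> _; apply: der_eq; [der_tac|rewrite /= (mulr0 s) cos0; field; rewrite lt0r_neq0].
by rewrite /fej (iint_ftc (ltW A0) cf dF); field; rewrite lt0r_neq0.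
Qed.

Lemma fej_closed A y : 0 < A -> fej A y * (A * y ^+ 2) = 1 - cos (A * y).
Proof.
move=> A0; have [->|y0] := eqVneq y 0; first by rewrite expr0n/= !mulr0 cos0 subrr.
have cf : continuous (fun s : R => (1 - s / A) * cos (s * y)) by cts_tac.
have dF (s : R) : 0 <= s <= A -> has_der
    (fun s : R => (1 - s / A) * sin (s * y) / y - cos (s * y) / (A * y ^+ 2)) s ((1 - s / A) * cos (s * y)).
  by move=> _; apply: der_eq; [der_tac|rewrite /=; field; rewrite y0 lt0r_neq0].
rewrite /fej (iint_ftc (ltW A0) cf dF) !mul0r sin0 cos0.
by field; rewrite y0 lt0r_neq0.
Qed.

Lemma fej_ge0 A y : 0 < A -> 0 <= fej A y.
Proof.
move=> A0; have [->|y0] := eqVneq y 0; first by rewrite fej0// divr_ge0// ltW.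
have Ay : 0 < A * y ^+ 2 by rewrite mulr_gt0// lt0r sqrf_eq0 y0 sqr_ge0.
by rewrite -(pmulr_lge0 _ Ay) fej_closed// subr_ge0 cos_le1.
Qed.

Lemma fej_scale A r y : 0 < A -> 0 < r -> fej (A * r) (y / r) = r * fej A y.
Proof.
move=> A0 r0; have [->|y0] := eqVneq y 0.
  by rewrite mul0r !fej0 ?mulr_gt0//; ring.
have Ay : A * y ^+ 2 / r != 0.
  by rewrite mulf_neq0 ?invr_neq0 ?mulf_neq0 ?expf_neq0// lt0r_neq0.
apply: (mulIf Ay).
have -> : r * fej A y * (A * y ^+ 2 / r) = fej A y * (A * y ^+ 2).
  by field; rewrite lt0r_neq0.
have -> : A * y ^+ 2 / r = A * r * (y / r) ^+ 2.
  by field; rewrite lt0r_neq0.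
rewrite !fej_closed ?mulr_gt0//; congr (1 - cos _); field; exact: lt0r_neq0.
Qed.

Lemma fej_decay A d y : 0 < A -> 0 < d -> d <= `|y| -> fej A y <= 2 / (A * d ^+ 2).
Proof.
move=> A0 d0 dy; have y2 : d ^+ 2 <= y ^+ 2.
  by rewrite -(real_normK (num_real y)) lerXn2r ?nnegrE// ltW.
have d2 : 0 < d ^+ 2 by rewrite exprn_gt0.
have fc := fej_closed y A0; have f0 := fej_ge0 y A0.
rewrite ler_pdivlMr ?mulr_gt0//; apply: (@le_trans _ _ (fej A y * (A * y ^+ 2))).
  by rewrite ler_wpM2l// ler_wpM2l// ltW.
by rewrite fc; have := cos_geN1 (A * y); lra.
Qed.

Lemma cts_fej A : 0 < A -> continuous (fej A).
Proof.
move=> A0; apply: (@cts_lipschitz _ _ (A * A)) => x y.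
have cf z : continuous (fun s : R => (1 - s / A) * cos (s * z)) by cts_tac.
rewrite /fej -iintB//; apply: (@le_trans _ _ (A * `|x - y| * (A - 0))); last first.
  by rewrite subr0 mulrAC.
apply: iint_norm_cst => [||s /andP[s0 sA]]; [exact: ltW|by cts_tac|].
rewrite -mulrBr normrM -[leRHS]mul1r; apply: ler_pM => //.
  have sA1 : s / A <= 1 by rewrite ler_pdivrMr// mul1r.
  by rewrite ger0_norm ?subr_ge0// gerBl divr_ge0// ltW.
apply: le_trans (cos_lipschitz _ _) _; rewrite -mulrBr normrM (ger0_norm s0).
by rewrite ler_wpM2r.
Qed.

(** The numerators are [1 - cos y] and [1 + cos y], with sum 2, and each denominator is at most
    [2 * (y ^+ 2 + pi ^+ 2)]. *)
Lemma fej_pair_lower y : 1 / (y ^+ 2 + pi ^+ 2) <= fej 1 y + fej 1 (y + pi).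
Proof.
have h1 := fej_closed y (@ltr01 R); have h2 := fej_closed (y + pi) (@ltr01 R).
rewrite !mul1r cosDpi in h1 h2.
have f1 := fej_ge0 y (@ltr01 R); have f2 := fej_ge0 (y + pi) (@ltr01 R).
have p0 := @pi_gt0 R.
have s0 : 0 < y ^+ 2 + pi ^+ 2 by rewrite ltr_wpDl ?sqr_ge0// exprn_gt0.
rewrite ler_pdivrMr//.
have e1 : y ^+ 2 <= 2 * (y ^+ 2 + pi ^+ 2) by have := sqr_ge0 y; have := sqr_ge0 (@pi R); lra.
have e2 : (y + pi) ^+ 2 <= 2 * (y ^+ 2 + pi ^+ 2) by have := sqr_ge0 (y - pi); lra.
have := ler_wpM2l f1 e1; have := ler_wpM2l f2 e2; lra.
Qed.

(* The periodic kernel [fejd n / (2 * n)] has an explicit mass over a period and differs from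
   [fej n] by [O(1 / n)] on [[-1, 1]]; this yields the mass of [fej n] without computing an
   improper integral. *)
Definition dirichlet n z : R := 1 + 2 * \sum_(1 <= j < n.+1) cos (j%:R * z).

Definition fejd n z : R := \sum_(i < n) dirichlet i z.

Lemma dirichlet_closed n z : (1 - cos z) * dirichlet n z = cos (n%:R * z) - cos (n.+1%:R * z).
Proof.
elim: n => [|n IH]; first by rewrite /dirichlet big_nil mulr0 addr0 mulr1 mul0r cos0 mul1r.
have -> : dirichlet n.+1 z = dirichlet n z + 2 * cos (n.+1%:R * z).
  by rewrite /dirichlet big_nat_recr//= mulrDr addrA.
rewrite mulrDr IH.
have -> : n.+2%:R * z = n.+1%:R * z + z by rewrite -[n.+2%:R]natr1 mulrDl mul1r.
have -> : n%:R * z = n.+1%:R * z - z by rewrite -[n.+1%:R]natr1 mulrDl mul1r addrK.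
by rewrite cosB cosD; ring.
Qed.

Lemma fejd_closed n z : (1 - cos z) * fejd n z = 1 - cos (n%:R * z).
Proof.
elim: n => [|n IH]; first by rewrite /fejd big_ord0 mulr0 mul0r cos0 subrr.
rewrite /fejd big_ord_recr/= mulrDr -/(fejd n z) IH dirichlet_closed; ring.
Qed.

Lemma fejd0 n : fejd n 0 = n%:R ^+ 2.
Proof.
elim: n => [|n IH]; first by rewrite /fejd big_ord0 expr0n.
rewrite /fejd big_ord_recr/= -/(fejd n 0) IH /dirichlet.
under eq_bigr do rewrite mulr0 cos0.
by rewrite sumr_const_nat subSS subn0 -natr1; ring.
Qed.

Lemma fejd_integral n x : iint (x - pi) (x + pi) (fun y => fejd n (x - y)) = 2 * pi * n%:R.
Proof.
have p0 := @pi_gt0 R; have ab : x - pi <= x + pi by lra.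
have cc (j : nat) : continuous (fun y : R => cos (j%:R * (x - y))) by cts_tac.
have ic j : (0 < j)%N -> iint (x - pi) (x + pi) (fun y => cos (j%:R * (x - y))) = 0.
  move=> j0; have j1 : j%:R != 0 :> R by rewrite pnatr_eq0 -lt0n.
  have dF (y : R) : x - pi <= y <= x + pi ->
      has_der (fun y => - (sin (j%:R * (x - y)) / j%:R)) y (cos (j%:R * (x - y))).
    by move=> _; apply: der_eq; [der_tac|rewrite /=; field].
  rewrite (iint_ftc ab (cc j) dF).
  have -> : j%:R * (x - (x + pi)) = - (j%:R * pi) by ring.
  have -> : j%:R * (x - (x - pi)) = j%:R * pi by ring.
  by rewrite sinN sin_natpi oppr0 mul0r oppr0 subrr.
have cs i : continuous (fun y : R => \sum_(1 <= j < i.+1) cos (j%:R * (x - y))).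
  exact: continuous_sumf.
have dd i : iint (x - pi) (x + pi) (fun y => dirichlet i (x - y)) = 2 * pi.
  rewrite /dirichlet iintD; [|by cts_tac|by apply: ctsM; [exact: cts_cst|exact: cs]].
  rewrite iint_cst// iintZ// iint_sum// big_nat big1 => [|j /andP[j1 _]]; last exact: ic.
  by ring.
have cd i : continuous (fun y : R => dirichlet i (x - y)).
  apply: ctsD; first exact: cts_cst.
  by apply: ctsM; [exact: cts_cst|exact: cs].
rewrite /fejd iint_sum//.
under eq_bigr do rewrite dd.
by rewrite sumr_const card_ord -[LHS]mulr_natr.
Qed.

Lemma cts_fejd n x : continuous (fun y : R => fejd n (x - y)).
Proof.
apply: continuous_sumf => i; apply: ctsD; first exact: cts_cst.
by apply: ctsM; [exact: cts_cst|apply: continuous_sumf => j; cts_tac].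
Qed.

Lemma fej_near n z : (0 < n)%N -> `|z| <= 1 -> `|fej n%:R z - fejd n z / (2 * n%:R)| <= 16 / n%:R.
Proof.
move=> n0 z1; have n1 : 0 < n%:R :> R by rewrite ltr0n.
have [->|z0] := eqVneq z 0.
  rewrite fej0// fejd0 (_ : _ - _ = 0) ?normr0 ?divr_ge0//.
  by field; rewrite lt0r_neq0.
have za : 0 < `|z| <= 1 by rewrite normr_gt0 z0.
have q0 : 0 < 1 - cos z.
  by apply: lt_le_trans (cos_quadratic z1); rewrite divr_gt0// lt0r sqrf_eq0 z0 sqr_ge0.
have -> : fej n%:R z = (1 - cos (n%:R * z)) / n%:R * (z ^+ 2)^-1.
  by rewrite -(fej_closed z n1); field; rewrite z0 lt0r_neq0.
have -> : fejd n z / (2 * n%:R) = (1 - cos (n%:R * z)) / n%:R * (2 * (1 - cos z))^-1.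
  by rewrite -(fejd_closed n z); field; rewrite !lt0r_neq0.
rewrite -mulrBr normrM mulrC; apply: (@le_trans _ _ (8 * (2 / n%:R))); last first.
  by rewrite le_eqVlt; apply/orP; left; apply/eqP; field; rewrite lt0r_neq0.
apply: ler_pM => //; first exact: sinc_comparison.
rewrite ger0_norm; last by rewrite divr_ge0 ?subr_ge0 ?cos_le1 ?ltW.
by rewrite ler_pM2r ?invr_gt0//; have := cos_geN1 (n%:R * z); lra.
Qed.

Lemma one_le_pi : 1 <= pi :> R.
Proof. by apply: le_trans (pi_ge2 R); rewrite ler1n. Qed.

Lemma one_sub_cos1_gt0 : 0 < 1 - cos 1 :> R.
Proof.
by apply: lt_le_trans (@cos_quadratic R 1 _); rewrite ?normr1// divr_gt0// exprn_gt0.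
Qed.

Lemma fejd_far n z : (0 < n)%N -> 1 <= `|z| <= pi ->
  `|fejd n z / (2 * n%:R)| <= (1 - cos 1)^-1 / n%:R.
Proof.
move=> n0 /andP[z1 zp]; have n1 : 0 < n%:R :> R by rewrite ltr0n.
have c1 := one_sub_cos1_gt0.
have cz : cos z <= cos 1.
  rewrite -cos_norm leNgt ltr_cos ?in_itv/= ?normr_ge0 ?zp ?ler01 ?(le_trans _ one_le_pi)//.
  by rewrite -leNgt.
have q0 : 0 < 1 - cos z by lra.
have -> : fejd n z / (2 * n%:R) = (1 - cos (n%:R * z)) / 2 / (1 - cos z) / n%:R.
  by rewrite -(fejd_closed n z); field; rewrite !lt0r_neq0.
have u0 : 0 <= (1 - cos (n%:R * z)) / 2 <= 1.
  by have := cos_geN1 (n%:R * z); have := cos_le1 (n%:R * z); lra.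
case/andP: u0 => u0 u1.
rewrite ger0_norm; last by apply: divr_ge0 (ltW n1); apply: divr_ge0 (ltW q0).
rewrite ler_pM2r ?invr_gt0// -[leRHS]mul1r; apply: ler_pM => //.
by rewrite lef_pV2 ?posrE//; lra.
Qed.

(** On [[x - 1, x + 1]] the kernel is compared with the periodic one, whose mass over the period
    [[x - pi, x + pi]] is [pi] and whose part at distance at least 1 from [x] is [O(1 / n)]. *)
Lemma fej_mass : exists2 C : R, 0 <= C & forall n x, (0 < n)%N ->
  `|iint (x - 1) (x + 1) (fun y => fej n%:R (x - y)) - pi| <= C / n%:R.
Proof.
have p1 := one_le_pi; have c1 := one_sub_cos1_gt0.
exists (32 + 2 * (pi - 1) * (1 - cos 1)^-1).
  by apply: addr_ge0 => //; apply: divr_ge0 (ltW c1); apply: mulr_ge0 => //; rewrite subr_ge0.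
move=> n x n0; have n1 : 0 < n%:R :> R by rewrite ltr0n.
pose f (y : R) := fejd n (x - y) / (2 * n%:R).
have cf : continuous f by apply: ctsM; [exact: cts_fejd|exact: cts_cst].
have cx : continuous (fun y : R => x - y) by cts_tac.
have ck : continuous (fun y : R => fej n%:R (x - y)) := cts_comp (cts_fej n1) cx.
have tot : iint (x - pi) (x + pi) f = pi.
  rewrite /f (@eq_iint _ _ _ _ (fun y => (2 * n%:R)^-1 * fejd n (x - y))); last first.
    by move=> y _; rewrite mulrC.
  rewrite iintZ; last exact: cts_fejd.
  by rewrite fejd_integral; field; rewrite lt0r_neq0.
have l1 : x - pi <= x - 1 by lra.
have l2 : x - 1 <= x + 1 by lra.
have l3 : x + 1 <= x + pi by lra.
rewrite -[X in _ - X]tot (iint_split l1 (le_trans l2 l3) cf) (iint_split l2 l3 cf).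
set a := iint (x - pi) _ f; set b := iint (x - 1) _ f; set c := iint (x + 1) _ f.
set d := iint _ _ (fun y => fej _ _).
have Ha : `|a| <= (1 - cos 1)^-1 / n%:R * ((x - 1) - (x - pi)).
  apply: iint_norm_cst => // y /andP[y1 y2]; apply: fejd_far => //.
  by rewrite ger0_norm; lra.
have Hc : `|c| <= (1 - cos 1)^-1 / n%:R * ((x + pi) - (x + 1)).
  apply: iint_norm_cst => // y /andP[y1 y2]; apply: fejd_far => //.
  by rewrite ler0_norm; lra.
have Hd : `|d - b| <= 16 / n%:R * ((x + 1) - (x - 1)).
  rewrite /d /b -iintB//; apply: iint_norm_cst => // [|y /andP[y1 y2]]; first by cts_tac.
  by apply: fej_near => //; rewrite ler_norml; lra.
have -> : d - (a + (b + c)) = (d - b) - (a + c) by ring.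
apply: le_trans (ler_normB _ _) _; apply: le_trans (lerD Hd (ler_normD _ _)) _.
apply: le_trans (lerD (lexx _) (lerD Ha Hc)) _.
by rewrite le_eqVlt; apply/orP; left; apply/eqP; ring.
Qed.

End FejerKernel.

(** * Approximation by convolution with the Fejer kernel *)

Section Smoothing.
Variables (R : realType) (g : R -> R) (B : R).
Hypothesis cg : continuous g.
Hypothesis g_supp : forall x, B < `|x| -> g x = 0.

(** Compactness gives uniformity for [x] in [[- (B + 1), B + 1]]; for other [x] the bound [del <= 1]
    keeps [y] off the support as well. *)
Lemma compact_support_uniform e : 0 < e ->
  exists2 del, 0 < del <= 1 & forall x y, `|x - y| <= del -> `|g x - g y| <= e.
Proof.
move=> e0; pose K := `[- (B + 1), B + 1]%classic.
have /compact_near_coveringP cK : compact K by exact: segment_compact.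
have [|d /= d0 dP] := cK R (0^'+) (fun d x => forall y, `|x - y| <= d -> `|g x - g y| <= e).
  move=> x _; have e2 : 0 < e / 2 by rewrite divr_gt0.
  have cgx : continuous_at x g by exact: cg.
  have /cvgrPdist_lt/(_ _ e2)[r /= r0 rP] := cgx.
  have r2 : 0 < r / 2 by rewrite divr_gt0.
  exists (ball x (r / 2), [set d | 0 < d < r / 2]) => /=.
    split; first exact: nbhsx_ballx.
    near=> d; apply/andP; split; near: d; [exact: nbhs_right_gt|exact: nbhs_right_lt].
  move=> [x' d] /= [xx' /andP[d0 dr]] y x'y.
  have gx z : `|x - z| < r -> `|g x - g z| < e / 2 by move=> xz; exact: rP.
  have -> : g x' - g y = - (g x - g x') + (g x - g y) by ring.
  apply: le_trans (ler_normD _ _) _; rewrite normrN [e]splitr; apply: lerD; apply/ltW/gx.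
    by apply: lt_trans xx' _; rewrite ltr_pdivrMr// ltr_pMr// ltr1n.
  have -> : x - y = (x - x') + (x' - y) by ring.
  apply: le_lt_trans (ler_normD _ _) _; rewrite [r]splitr; apply: ltrD => //.
  exact: le_lt_trans x'y dr.
pose d1 := Num.min (d / 2) 1.
have d1d : d1 < d.
  by rewrite /d1 gt_min; apply/orP; left; rewrite ltr_pdivrMr// ltr_pMr// ltr1n.
have d10 : 0 < d1 by rewrite lt_min ltr01 andbT; apply: divr_gt0.
have d1b : ball_ (fun x : R => `|x|) 0 d d1 by rewrite /ball_/= sub0r normrN gtr0_norm.
have dP1 := dP d1 d1b d10.
exists d1; first by rewrite d10 ge_min lexx orbT.
move=> x y xy; have [xK|xK] := leP `|x| (B + 1).
  have xK' : K x by rewrite /K /= in_itv/= -ler_norml.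
  exact: dP1 xK' y xy.
have yB : B < `|y|.
  have h := lerB_dist x y; have : `|x - y| <= 1 by apply: le_trans xy _; rewrite ge_min lexx orbT.
  lra.
rewrite !g_supp ?subrr ?normr0 ?(ltW e0)//; lra.
Unshelve. all: end_near. Qed.

Variable M : R.
Hypothesis gM : forall x, `|g x| <= M.
Hypothesis B0 : 0 <= B.
(** For [|x| <= B + 1] the interval [[x - 1, x + 1]] of [fej_mass] lies in [[- b, b]]. *)
Let b := B + 2.

Definition fejer_smooth (n : nat) (x : R) : R := iint (- b) b (fun y => g y * fej n%:R (x - y)).

(* The two squared sines never vanish together, so the majorant dominates [1 / (x ^+ 2 + pi ^+ 2)];
   as its Fourier transform has compact support, its expectation under [S_N - u] is
   [O(N ^ (- 1 / 2))] uniformly in [u]. *)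
Definition fejer_majorant (x : R) : R := fej 1 x + fej 1 (x + pi).

Lemma cts_fej_sub n x : (0 < n)%N -> continuous (fun y : R => fej n%:R (x - y)).
Proof. by move=> n0; apply: (cts_comp (g := fej n%:R)); [apply: cts_fej; rewrite ltr0n|cts_tac]. Qed.

(** For [|y| <= B] and [|x| > B + 1] one has [|x - y| >= |x| / (B + 1)], so the convolution is
    [O(1 / (n x ^ 2))], and [fej_pair_lower] bounds this decay in [x] by the majorant. *)
Lemma smooth_far : exists2 C : R, 0 <= C & forall n x, (0 < n)%N -> B + 1 < `|x| ->
  `|pi * g x - fejer_smooth n x| <= C / n%:R * fejer_majorant x.
Proof.
have B_0 := B0.
have M0 : 0 <= M := le_trans (normr_ge0 _) (gM 0).
have B1 : 0 < B + 1 by lra.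
have p0 := @pi_gt0 R.
pose C := M * 2 * (B + 1) ^+ 2 * (b - - b) * (1 + pi ^+ 2).
have p2 : 0 < 1 + pi ^+ 2 :> R by rewrite addr_gt0// exprn_gt0.
exists C; first by rewrite /C !mulr_ge0 ?exprn_ge0 ?(ltW B1) ?(ltW p2)//; rewrite /b; lra.
move=> n x n0 xB; have n1 : 0 < n%:R :> R by rewrite ltr0n.
rewrite g_supp; last by lra.
rewrite mulr0 sub0r normrN.
have cf := @cts_fej_sub n x n0.
have x1 : 1 <= `|x| by lra.
have x2 : 1 <= x ^+ 2 by rewrite -(real_normK (num_real x)) expr_ge1.
have x20 : 0 < x ^+ 2 by lra.
apply: (@le_trans _ _ (M * (2 / (n%:R * (`|x| / (B + 1)) ^+ 2)) * (b - - b))).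
  apply: iint_norm_cst => [||y _]; [rewrite /b; lra|by cts_tac|].
  have [yB|yB] := leP `|y| B; last first.
    by rewrite g_supp// mul0r normr0 mulr_ge0// divr_ge0// mulr_ge0// exprn_ge0// divr_ge0// ltW.
  rewrite normrM (ger0_norm (fej_ge0 _ n1)); apply: ler_pM => //; first exact: fej_ge0.
  apply: fej_decay => //; first by rewrite divr_gt0//; lra.
  apply: le_trans (lerB_dist x y); rewrite ler_pdivrMr//.
  have H1 : 0 <= B * (`|x| - B - 1) by apply: mulr_ge0; lra.
  have H2 : 0 <= (B - `|y|) * (B + 1) by apply: mulr_ge0; lra.
  by rewrite -subr_ge0 (_ : _ - _ = B * (`|x| - B - 1) + (B - `|y|) * (B + 1)); [lra|ring].
have -> : M * (2 / (n%:R * (`|x| / (B + 1)) ^+ 2)) * (b - - b) =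
    M * 2 * (B + 1) ^+ 2 * (b - - b) / n%:R * (x ^+ 2)^-1.
  rewrite expr_div_n (real_normK (num_real x)).
  by move: (x ^+ 2) x20 (b - - b) => w w0 b'; field; rewrite !lt0r_neq0.
have -> : C / n%:R * fejer_majorant x =
    M * 2 * (B + 1) ^+ 2 * (b - - b) / n%:R * ((1 + pi ^+ 2) * fejer_majorant x) by rewrite /C; ring.
rewrite ler_wpM2l//.
  by rewrite divr_ge0// !mulr_ge0 ?exprn_ge0 ?(ltW B1)//; rewrite /b; lra.
apply: le_trans (ler_wpM2l (ltW p2) (fej_pair_lower x)).
rewrite mul1r -[(x ^+ 2)^-1]mul1r ler_pdivrMr// mulrAC.
rewrite ler_pdivlMr ?mul1r; last by rewrite addr_gt0// exprn_gt0.
have := @sqr_ge0 _ (@pi R); nra.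
Qed.

Lemma smooth_mass : exists2 C : R, 0 <= C & forall n x, (0 < n)%N -> `|x| <= B + 1 ->
  `|iint (- b) b (fun y => fej n%:R (x - y)) - pi| <= C / n%:R.
Proof.
have B_0 := B0; have [C C0 CP] := fej_mass R.
exists (C + 4 * (b - - b)); first by rewrite addr_ge0// mulr_ge0//; rewrite /b; lra.
move=> n x n0; rewrite ler_norml => /andP[x1 x2]; have n1 : 0 < n%:R :> R by rewrite ltr0n.
have cf := @cts_fej_sub n x n0.
have l1 : - b <= x - 1 by rewrite /b; lra.
have l2 : x - 1 <= x + 1 by lra.
have l3 : x + 1 <= b by rewrite /b; lra.
rewrite (iint_split l1 (le_trans l2 l3) cf) (iint_split l2 l3 cf).
set p1 := iint (- b) _ _; set p2 := iint (x - 1) _ _; set p3 := iint (x + 1) _ _.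
have far y : 1 <= `|x - y| -> `|fej n%:R (x - y)| <= 2 / n%:R.
  move=> xy; rewrite ger0_norm ?fej_ge0//; apply: le_trans (fej_decay n1 ltr01 xy) _.
  by rewrite expr1n mulr1.
have H1 : `|p1| <= 2 / n%:R * (x - 1 - - b).
  by apply: iint_norm_cst => // y /andP[y1 y2]; apply: far; rewrite ger0_norm; lra.
have H3 : `|p3| <= 2 / n%:R * (b - (x + 1)).
  by apply: iint_norm_cst => // y /andP[y1 y2]; apply: far; rewrite ler0_norm; lra.
have -> : p1 + (p2 + p3) - pi = (p2 - pi) + (p1 + p3) by ring.
apply: le_trans (ler_normD _ _) _; apply: le_trans (lerD (CP n x n0) (ler_normD _ _)) _.
apply: le_trans (lerD (lexx _) (lerD H1 H3)) _.
rewrite -subr_ge0.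
have -> : (C + 4 * (b - - b)) / n%:R - (C / n%:R + (2 / n%:R * (x - 1 - - b) + 2 / n%:R * (b - (x + 1)))) =
   (4 * b + 4) / n%:R by ring.
by rewrite divr_ge0 ?(ltW n1)//; rewrite /b; lra.
Qed.

(** Where [|x - y| <= del], the oscillation of [g] is at most [e'] and the kernel has mass at most
    [pi + C]; elsewhere the kernel is [O(1 / n)]. The defect of the mass from [pi] takes the last
    third of [e]. *)
Lemma smooth_near e : 0 < e -> \forall n \near \oo, forall x, `|x| <= B + 1 ->
  `|pi * g x - fejer_smooth n x| <= e.
Proof.
move=> e0; have B_0 := B0; have M0 : 0 <= M := le_trans (normr_ge0 _) (gM 0).
have p0 := @pi_gt0 R.
have [C C0 CP] := smooth_mass.
pose e' := e / 3 / (pi + C).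
have pC : 0 < pi + C by lra.
have e'0 : 0 < e' by rewrite !divr_gt0.
have [del /andP[del0 _] delP] := compact_support_uniform e'0.
have bb : 0 <= b - - b by rewrite /b; lra.
have D0 : 0 < del ^+ 2 by rewrite exprn_gt0.
near=> n.
have n0 : (0 < n)%N by near: n; exact: nbhs_infty_gt.
have n1 : 0 < n%:R :> R by rewrite ltr0n.
have n1' : 1 <= n%:R :> R by rewrite ler1n.
have N1 : 2 * M * 2 / del ^+ 2 * (b - - b) / (e / 3) <= n%:R by near: n; exact: nbhs_infty_ger.
have N2 : M * C / (e / 3) <= n%:R by near: n; exact: nbhs_infty_ger.
move=> x xB; have cf := @cts_fej_sub n x n0.
set I := iint (- b) b (fun y => fej n%:R (x - y)).
have IC : `|I - pi| <= C / n%:R by exact: CP.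
have -> : pi * g x - fejer_smooth n x =
    - (fejer_smooth n x - g x * I) - g x * (I - pi) by ring.
have -> : fejer_smooth n x - g x * I = iint (- b) b (fun y => (g y - g x) * fej n%:R (x - y)).
  rewrite /fejer_smooth /I -iintZ// -iintB; [|by cts_tac|by cts_tac].
  by apply: eq_iint => y _; rewrite mulrBl.
apply: le_trans (ler_normB _ _) _; rewrite normrN.
have H1 : `|iint (- b) b (fun y => (g y - g x) * fej n%:R (x - y))| <= e / 3 + e / 3.
  apply: (@le_trans _ _ (iint (- b) b (fun y => e' * fej n%:R (x - y) + 2 * M * (2 / (n%:R * del ^+ 2))))).
    apply: iint_norm => [||y _]; [by cts_tac|by cts_tac|].
    rewrite normrM (ger0_norm (fej_ge0 _ n1)).
    have [xy|xy] := leP `|y - x| del.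
      apply: (@le_trans _ _ (e' * fej n%:R (x - y))).
        by apply: ler_wpM2r; [exact: fej_ge0|exact: delP].
      by rewrite lerDl !mulr_ge0// invr_ge0 mulr_ge0 ?ltW.
    rewrite -[leLHS]add0r; apply: lerD; first by rewrite mulr_ge0 ?fej_ge0 ?ltW.
    apply: ler_pM => //; first exact: fej_ge0.
      apply: le_trans (ler_normB _ _) _; have := gM x; have := gM y; lra.
    by apply: fej_decay => //; rewrite distrC ltW.
  rewrite iintD; [|by cts_tac|by cts_tac].
  have bb' : - b <= b by rewrite /b; lra.
  rewrite [X in X + _]iintZ// (iint_cst _ bb').
  apply: lerD.
    rewrite -/I; apply: (@le_trans _ _ (e' * (pi + C))); last by rewrite /e' divfK// lt0r_neq0.
    rewrite ler_wpM2l ?(ltW e'0)//.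
    have : C / n%:R <= C by rewrite ler_pdivrMr// ler_peMr.
    move: IC; rewrite ler_norml => /andP[_ ?]; lra.
  rewrite ler_pdivrMr ?divr_gt0// in N1.
  have -> : 2 * M * (2 / (n%:R * del ^+ 2)) * (b - - b) = 2 * M * 2 / del ^+ 2 * (b - - b) / n%:R.
    by move: (del ^+ 2) D0 (b - - b) => w w0 b'; field; rewrite !lt0r_neq0.
  by rewrite ler_pdivrMr// [leRHS]mulrC.
have H2 : `|g x * (I - pi)| <= e / 3.
  rewrite normrM; apply: (@le_trans _ _ (M * (C / n%:R))); first exact: ler_pM.
  by rewrite ler_pdivrMr ?divr_gt0// in N2; rewrite mulrA ler_pdivrMr// [leRHS]mulrC.
by apply: le_trans (lerD H1 H2) _; lra.
Unshelve. all: end_near. Qed.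

(** A constant error would not do: expectations are multiplied by [sqrt N], and only that of the
    majorant is of order [1 / sqrt N]. On [|x| <= B + 1] the majorant is at least [h0]. *)
Lemma fejer_smoothing e : 0 < e -> \forall n \near \oo, forall x,
  `|pi * g x - fejer_smooth n x| <= e * fejer_majorant x.
Proof.
move=> e0; have p0 := @pi_gt0 R; have B_0 := B0.
have [C C0 CP] := smooth_far.
pose h0 := 1 / ((B + 1) ^+ 2 + pi ^+ 2) : R.
have h00 : 0 < h0 by rewrite divr_gt0// ltr_wpDl ?sqr_ge0// exprn_gt0.
have [N _ NP] := smooth_near (mulr_gt0 e0 h00).
near=> n.
have n0 : (0 < n)%N by near: n; exact: nbhs_infty_gt.
have n1 : 0 < n%:R :> R by rewrite ltr0n.
have Nn : (N <= n)%N by near: n; exact: nbhs_infty_ge.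
have Cn : C / e <= n%:R by near: n; exact: nbhs_infty_ger.
move=> x; have maj0 : 0 <= fejer_majorant x by rewrite addr_ge0 ?fej_ge0.
have [xB|xB] := leP `|x| (B + 1).
  apply: le_trans (NP n Nn x xB) _; rewrite ler_wpM2l ?(ltW e0)//.
  apply: le_trans (fej_pair_lower x); rewrite /h0 !mul1r lef_pV2 ?posrE.
  - by rewrite lerD2r -(real_normK (num_real x)) lerXn2r ?nnegrE//; lra.
  - by rewrite ltr_wpDl ?sqr_ge0// exprn_gt0.
  - by rewrite ltr_wpDl ?sqr_ge0// exprn_gt0.
apply: le_trans (CP n x n0 xB) _; rewrite ler_wpM2r//.
by rewrite ler_pdivrMr// mulrC -ler_pdivrMr.
Unshelve. all: end_near. Qed.

End Smoothing.

(** * The local limit without lattice structure *)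

Section NonLattice.
Variables (R : realType) (nu : nat -> seq (R * R)) (v : R).
Hypothesis v0 : 0 < v.
Hypothesis nu_law : forall N, finite_law (nu N).
Notation E N := (law_mean (nu N)).
Hypothesis clt : forall A e, 0 <= A -> 0 < e -> \forall N \near \oo, forall s phi, `|s| <= A ->
  `|E N (fun x => cos (s / Num.sqrt N%:R * x + phi)) - cos phi * expR (- (s ^+ 2 * v / 2))| <= e.

(** Rescaling the Fejer kernel by [sqrt N] makes its expectation an inversion integral with
    triangular weight. *)
Lemma fej_cfint N (A u : R) : 0 < A -> 0 < Num.sqrt N%:R :> R ->
  Num.sqrt N%:R * E N (fun x => fej A (x - u)) =
  cfint nu N (A * Num.sqrt N%:R) (fun s => 1 - s / (A * Num.sqrt N%:R)) u.
Proof.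
set r := Num.sqrt _ => A0 r0; rewrite -law_meanZ /cfint.
transitivity (iint 0 (A * r) (fun s => E N (fun x => (1 - s / (A * r)) * cos (s / r * (x - u))))).
  rewrite law_mean_iint; last by move=> x; cts_tac.
  apply: eq_law_mean => z _; rewrite -fej_scale// /fej; apply: eq_iint => s _.
  by congr (_ * cos _); ring.
by apply: eq_iint => s _; rewrite law_meanZ.
Qed.

Lemma fejer_above_fej (A : R) : 0 < A -> fejer_above A (fun s => 1 - s / A).
Proof.
move=> A0; split; first by cts_tac.
by move=> s /andP[s0 sA]; rewrite lexx gerBl divr_ge0// ltW.
Qed.

Variables (g : R -> R) (B M : R).
Hypothesis cg : continuous g.
Hypothesis g_supp : forall x, B < `|x| -> g x = 0.
Hypothesis gM : forall x, `|g x| <= M.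
Hypothesis B0 : 0 <= B.
Let b := B + 2.

Lemma nonlattice_limit e : (forall T, 0 < T -> decay nu T) -> 0 < e ->
  \forall N \near \oo, forall u,
  `|kappa v * pi * Num.sqrt N%:R * E N (fun x => g (x - u)) -
    expR (- (u ^+ 2 / (2 * N%:R * v))) * iint (- b) b g| <= e.
Proof.
move=> dec e0; have B_0 := B0; have p0 := @pi_gt0 R; have k0 := kappa_gt0 v0.
have M0 : 0 <= M := le_trans (normr_ge0 _) (gM 0).
have bb : - b <= b by rewrite /b; lra.
have e8 : 0 < e / 8 by rewrite divr_gt0.
(* The kernel parameter [n] is fixed before [N], so decay is needed only on the fixed windows
   [T = n] and, for the majorant, [T = 1]. *)
near \oo => n.
have n0 : (0 < n)%N by near: n; exact: nbhs_infty_gt.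
have n1 : 0 < n%:R :> R by rewrite ltr0n.
have smooth : forall x, `|pi * g x - fejer_smooth g B n x| <= e / 8 * fejer_majorant x.
  by near: n; exact: (fejer_smoothing cg g_supp gM B0 e8).
pose e2 := e / 2 / ((M + 1) * (b - - b)).
have b0 : 0 < b - - b by rewrite /b; lra.
have e20 : 0 < e2 by rewrite divr_gt0 ?divr_gt0// mulr_gt0//; lra.
have [N1 _ N1P] := @cfint_shift R nu v v0 clt 1 1 pi ltr01 (dec 1 ltr01) ltr01.
have [N2 _ N2P] := @cfint_shift R nu v v0 clt n%:R e2 b n1 (dec _ n1) e20.
near=> N.
have r0 : 0 < Num.sqrt N%:R :> R.
  by apply: (@lt_le_trans _ _ 1) => //; near: N; exact: near_sqrt.
have N1N : (N1 <= N)%N by near: N; exact: nbhs_infty_ge.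
have N2N : (N2 <= N)%N by near: N; exact: nbhs_infty_ge.
move=> u; set r := Num.sqrt N%:R in r0 *; set G := expR _.
have G1 : G <= 1.
  by rewrite /G -expR0 ler_expR oppr_le0 divr_ge0 ?sqr_ge0// !mulr_ge0// ltW.
(* Each half is within 1 of [G <= 1], hence at most 2; with the total 4 the tolerance [e / 8] of the
   smoothing costs [e / 2]. *)
have maj : kappa v * r * E N (fun x => fejer_majorant (x - u)) <= 4.
  have half y : `|y| <= pi -> kappa v * (r * E N (fun x => fej 1 (x - (u + y)))) <= 2.
    move=> yp; rewrite fej_cfint//.
    have := N1P N N1N u y _ yp (fejer_above_fej (mulr_gt0 ltr01 r0)).
    rewrite -/r ler_norml -/G => /andP[_ h]; lra.
  have -> : E N (fun x => fejer_majorant (x - u)) =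
      E N (fun x => fej 1 (x - (u + 0))) + E N (fun x => fej 1 (x - (u - pi))).
    rewrite /law_mean -big_split/=; apply: eq_bigr => z _.
    rewrite -mulrDr /fejer_majorant addr0; congr (_ * (fej _ _ + fej _ _)); ring.
  have h1 := half 0; rewrite normr0 (ltW p0) in h1.
  have h2 := half (- pi); rewrite normrN (gtr0_norm p0) lexx in h2.
  by have := h1 isT; have := h2 isT; rewrite mulrDr !mulrA; lra.
have H1 : `|kappa v * r * E N (fun x => pi * g (x - u) - fejer_smooth g B n (x - u))| <= e / 2.
  rewrite normrM gtr0_norm ?mulr_gt0//.
  apply: (@le_trans _ _ (kappa v * r * E N (fun x => e / 8 * fejer_majorant (x - u)))).
    apply: ler_wpM2l; first by rewrite mulr_ge0 ?ltW.
    by apply: (law_mean_norm (nu_law N)) => x; exact: smooth.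
  rewrite law_meanZ mulrCA; apply: le_trans (ler_wpM2l (ltW e8) maj) _; lra.
have cfj x : continuous (fun y : R => fej n%:R (x - u - y)).
  by apply: (cts_comp (g := fej n%:R)); [exact: cts_fej|cts_tac].
have cE : continuous (fun y => E N (fun x => fej n%:R (x - u - y))) by exact: cts_law_mean.
have smE : kappa v * r * E N (fun x => fejer_smooth g B n (x - u)) =
    iint (- b) b (fun y => g y * (kappa v * r * E N (fun x => fej n%:R (x - u - y)))).
  rewrite /fejer_smooth.
  have := @law_mean_iint R (nu N) (- b) b (fun y x => g y * fej n%:R (x - u - y)).
  rewrite -/b => <-; last by move=> x; apply: ctsM => //; exact: cfj.
  rewrite -iintZ; last by apply: cts_law_mean => x; apply: ctsM => //; exact: cfj.
  by apply: eq_iint => y _; rewrite law_meanZ mulrCA.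
have H2 : `|kappa v * r * E N (fun x => fejer_smooth g B n (x - u)) - G * iint (- b) b g| <= e / 2.
  rewrite smE -iintZ// -iintB; last 2 first.
  - by cts_tac.
  - by cts_tac.
  apply: (@le_trans _ _ (M * e2 * (b - - b))).
    apply: iint_norm_cst => // [|y yb]; first by cts_tac.
    rewrite [G * _]mulrC -mulrBr normrM; apply: ler_pM => //.
    have yb' : `|y| <= b by rewrite ler_norml.
    have -> : (fun x => fej n%:R (x - u - y)) = (fun x => fej n%:R (x - (u + y))).
      by apply/funext => x; rewrite opprD addrA.
    rewrite -mulrA fej_cfint//.
    exact: (N2P N N2N u y _ yb' (fejer_above_fej (mulr_gt0 n1 r0))).
  have M1 : 0 < M + 1 by lra.
  have -> : M * e2 * (b - - b) = e / 2 * (M / (M + 1)).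
    by rewrite /e2; move: (b - - b) b0 => w w0; field; rewrite !lt0r_neq0.
  by rewrite ler_piMr ?divr_ge0 ?ltW// ltr_pdivrMr//; lra.
have -> : kappa v * pi * r * E N (fun x => g (x - u)) - G * iint (- b) b g =
  kappa v * r * E N (fun x => pi * g (x - u) - fejer_smooth g B n (x - u)) +
  (kappa v * r * E N (fun x => fejer_smooth g B n (x - u)) - G * iint (- b) b g).
  rewrite law_meanB law_meanZ; ring.
by apply: le_trans (ler_normD _ _) _; rewrite [e]splitr; exact: lerD.
Unshelve. all: end_near. Qed.

End NonLattice.

(** * The local limit theorem *)

Section FullSupport.
Variables (R : realType) (T : finType) (nu : T -> R).
Hypothesis nu0 : forall x, 0 < nu x.

Lemma pmf_ae_all (A : set T) : pmf_ae nu A -> forall x, A x.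
Proof.
rewrite /pmf_ae /pmf_measure => H x; apply: contrapT => nAx.
have := psumr_eq0P (fun y (_ : y \in ~` A) => ltW (nu0 y)) H.
by move=> /(_ x); rewrite inE => /(_ nAx) nux; have := nu0 x; rewrite nux ltxx.
Qed.

Lemma pmf_measure_inhabited (A : set T) : 0 < pmf_measure nu A -> exists x, A x.
Proof.
move=> H; apply: contrapT => /forallNP nA; move: H.
rewrite /pmf_measure big1 ?ltxx// => x.
by rewrite inE => /nA.
Qed.

End FullSupport.

Lemma cos_eq1 (R : realType) (x : R) : cos x = 1 -> exists k : int, x = k%:~R * (2 * pi).
Proof.
move=> cx; have p0 := @pi_gt0 R; have p2 : 0 < 2 * pi :> R by lra.
pose k := Num.floor (x / (2 * pi)); exists k.
(* Half of the remainder of [x] modulo [2 * pi]: it lies in [[0, pi)] and its sine vanishes, so it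
   is 0. *)
pose y := (x - k%:~R * (2 * pi)) / 2.
have cos_shift (n : nat) z : cos (z - n%:R * (2 * pi)) = cos z :> R.
  elim: n z => [|n IH] z; first by rewrite mul0r subr0.
  rewrite -(IH z) -[LHS]cosD2pi -natr1; congr cos; rewrite -mulr_natl; ring.
have cos_period (j : int) : cos (x - j%:~R * (2 * pi)) = 1.
  case: j => n; first by rewrite -pmulrn cos_shift.
  rewrite NegzE mulrNz mulNr opprK -pmulrn -(cos_shift n.+1) addrK; exact: cx.
have yb : 0 <= y < pi.
  have := Num.Theory.floor_le (x / (2 * pi)); have := Num.Theory.floorD1_gt (x / (2 * pi)).
  rewrite -/k ltr_pdivrMr// ler_pdivlMr// rmorphD/= mulrDl mul1r /y => h1 h2.
  by apply/andP; split; lra.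
have : sin y = 0.
  have e1 := cos_period k.
  have e2 : x - k%:~R * (2 * pi) = y + y by rewrite /y -splitr.
  have := cos2Dsin2 y; rewrite e2 cosD -!expr2 in e1 *; move=> e3.
  by apply/eqP; rewrite -sqrf_eq0; apply/eqP; lra.
case/andP: yb => y0 yp; move: y0; rewrite le_eqVlt => /predU1P[y0 _|y0 s0].
  by apply/eqP; rewrite -subr_eq0; apply/eqP; move: y0; rewrite /y; lra.
by have := sin_gt0_pi (introT andP (conj y0 yp)); rewrite s0 ltxx.
Qed.

(** * From the span of the last argument to phase gaps *)

Section SpanGap.
Variables (R : realType) (X : finType) (mu : X -> R) (m : nat) (F : m.+1.-tuple X -> R).
Hypothesis mu0 : forall x, 0 < mu x.

Lemma character_span (xs : m.-tuple X) t : 0 < t ->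
  (forall y1 y2, cos (t * (F [tuple of rcons xs y1] - F [tuple of rcons xs y2])) = 1) ->
  setB mu F xs (2 * pi / t).
Proof.
move=> t0 H; have p0 := @pi_gt0 R.
split; first by rewrite divr_ge0 ?mulr_ge0 ?ltW.
rewrite /pmf_ae /pmf_measure big1// => z; rewrite inE => nz; exfalso; apply: nz.
have [k tk] := cos_eq1 (H z.1 z.2).
exists k => //; apply: (mulfI (lt0r_neq0 t0)); rewrite tk.
by field; rewrite lt0r_neq0.
Qed.

Lemma nonlattice_gap : nonlattice_case mu F -> exists xs : m.-tuple X, forall t, 0 < t ->
  exists y1 y2, cos (t * (F [tuple of rcons xs y1] - F [tuple of rcons xs y2])) != 1.
Proof.
move=> /pmf_measure_inhabited[xs xsB]; exists xs => t t0.
apply: contrapT => /forallNP H; have : setB mu F xs (2 * pi / t).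
  apply: character_span => // y1 y2; have /forallNP/(_ y2) := H y1.
  by move=> /negP; rewrite negbK => /eqP.
by rewrite [setB _ _ _]xsB.
Qed.

(** Otherwise [2 * pi / t], which is at least [2 * h], would belong to [setB], whose supremum is
    [h]. As [mu] is positive, this works for every [xs]. *)
Lemma lattice_gap h (xs : m.-tuple X) t : lattice_case mu F h -> 0 < t <= pi / h ->
  exists y1 y2, cos (t * (F [tuple of rcons xs y1] - F [tuple of rcons xs y2])) != 1.
Proof.
move=> [h0 /pmf_ae_all-/(_ (fun xs => prodr_gt0 _ _))]; move=> /(_ _)/(_ xs)[|_ span _].
  by move=> ys i _; exact: mu0.
move=> /andP[t0 th]; have p0 := @pi_gt0 R.
apply: contrapT => /forallNP H; have B : setB mu F xs (2 * pi / t).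
  apply: character_span => // y1 y2; have /forallNP/(_ y2) := H y1.
  by move=> /negP; rewrite negbK => /eqP.
have : ((2 * pi / t)%:E <= local_span mu F xs)%E by apply: ereal_sup_ubound; exists (2 * pi / t).
rewrite span lee_fin ler_pdivrMr// => h1.
by rewrite ler_pdivlMr// mulrC in th; lra.
Qed.

Lemma lattice_values h : lattice_case mu F h -> forall t, multiples h (F t).
Proof.
move=> [h0 /pmf_ae_all H] t.
have [xs [x ->]] : exists (xs : m.-tuple X) x, t = [tuple of rcons xs x].
  exists [tuple of belast (thead t) (behead t)], (last (thead t) (behead t)).
  by apply/val_inj => /=; rewrite -lastI; case/tupleP: t => a s /=; rewrite theadE.
have [_ _ [_ /pmf_ae_all]] := H (fun xs => prodr_gt0 _ (fun i _ => mu0 _)) xs.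
by move=> /(_ mu0 x).
Qed.

End SpanGap.

(** Nonemptiness of [U] makes the supremum at least 0, the empty one being [-oo]. *)
Lemma cvg_ereal_sup0 (R : realType) (U : set R) (err : nat -> R -> R) : U !=set0 ->
  (forall N u, 0 <= err N u) ->
  (forall e, 0 < e -> \forall N \near \oo, forall u, U u -> err N u <= e) ->
  ereal_sup [set (err N u)%:E | u in U] @[N --> \oo] --> 0%E.
Proof.
move=> [u0 Uu0] err0 errU.
have lo N : (0 <= ereal_sup [set (err N u)%:E | u in U])%E.
  apply: (@le_trans _ _ (err N u0)%:E); first by rewrite lee_fin.
  by apply: ereal_sup_ubound; exists u0.
have hi N e : (forall u, U u -> err N u <= e) -> (ereal_sup [set (err N u)%:E | u in U] <= e%:E)%E.
  by move=> H; apply: ge_ereal_sup => _ [u Uu <-]; rewrite lee_fin H.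
apply/fine_cvgP; split.
  have [N1 _ NP] := errU 1 ltr01; exists N1 => // N N1N.
  rewrite ge0_fin_numE//; apply: le_lt_trans (hi N 1 (NP N N1N)) _; exact: ltry.
apply/cvgrPdist_le => e e0; have [N1 _ NP] := errU e e0; exists N1 => // N N1N /=.
have h := hi N e (NP N N1N).
rewrite sub0r normrN ger0_norm ?fine_ge0// -lee_fin fineK//.
by rewrite ge0_fin_numE//; apply: le_lt_trans h _; exact: ltry.
Qed.

Section CompactSupport.
Variables (R : realType) (g : R -> R).
Hypothesis cg : continuous g.
Hypothesis g_compact : compactly_supported g.

Lemma support_bound : exists2 B, 0 <= B & forall x, B < `|x| -> g x = 0.
Proof.
have [B [_ BP]] := compact_bounded g_compact.
pose B' := Num.max B 0 + 1.
have BB : B < B' by rewrite ltr_pwDr// le_max lexx.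
exists B'; first by rewrite addr_ge0// le_max lexx orbT.
move=> x xB; apply: contrapT => /eqP gx.
have : `|x| <= B' by apply: (BP B' BB); exact: subset_closure.
by rewrite leNgt xB.
Qed.

Lemma compact_support_bounded : exists M, forall x, `|g x| <= M.
Proof.
have [B B0 BP] := support_bound.
have cn : continuous (fun x => `|g x|) by cts_tac.
have BB : - B <= B by lra.
have [c _ cP] := EVT_max BB (continuous_subspaceT cn).
exists `|g c| => x; have [xB|xB] := leP `|x| B; last by rewrite BP// normr0.
by apply: cP; rewrite in_itv/= -ler_norml.
Qed.

Lemma lebesgue_integral_support B : 0 <= B -> (forall x, B < `|x| -> g x = 0) ->
  (\int[@lebesgue_measure R]_x g x)%R = iint (- B) B g.
Proof.
move=> B0 BP; rewrite /iint [RHS]Rintegral_mkcond; congr Rintegral; apply/funext => x.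
rewrite patchE; case: ifPn => // /negP; rewrite inE /= in_itv/= -ler_norml => /negP.
by rewrite -ltNge => /BP.
Qed.

End CompactSupport.

(** * Integration against the lattice measure *)

Section LatticeIntegral.
Variables (R : realType) (h : {posnum R}) (K : nat).
Let H : R := h%:num.

Lemma dirac_series (a : nat -> R) (f : R -> R) : (forall n, (K < n)%N -> f (a n) = 0) ->
  (forall x, 0 <= f x) -> measurable_fun setT f ->
  (\int[mseries (fun n => dirac (a n : measurableTypeR R)) 0]_x (f x)%:E)%E =
  (\sum_(n < K.+1) f (a n))%:E.
Proof.
move=> f0 fge mf; have mfE : measurable_fun setT (EFin \o f) by exact/measurable_EFinP.
rewrite ge0_integral_measure_series//; last by move=> x _; rewrite lee_fin.
have step n : (\int[dirac (a n : measurableTypeR R)]_x (f x)%:E)%E = (f (a n))%:E.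
  by rewrite integral_dirac// diracT mul1e.
rewrite (eq_eseriesr (fun n _ => step n)) (@nneseries_split _ _ 0 K.+1); last first.
  by move=> n _; rewrite lee_fin.
rewrite add0n eseries0 ?adde0 => [|n Kn _]; last by rewrite f0.
by rewrite sumEFin big_mkord.
Qed.

Lemma lattice_integral_ge0 (f : R -> R) : (forall x, K%:R * H < `|x| -> f x = 0) ->
  (forall x, 0 <= f x) -> measurable_fun setT f ->
  (\int[lattice_measure h]_x (f x)%:E)%E = (\sum_(i < K.*2.+1) f ((i%:R - K%:R) * H) * H)%:E.
Proof.
move=> f0 fge mf; have mfE : measurable_fun setT (EFin \o f) by exact/measurable_EFinP.
have h0 : 0 < H by rewrite /H.
rewrite /lattice_measure ge0_integral_mscale//; last by move=> x _; rewrite lee_fin.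
rewrite ge0_integral_measure_add//; last by move=> x _; rewrite lee_fin.
rewrite !dirac_series//; last 2 first.
- move=> n Kn; apply: f0; rewrite normrM (gtr0_norm h0) ltr_pM2r// NegzE mulrNz normrN.
  by rewrite -pmulrn normr_nat ltr_nat ltnW.
- by move=> n Kn; apply: f0; rewrite normrM (gtr0_norm h0) ltr_pM2r// -pmulrn normr_nat ltr_nat.
rewrite -EFinD -EFinM; congr (_%:E).
rewrite -mulr_suml mulrC; congr (_ * _).
rewrite -(big_mkord xpredT (fun i => f ((i%:R - K%:R) * H))).
(* Indices from [K] on are the points of [Posz n]; those below [K], read backwards, are the points
   of [Negz n]. The sum over [Negz] has one more term, at [n = K], where [f] vanishes. *)
rewrite (@big_cat_nat _ _ _ K)//=; last by rewrite -addnn; lia.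
rewrite addrC; congr (_ + _).
  rewrite -[X in \sum_(X <= _ < _) _](add0n K) big_addn big_mkord.
  have -> : (K.*2.+1 - K = K.+1)%N by lia.
  by apply: eq_bigr => i _; congr (f (_ * _)); rewrite -pmulrn natrD; ring.
rewrite big_ord_recr/= f0 ?addr0; last first.
  by rewrite normrM (gtr0_norm h0) ltr_pM2r// NegzE mulrNz normrN -pmulrn normr_nat ltr_nat.
rewrite big_mkord (reindex_inj rev_ord_inj)/=; apply: eq_bigr => i _; congr (f (_ * _)).
by rewrite NegzE subnSK// mulrNz -pmulrn natrB 1?ltnW//; ring.
Qed.

Lemma lattice_integral (g : R -> R) : continuous g -> (forall x, K%:R * H < `|x| -> g x = 0) ->
  (\int[lattice_measure h]_x g x)%R = \sum_(i < K.*2.+1) g ((i%:R - K%:R) * H) * H.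
Proof.
move=> cg g0; have mg : measurable_fun setT g by exact: continuous_measurable_fun.
rewrite /Rintegral integralE.
have -> : (\int[lattice_measure h]_x ((fun x => (g x)%:E)^\+ x))%E =
    (\sum_(i < K.*2.+1) Num.max (g ((i%:R - K%:R) * H)) 0 * H)%:E.
  rewrite -(@lattice_integral_ge0 (fun x => Num.max (g x) 0)).
  - by apply: eq_integral => x _; rewrite funeposE EFin_max.
  - by move=> x /g0 ->; rewrite maxxx.
  - by move=> x; rewrite le_max lexx orbT.
  - by apply: measurable_maxr.
have -> : (\int[lattice_measure h]_x ((fun x => (g x)%:E)^\- x))%E =
    (\sum_(i < K.*2.+1) Num.max (- g ((i%:R - K%:R) * H)) 0 * H)%:E.
  rewrite -(@lattice_integral_ge0 (fun x => Num.max (- g x) 0)).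
  - by apply: eq_integral => x _; rewrite funenegE EFin_max.
  - by move=> x /g0 ->; rewrite oppr0 maxxx.
  - by move=> x; rewrite le_max lexx orbT.
  - by apply: measurable_maxr => //; exact: measurableT_comp.
rewrite -EFinB /= -sumrB; apply: eq_bigr => i _; rewrite -mulrBl; congr (_ * _).
by case: (lerP (g _) 0) => gi; case: lerP => gi'; lra.
Qed.

End LatticeIntegral.

Section LocalLimitLaws.
Variables (R : realType) (d : measure_display) (Omega : measurableType d).
Variables (P : probability Omega R) (X : finType) (xi : nat -> Omega -> X).
Variables (mu : X -> R) (p : X -> X -> R) (m : nat) (F : m.+1.-tuple X -> R).
Hypothesis chain : stationary_markov_chain P xi mu p.
Hypothesis positive_power : exists k : nat, forall i j, 0 < trans_prob p k i j.
Hypothesis row_overlap : forall i j, 0 < \sum_(k : X)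
     Num.min (trans_prob p m.+1 i k) (trans_prob p m.+1 j k).
Hypothesis col_overlap : forall i j, 0 < \sum_(k : X)
     Num.min (trans_prob p m.+1 k i) (trans_prob p m.+1 k j).
Hypothesis F_centered : pmf_int (@pmf_pow R X mu m.+1) F = 0.

Lemma chain_mu_gt0 x : 0 < mu x.
Proof.
have [k kpos] := positive_power.
apply: (mu_gt0 (stochastic_p chain) (smc_distr_ge0 chain) (smc_distr_sum1 chain) (smc_stationary chain) (k := k)).
by move=> i j; rewrite -trans_probE.
Qed.

Lemma chain_state_exists : exists x : X, True.
Proof.
apply: contrapT => /forallNP H; have := smc_distr_sum1 chain.
by rewrite big1 => [/eqP|x _]; [rewrite eq_sym oner_eq0|case: (H x)].
Qed.

(** Interface between the probabilistic part and the Fourier part: only the laws [nu N], the number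
    [v] and the two estimates are passed on. A phase gap at one [xs] up to [T] is enough, and it
    also makes [v] positive. *)
Lemma chain_laws : exists (nu : nat -> seq (R * R)) (v : R),
  [/\ forall N, finite_law (nu N),
      forall N z, z \in nu N -> exists s, z.2 = psum F N xpredT s,
      forall N f, 'E_P[fun w => f (nonconv_sum xi F N w)]%E = (law_mean (nu N) f)%:E &
      asymp_stddev P (nonconv_sum xi F) = Num.sqrt v /\
      forall (xs : m.-tuple X) T, 0 < T ->
        (forall t, 0 < t <= T -> exists y1 y2,
           cos (t * (F [tuple of rcons xs y1] - F [tuple of rcons xs y2])) != 1) ->
        [/\ 0 < v, decay nu T &
         forall A e, 0 <= A -> 0 < e -> \forall N \near \oo, forall s phi, `|s| <= A ->
           `|law_mean (nu N) (fun x => cos (s / Num.sqrt N%:R * x + phi)) -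
             cos phi * expR (- (s ^+ 2 * v / 2))| <= e]].
Proof.
have [x0 _] := chain_state_exists; pose s0 : nat -> X := fun=> x0.
have [k kpos] := positive_power.
have pnpos i j : 0 < pn p k i j by rewrite -trans_probE.
have [C C0 [th th01 mix]] := pn_mixing (stochastic_p chain) (smc_distr_ge0 chain)
  (smc_distr_sum1 chain) (smc_stationary chain) pnpos.
pose M := \sum_t `|F t|.
have FM t : `|F t| <= M by rewrite /M (bigD1 t)//= lerDl sumr_ge0.
have sk := stochastic_kern chain.
have [nu nuP] := choice (fun N => EL_law 0%N s0 (iota 1 (m.+1 * N)) (psum F N xpredT) sk).
have EN N f : trunc_ex mu p m s0 N (fun w => f (psum F N xpredT w)) = law_mean (nu N) f.
  by case: (nuP N) => _ _ H; exact: H.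
have v0 := sig2_ge0 chain s0 C0 th01 mix FM F_centered.
have vc := cvg_sig2 chain s0 C0 th01 mix FM F_centered.
have vE := asymp_stddevE chain s0 C0 th01 mix FM F_centered.
exists nu, (limn (fun N => second_moment P xi F N / N%:R)); split.
- by move=> N; case: (nuP N).
- by move=> N; case: (nuP N).
- by move=> N f; rewrite (expectation_nonconv_sum chain F s0 N f) EN.
split=> // xs T T0 gap.
have [c c0 dec] := chain_charfun_decay chain positive_power row_overlap col_overlap s0 T0 gap.
split.
- exact: (sig2_gt0 chain C0 th01 mix FM F_centered T0 c0 dec).
- exists c => //; have [N1 _ NP] := dec; exists N1 => // N N1N t phi tT.
  by rewrite -(EN N (fun x => cos (t * x + phi))); exact: NP.
- move=> A e A0 e0.
  have [N1 _ NP] := charfun_cvg chain C0 th01 mix FM F_centered s0 v0 vc A0 e0.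
  exists N1 => // N N1N s phi sA.
  by rewrite -(EN N (fun x => cos (s / Num.sqrt N%:R * x + phi))); exact: NP.
Qed.

End LocalLimitLaws.

Lemma llt_errorE (R : realType) (d : measure_display) (Omega : measurableType d)
  (P : probability Omega R) (S : nat -> Omega -> R) (v : R) (g : R -> R) (I : R) (N : nat) (u : R)
  (L : seq (R * R)) : 0 < v ->
  'E_P[fun w => (g (S N w - u))%R]%E = (law_mean L (fun x => g (x - u)))%:E ->
  llt_error P S (Num.sqrt v) g I N u =
  `|kappa v * pi * Num.sqrt N%:R * law_mean L (fun x => g (x - u)) -
    expR (- (u ^+ 2 / (2 * N%:R * v))) * I|.
Proof.
move=> v0 E; rewrite /llt_error E /= sqr_sqrtr ?(ltW v0)//; congr (`|_ * _ - _|).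
have p0 := @pi_gt0 R.
have -> : kappa v * pi = Num.sqrt v * Num.sqrt (2 * pi).
  rewrite -sqrtrM ?(ltW v0)// /kappa -[X in _ * X](ger0_norm (ltW p0)) -sqrtr_sqr -sqrtrM.
    by congr Num.sqrt; move: (@pi R) p0 => q q0; field; rewrite lt0r_neq0.
  by rewrite divr_ge0 ?(ltW p0)// mulr_ge0 ?(ltW v0).
by rewrite (@sqrtrM _ (2 * pi)) ?mulr_ge0 ?(ltW p0)// mulrA.
Qed.

Lemma psum_multiples (R : realType) (X : finType) (m : nat) (F : m.+1.-tuple X -> R) (h : R) N s :
  (forall t, multiples h (F t)) -> multiples h (psum F N xpredT s).
Proof.
move=> Fh; rewrite /psum; elim/big_ind: _ => [|x y|i _]; last exact: Fh.
  by exists 0 => //; rewrite mul0r.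
exact: multiplesD.
Qed.

Theorem theorem2p7 (R : realType) (d : measure_display)
  (Omega : measurableType d) (P : probability Omega R) (X : finType)
  (xi : nat -> Omega -> X) (mu : X -> R) (p : X -> X -> R)
  (m : nat) (F : m.+1.-tuple X -> R)
  (chain : stationary_markov_chain P xi mu p)
  (positive_power : exists k : nat, forall i j, 0 < trans_prob p k i j)
  (row_overlap : forall i j, 0 < \sum_(k : X)
     Num.min (trans_prob p m.+1 i k) (trans_prob p m.+1 j k))
  (col_overlap : forall i j, 0 < \sum_(k : X)
     Num.min (trans_prob p m.+1 k i) (trans_prob p m.+1 k j))
  (F_centered : pmf_int (@pmf_pow R X mu m.+1) F = 0)
  (F_last_neq0 : exists (xs : m.-tuple X) (x : X),
     centered_last mu F xs x != 0) :
  let S := nonconv_sum xi F in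
  let sigma := asymp_stddev P S in
  forall (g : R -> R), continuous g -> compactly_supported g ->
  (forall h : {posnum R}, lattice_case mu F h%:num ->
     ereal_sup [set (llt_error P S sigma g
                       (\int[lattice_measure h]_x g x)%R N u)%:E
               | u in multiples h%:num] @[N --> \oo] --> 0%E) /\
  (nonlattice_case mu F ->
     ereal_sup [set (llt_error P S sigma g
                       (\int[@lebesgue_measure R]_x g x)%R N u)%:E
               | u in [set: R]] @[N --> \oo] --> 0%E).
Proof.
move=> S sigma g cg g_compact.
have mu0 := chain_mu_gt0 chain positive_power.
have [B B0 BP] := support_bound g_compact.
have [M gM] := compact_support_bounded cg g_compact.
have [nu [v [nu_law nu_atom nu_mean [vE laws]]]] :=
  chain_laws chain positive_power row_overlap col_overlap F_centered.
rewrite /sigma /S vE.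
have errE v0 I N u := llt_errorE I v0 (nu_mean N (fun x => g (x - u))).
split=> [h lat|nlat].
- have h0 : 0 < h%:num :> R by [].
  have T0 : 0 < pi / h%:num :> R by rewrite divr_gt0 ?pi_gt0.
  (* By [lattice_gap] every tuple has a phase gap, so a constant one serves. *)
  have [x0 _] := chain_state_exists chain.
  have [v0 dec clt] := laws [tuple x0 | i < m] _ T0 (fun t => lattice_gap mu0 [tuple x0 | i < m] lat).
  (* Rounded up so that [B <= K%:R * h%:num]. *)
  pose K := (Num.trunc (B / h%:num)).+1.
  have KP x : K%:R * h%:num < `|x| -> g x = 0.
    move=> xK; apply: BP; apply: le_lt_trans xK.
    by rewrite -ler_pdivrMr// ltW// truncnS_gt.
  rewrite (lattice_integral cg KP).
  apply: cvg_ereal_sup0 => [|N u|e e0]; first by exists 0; exists 0 => //; rewrite mul0r.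
    exact: normr_ge0.
  have nu_lat N z : z \in nu N -> multiples h%:num z.2.
    by move=> /nu_atom[s ->]; apply: psum_multiples; exact: (lattice_values mu0 lat).
  have [N1 _ NP] := lattice_limit v0 clt h0 KP nu_lat dec e0.
  by exists N1 => // N N1N u hu; rewrite errE//; exact: NP.
- have [xs gap] := nonlattice_gap nlat.
  have gap' T (t : R) : 0 < t <= T -> exists y1 y2,
      cos (t * (F [tuple of rcons xs y1] - F [tuple of rcons xs y2])) != 1.
    by move=> /andP[t0 _]; exact: gap.
  have [v0 _ clt] := laws xs 1 ltr01 (gap' 1).
  have dec T : 0 < T -> decay nu T by move=> T0; have [] := laws xs T T0 (gap' T).
  (* [nonlattice_limit] integrates [g] over [[- (B + 2), B + 2]], so the Lebesgue integral is
     brought to this interval. *)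
  have B2 : 0 <= B + 2 by rewrite addr_ge0.
  have BP2 x : B + 2 < `|x| -> g x = 0.
    by move=> xB; apply: BP; apply: le_lt_trans xB; rewrite lerDl.
  rewrite (lebesgue_integral_support B2 BP2).
  apply: cvg_ereal_sup0 => [|N u|e e0]; first by exists 0.
    exact: normr_ge0.
  have [N1 _ NP] := nonlattice_limit v0 nu_law clt cg BP gM B0 dec e0.
  by exists N1 => // N N1N u _; rewrite errE//; exact: NP.
Qed.
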